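(* Let $\omega\in\Lambda^1(\widetilde{\mathcal T}\times\mathcal M)$ be the 1-form defined by $$\omega=\sum_{\nu=1,\dots,n,\infty}\operatorname{res}_{z=a_\nu}\operatorname{Tr}\left(A(z)\,dG^{(\nu)}(z)\,{G^{(\nu)}(z)}^{-1}\right),$$ where $d=d_{\mathcal T}+d_{\mathcal M}$. Then its exterior differential $\Omega:=d\omega$ is a closed 2-form on $\mathcal M$ independent of the isomonodromic times $\vec t\in\mathcal T$ (i.e. $\Omega$ has no components involving differentials of the isomonodromic times, and its coefficients do not depend on them).
   Context: Linear systems. Consider $\frac{d\Phi}{dz}=A(z)\Phi$ with $$A(z)=\sum_{\nu=1}^n\sum_{k=1}^{r_\nu+1}\frac{A_{\nu,-k+1}}{(z-a_\nu)^k}-\sum_{k=0}^{r_\infty-1}z^kA_{\infty,-k-1},$$ where $r_\nu\in\mathbb Z_{\ge0}$, all coefficients are in $\mathfrak{sl}_N(\mathbb C)$, and $a_\infty:=\infty$. The leading coefficients $A_{\nu,-r_\nu}$ at each $\nu=1,\dots,n,\infty$ (at $\infty$: $A(z)=-z^{r_\infty-1}A_{\infty,-r_\infty}+O(z^{r_\infty-2})$) are diagonalizable, $A_{\nu,-r_\nu}=G_\nu\Theta_{\nu,-r_\nu}G_\nu^{-1}$ with $\Theta_{\nu,-r_\nu}$ diagonal, and their eigenvalues are pairwise distinct if $r_\nu\ge1$ and pairwise distinct modulo $\mathbb Z$ if $r_\nu=0$. The irregular singular points ($r_\nu>0$) are $\infty$ and $a_1,\dots,a_m$, $m\le n$. Formal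 solutions. At each singular point there is a formal solution $\Phi^{(\nu)}_{\rm form}(z)=G^{(\nu)}(z)e^{\Theta_\nu(z)}$, where $G^{(\nu)}(z)=G_\nu\left(\mathbf 1+\sum_{k\ge1}g_{\nu,k}(z-a_\nu)^k\right)$ for $\nu\le n$, $G^{(\infty)}(z)=G_\infty\left(\mathbf 1+\sum_{k\ge1}g_{\infty,k}z^{-k}\right)$ (formal series), and $\Theta_\nu(z)$ is diagonal: $$\Theta_\nu(z)=\sum_{k=-r_\nu}^{-1}\frac{\Theta_{\nu,k}}{k}(z-a_\nu)^k+\Theta_{\nu,0}\ln(z-a_\nu)\ (\nu\le n),\qquad \Theta_\infty(z)=-\sum_{k=1}^{r_\infty}\frac{\Theta_{\infty,-k}}{k}z^k-\Theta_{\infty,0}\ln z.$$ Monodromy data. In standard Stokes sectors $\Omega_{j,\nu}$, $j=1,\dots,2r_\nu+1$ (of opening slightly larger than $\pi/r_\nu$) around an irregular point there are unique canonical solutions $\Phi^{(\nu)}_j\simeq\Phi^{(\nu)}_{\rm form}$; at Fuchsian points the formal solution converges and $\Phi^{(\nu)}_1=\Phi^{(\nu)}_{\rm form}$. Stokes matrices: $\Phi^{(\nu)}_{j+1}=\Phi^{(\nu)}_jS^{(\nu)}_j$, $j=1,\dots,2r_\nu$; connection matrices: $\Phi^{(\nu)}_1=\Phi^{(\infty)}_1C_\nu$, $\nu=1,\dots,n$. The space $\mathcal M$ of monodromy data consists of the formal monodromy exponents $\Theta_{\nu,0}$, the connection matrices $C_\nu$ and the Stokes matrices. Times. $\mathcal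 T$ is the set of isomonodromic times $a_1,\dots,a_n$ and $(\Theta_{\nu,k})_{ll}$ with $k=-r_\nu,\dots,-1$, $\nu=1,\dots,m,\infty$, $l=1,\dots,N$; $\vec t=(t_1,\dots,t_L)$ denotes a point of it and $\widetilde{\mathcal T}$ its universal cover. $A(z)=A(z;\vec t;M)$ denotes the isomonodromic family of systems with monodromy data $M$ and times $\vec t$ (where the inverse monodromy problem is solvable); along it all canonical solutions satisfy $d_{\mathcal T}\Phi=U\Phi$ with one and the same matrix-valued 1-form $U=\sum_kU_k(z,\vec t)\,dt_k$, rational in $z$ with poles only at $a_1,\dots,a_n,\infty$. $A$ and $G^{(\nu)}$ are viewed as functions on $\widetilde{\mathcal T}\times\mathcal M$. Conventions: the differentials $d_{\mathcal T}$, $d_{\mathcal M}$ (in times and in monodromy data) act on $G^{(\nu)}(z)$ at fixed $z$; the residue of a formal Laurent series at $z=a_\nu$, $\nu\le n$, is the coefficient of $(z-a_\nu)^{-1}$, and at $z=\infty$ it is minus the coefficient of $z^{-1}$. *)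

(* Defs.v *)
From HB Require Import structures.
From mathcomp Require Import all_boot all_order all_algebra.
From mathcomp Require Import complex.
From mathcomp Require Import all_classical all_reals all_analysis.

Set Implicit Arguments.
Unset Strict Implicit.
Unset Printing Implicit Defensive.

Import Order.TTheory GRing.Theory Num.Theory.
Import numFieldNormedType.Exports.

Local Open Scope classical_set_scope.
Local Open Scope ring_scope.

Definition Cx (R : realType) : numFieldType := R[i].

Definition cexp (R : realType) (z : Cx R) : Cx R :=
  ((expR (complex.Re z) * cos (complex.Im z))
     +i* (expR (complex.Re z) * sin (complex.Im z)))%C.

Section Covering.
Variable R : realType.

Definition simply_connected (X : topologicalType) : Prop :=
  (forall x y : X, exists f : R -> X,
     [/\ {within `[0, 1]%classic, continuous f}, f 0 = x & f 1 = y]) /\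
  (forall f : R -> X, {within `[0, 1]%classic, continuous f} -> f 0 = f 1 ->
     exists H : R * R -> X,
       {within [set s | 0 <= s.1 <= 1 /\ 0 <= s.2 <= 1], continuous H} /\
       forall s : R, 0 <= s <= 1 ->
         [/\ H (0, s) = f s, H (1, s) = f 0, H (s, 0) = f 0 & H (s, 1) = f 0]).

Definition covering_map (X E : topologicalType) (T : set E) (p : X -> E) :=
  [/\ continuous p, range p = T &
  forall t, T t -> exists O : set E, [/\ open O, O t &
    exists (I : Type) (S : I -> set X) (s : I -> E -> X),
      [/\ forall i, open (S i),
          forall i j x, S i x -> S j x -> i = j,
          \bigcup_i S i = p @^-1` O &
          forall i, [/\ {within O `&` T, continuous (s i)},
            forall y, O y -> T y -> S i (s i y) /\ p (s i y) = y &
            forall x, S i x -> s i (p x) = x]]]].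

Definition universal_cover (X E : topologicalType) (T : set E) (p : X -> E) :=
  covering_map T p /\ simply_connected X.

End Covering.

Section Calculus.
Variables (R : realType) (X : topologicalType) (E : normedModType (Cx R)).
Variable p : X -> E.

(* The germ at [h = 0] of the lift to [X] of the line [h |-> p x + h *: v].  For
   a covering [p] of [T] and [v] tangent to [T], it exists and is unique. *)
Definition lift (x : X) (v : E) : Cx R -> X :=
  xget (fun=> x) [set c : Cx R -> X | c 0 = x /\
    \forall h \near (0 : Cx R), {for h, continuous c} /\ p (c h) = p x + h *: v].

Section Params.
Variable P : normedModType (Cx R).

Definition along (F : Type) (f : X * P -> F) (w : E * P) (q : X * P) :
    Cx R -> F :=
  fun h => f (lift q.1 w.1 h, q.2 + h *: w.2).

Definition dirder (F : normedModType (Cx R)) (f : X * P -> F) (w : E * P)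
  (q : X * P) : F := derive1 (along f w q) 0.

(* All iterated complex directional derivatives exist and are continuous: [f]
   belongs to a family of continuous functions closed under differentiation
   along the directions [w] with [w.1] in [V]. *)
Definition holomorphic_on (V : set E) (D : set (X * P))
    (F : normedModType (Cx R)) (f : X * P -> F) : Prop :=
  exists2 S : set (X * P -> F), S f & forall g, S g ->
    (forall q, D q -> {for q, continuous g}) /\
    (forall w, V w.1 -> exists2 g', S g' &
       forall q, D q -> is_derive (0 : Cx R) 1 (along g w q) (g' q)).

(* Exterior derivative of a 1-form [om] (with [om q w] its value at [q] on the
   tangent vector [w]), evaluated on constant vector fields, which commute. *)
Definition ext_d (om : X * P -> E * P -> Cx R) (q : X * P) (w1 w2 : E * P) :
    Cx R :=
  dirder (om ^~ w2) w1 q - dirder (om ^~ w1) w2 q.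

End Params.
End Calculus.

Definition holomorphic (R : realType) (P F : normedModType (Cx R)) (B : set P)
    (f : P -> F) : Prop :=
  exists2 S : set (P -> F), S f & forall g, S g ->
    (forall u, B u -> {for u, continuous g}) /\
    (forall e, exists2 g', S g' & forall u, B u -> is_derive u e g (g' u)).

Record closed_2form (R : realType) (P : normedModType (Cx R)) (B : set P)
    (Om : P -> P -> P -> Cx R) : Prop := Closed2Form {
  form_linear : forall u e, B u -> linear (Om u e : P -> (Cx R)^o);
  form_antisym : forall u e1 e2, B u -> Om u e1 e2 = - Om u e2 e1;
  form_holomorphic : forall e1 e2,
    holomorphic B ((fun u => Om u e1 e2) : P -> Cx R);
  form_closed : forall u e1 e2 e3, B u ->
    'D_e1 ((fun u' => Om u' e2 e3) : P -> Cx R) u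
    - 'D_e2 ((fun u' => Om u' e1 e3) : P -> Cx R) u
    + 'D_e3 ((fun u' => Om u' e1 e2) : P -> Cx R) u = 0 }.

(* A power series in a local parameter [xi] is its sequence of coefficients. *)
Section PowerSeries.
Variables (K : fieldType) (N : nat).
Implicit Types f g : nat -> 'M[K]_N.

Definition ps_mul f g (k : nat) : 'M[K]_N := \sum_(i < k.+1) f i *m g (k - i)%N.

Definition ps_one (k : nat) : 'M[K]_N := if k == 0%N then 1%:M else 0.

(* With [f = f_0 (1 - e)] and [e] without constant term, this is
   [(\sum_k e^k) f_0^-1]; for [f_0] invertible. *)
Definition ps_inv f (k : nat) : 'M[K]_N :=
  let e i := if i == 0%N then 0 else - (invmx (f 0%N) *m f i) in
  (\sum_(i < k.+1) iter i (ps_mul e) ps_one k) *m invmx (f 0%N).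

(* Multiplication by [xi^s]. *)
Definition ps_shift (s : nat) f (k : nat) : 'M[K]_N :=
  if (k < s)%N then 0 else f (k - s)%N.

End PowerSeries.

(* Singular points are indexed by [option 'I_n], with [None] for infinity. *)
Section Systems.
Variables (R : realType) (N n : nat) (r : option 'I_n -> nat).

Local Notation C := (Cx R).
Local Notation sing := (option 'I_n).

(* [inl i] stands for [a_i], and [inr (nu, (k, l))] for the [l]-th diagonal
   entry of [Theta_{nu,-(k+1)}]; the latter exist only if [r nu > 0]. *)
Definition time_index : finType :=
  ('I_n + {nu : sing & ('I_(r nu) * 'I_N)%type})%type.

Definition times := 'rV[C]_#|time_index|.

(* The centre [a_nu] of the local coordinate, with [0] at infinity, where this
   coordinate is [1 / z]. *)
Definition center (t : times) (nu : sing) : C :=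
  if nu is Some i then t 0 (enum_rank (inl i : time_index)) else 0.

Definition time_theta (t : times) (nu : sing) (k : 'I_(r nu)) : 'rV[C]_N :=
  \row_l t 0 (enum_rank
    (inr (existT (fun nu => ('I_(r nu) * 'I_N)%type) nu (k, l)) : time_index)).

(* The diagonal of [Theta_{nu,-k}] for [k <= r nu], where [th0 nu] is the
   diagonal of [Theta_{nu,0}]. *)
Definition theta (t : times) (th0 : sing -> 'rV[C]_N) (nu : sing) (k : nat) :
    'rV[C]_N :=
  if k is k'.+1 then
    if @insub _ _ 'I_(r nu) k' is Some j then time_theta t j else 0
  else th0 nu.

Definition trace_free (v : times) : Prop :=
  forall (nu : sing) (k : 'I_(r nu)), \sum_l time_theta v k 0 l = 0.

Definition time_space : set times := [set t : times |
  [/\ injective (fun i : 'I_n => center t (Some i)),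
      forall (nu : sing) (k : 'I_(r nu)), k.+1 = r nu ->
        injective (time_theta t k 0) &
      trace_free t]].

(* The coefficients of [A]: [c (Some i) k] is [A_{i,-k}] for [k <= r_i], and
   [c None k] is [A_{infinity,-k-1}] for [k < r_infinity]. *)
Definition ncoef (nu : sing) : nat := if nu is Some _ then (r nu).+1 else r nu.

Definition sys_eval (t : times) (c : sing -> nat -> 'M[C]_N) (z : C) : 'M[C]_N :=
  \sum_(i < n) \sum_(k < ncoef (Some i))
     (z - center t (Some i)) ^- k.+1 *: c (Some i) k
  - \sum_(k < ncoef None) z ^+ k *: c None k.

(* The Laurent expansion of [A(z)] at [a_nu] is
   [xi ^- (pole_order nu) * \sum_k (sys_laurent t c nu k) xi^k], with
   [xi = z - a_nu] or [xi = 1 / z] (and [r None > 0]). *)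
Definition pole_order (nu : sing) : nat :=
  if nu is Some _ then (r nu).+1 else (r nu).-1.

Definition sys_laurent (t : times) (c : sing -> nat -> 'M[C]_N) (nu : sing)
    (k : nat) : 'M[C]_N :=
  if (k < ncoef nu)%N then
    (if nu is Some _ then 1 else -1) *: c nu ((ncoef nu).-1 - k)%N
  else let s := (k - ncoef nu)%N in
  if nu is Some i then
    \sum_(j < n | j != i) \sum_(m < ncoef (Some j))
       ((-1) ^+ s * 'C(m + s, s)%:R
          * (center t (Some i) - center t (Some j)) ^- (m + s).+1) *: c (Some j) m
    - \sum_(m < ncoef None | (s <= m)%N)
       ('C(m, s)%:R * center t (Some i) ^+ (m - s)) *: c None m
  else
    \sum_(j < n) \sum_(m < ncoef (Some j) | (m <= s)%N)
       ('C(s, m)%:R * center t (Some j) ^+ (s - m)) *: c (Some j) m.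

(* [d/dz] of a power series in [xi]; at infinity [d/dz = - xi^2 d/dxi]. *)
Definition ps_dz (nu : sing) (f : nat -> 'M[C]_N) (k : nat) : 'M[C]_N :=
  if nu is Some _ then k.+1%:R *: f k.+1
  else if k is k'.+1 then - (k'%:R *: f k') else 0.

(* [xi ^ (pole_order nu) * d Theta_nu / dz]. *)
Definition theta_dz (t : times) (th0 : sing -> 'rV[C]_N) (nu : sing) (k : nat) :
    'M[C]_N :=
  if (k <= r nu)%N then
    (if nu is Some _ then 1 else -1) *: diag_mx (theta t th0 nu (r nu - k)%N)
  else 0.

(* The residue at [a_nu] of [xi ^- s * \sum_k f_k xi^k]. *)
Definition residue (nu : sing) (s : nat) (f : nat -> C) : C :=
  if nu is Some _ then (if s is s'.+1 then f s' else 0) else - f s.+1.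

(* [G nu k] is the coefficient of [xi^k] in [G^(nu)(z)], that is
   [G_nu *m g_{nu,k}]; the last clause is [dG/dz + G dTheta/dz = A G]. *)
Record formal_solution (t : times) (c : sing -> nat -> 'M[C]_N)
    (th0 : sing -> 'rV[C]_N) (G : sing -> nat -> 'M[C]_N) : Prop :=
  FormalSolution {
  fs_traceless : forall nu k, (k < ncoef nu)%N -> \tr (c nu k) = 0;
  fs_nonresonant : forall nu, r nu = 0%N -> forall l l' : 'I_N, l != l' ->
    forall z : int, th0 nu 0 l - th0 nu 0 l' != z%:~R;
  fs_unit : forall nu, G nu 0%N \in unitmx;
  fs_leading : forall nu, c nu (ncoef nu).-1 =
    G nu 0%N *m diag_mx (theta t th0 nu (r nu)) *m invmx (G nu 0%N);
  fs_eq : forall nu k,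
    ps_shift (pole_order nu) (ps_dz nu (G nu)) k
      + ps_mul (G nu) (theta_dz t th0 nu) k
    = ps_mul (sys_laurent t c nu) (G nu) k }.

(* Near [a_nu] the canonical solutions are multivalued; they are written as
    functions of [zeta = ln (z - a_nu)], or [zeta = ln z] at infinity. *)

Definition orient (nu : sing) : R := if nu is Some _ then 1 else -1.

Definition near_sing (rho : R) (nu : sing) (zeta : C) : Prop :=
  orient nu * complex.Re zeta < - rho.

Definition log_point (t : times) (nu : sing) (zeta : C) : C := center t nu + cexp zeta.

Definition local_param (nu : sing) (zeta : C) : C :=
  if nu is Some _ then cexp zeta else cexp (- zeta).

(* [exp (- Theta_nu)]; in the local parameter both formulas for [Theta_nu] become
   [- \sum_k Theta_{nu,-k} / k * xi^(-k) + Theta_{nu,0} ln xi]. *)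
Definition exp_opp_Theta (t : times) (th0 : sing -> 'rV[C]_N) (nu : sing)
    (zeta : C) : 'M[C]_N :=
  let ln_param := if nu is Some _ then zeta else - zeta in
  diag_mx (\row_l cexp (- (
    - \sum_(k < r nu) theta t th0 nu k.+1 0 l / k.+1%:R
        * local_param nu zeta ^- k.+1
    + th0 nu 0 l * ln_param))).

Definition partial_sum (G : sing -> nat -> 'M[C]_N) (nu : sing) (zeta : C)
    (K : nat) : 'M[C]_N :=
  \sum_(k < K) local_param nu zeta ^+ k *: G nu k.

(* The [j]-th Stokes sector, [j = 0, ..., 2 r_nu], with initial direction [dir]
   and excess opening [del] on each side. *)
Definition in_sector (dir del : R) (nu : sing) (j : nat) (zeta : C) : Prop :=
  dir + j%:R * pi / (r nu)%:R - del < complex.Im zeta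
    < dir + j.+1%:R * pi / (r nu)%:R + del.

Definition is_canonical (t : times) (th0 : sing -> 'rV[C]_N)
    (G : sing -> nat -> 'M[C]_N) (dir : R) (nu : sing) (j : nat) (rho : R)
    (Phi : C -> 'M[C]_N) : Prop :=
  if r nu == 0%N then
    forall zeta, near_sing rho nu zeta ->
      partial_sum G nu zeta @ \oo --> Phi zeta *m exp_opp_Theta t th0 nu zeta
  else exists2 del : R, 0 < del & forall K : nat, exists (M : C) (rho' : R),
    forall zeta, near_sing rho nu zeta -> near_sing rho' nu zeta ->
      in_sector dir del nu j zeta ->
      `|Phi zeta *m exp_opp_Theta t th0 nu zeta - partial_sum G nu zeta K|
        <= M * `|local_param nu zeta| ^+ K.

(* [F] is the continuation along the path [gam] of a solution of [Y' = A Y]. *)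
Definition continued_along (A : C -> 'M[C]_N) (gam : R -> C) (F : R -> 'M[C]_N) :=
  forall s : R, 0 <= s <= 1 -> exists Y : C -> 'M[C]_N,
    (\forall z \near (gam s : C), is_derive (z : C) (1 : C) Y (A z *m Y z)) /\
    (\forall s' \near s, 0 <= s' <= 1 -> F s' = Y (gam s')).

Record mon_data := MonData {
  md_exponent : sing -> 'rV[C]_N;
  md_connection : 'I_n -> 'M[C]_N;
  md_stokes : sing -> nat -> 'M[C]_N }.

Section Family.
Variables (X : topologicalType) (p : X -> times) (d : nat).

Local Notation par := 'rV[C]_d.

(* The choices needed to define monodromy data: initial directions of the Stokes
   sectors, and paths from infinity to the [a_i] between given logarithms. *)
Record marking := Marking {
  mk_dir : sing -> R;
  mk_path : 'I_n -> X -> R -> C;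
  mk_start : 'I_n -> C;
  mk_end : 'I_n -> C }.

Record marking_on (W : set (X * par)) (rho : R) (mk : marking) : Prop :=
  MarkingOn {
  mk_isolated : forall q nu zeta, W q -> near_sing rho nu zeta ->
    forall i, log_point (p q.1) nu zeta != center (p q.1) (Some i);
  mk_near_start : forall i, near_sing rho None (mk_start mk i);
  mk_near_end : forall i, near_sing rho (Some i) (mk_end mk i);
  mk_continuous : forall i,
    {within [set y : X * R | (exists u, W (y.1, u)) /\ 0 <= y.2 <= 1],
       continuous (fun y => mk_path mk i y.1 y.2)};
  mk_avoid : forall i q s j, W q -> 0 <= s <= 1 ->
    mk_path mk i q.1 s != center (p q.1) (Some j);
  mk_path0 : forall i q, W q ->
    mk_path mk i q.1 0 = log_point (p q.1) None (mk_start mk i);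
  mk_path1 : forall i q, W q ->
    mk_path mk i q.1 1 = log_point (p q.1) (Some i) (mk_end mk i) }.

(* The canonical solutions [Phi nu j] (numbered from 0) of the system with
   coefficients [c], and its monodromy data [M], at the time [t = p x]. *)
Record has_monodromy (mk : marking) (rho : R) (x : X)
    (c G : sing -> nat -> 'M[C]_N) (Phi : sing -> nat -> C -> 'M[C]_N)
    (M : mon_data) : Prop := HasMonodromy {
  hm_formal : formal_solution (p x) c (md_exponent M) G;
  hm_solution : forall nu j zeta, (j <= (r nu).*2)%N -> near_sing rho nu zeta ->
    is_derive (zeta : C) (1 : C) (Phi nu j)
      (cexp zeta *: (sys_eval (p x) c (log_point (p x) nu zeta) *m Phi nu j zeta));
  hm_canonical : forall nu j, (j <= (r nu).*2)%N ->
    is_canonical (p x) (md_exponent M) G (mk_dir mk nu) nu j rho (Phi nu j);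
  hm_stokes : forall nu j zeta, (j < (r nu).*2)%N -> near_sing rho nu zeta ->
    Phi nu j.+1 zeta = Phi nu j zeta *m md_stokes M nu j;
  hm_connection : forall i, exists F : R -> 'M[C]_N,
    [/\ continued_along (sys_eval (p x) c) (mk_path mk i x) F,
        F 0 = Phi None 0%N (mk_start mk i) &
        Phi (Some i) 0%N (mk_end mk i) = F 1 *m md_connection M i] }.

Definition rational_at (t : times) (f : C -> 'M[C]_N) : Prop :=
  exists (K : nat) (B : 'I_n -> nat -> 'M[C]_N) (B' : nat -> 'M[C]_N),
    forall z, (forall i, z != center t (Some i)) -> f z =
      \sum_(i < n) \sum_(k < K) (z - center t (Some i)) ^- k.+1 *: B i k
      + \sum_(k < K) z ^+ k *: B' k.

(* [d_T Phi = U Phi] along [v], where [d_T] acts at fixed [z]; as the derivative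
   below is at fixed [zeta] and [z = a_nu + exp zeta], it contains in addition
   the term [(d a_nu / d v) * dPhi/dz]. *)
Definition deformation (c : X * par -> sing -> nat -> 'M[C]_N)
    (Phi : sing -> nat -> X * par -> C -> 'M[C]_N) (rho : R)
    (q : X * par) (v : times) (U : C -> 'M[C]_N) : Prop :=
  forall nu j zeta, (j <= (r nu).*2)%N -> near_sing rho nu zeta ->
    let z := log_point (p q.1) nu zeta in
    is_derive (0 : C) (1 : C) (along p (fun q' => Phi nu j q' zeta) (v, 0) q)
      (U z *m Phi nu j q zeta
       + center v nu *: (sys_eval (p q.1) (c q) z *m Phi nu j q zeta)).

Definition isomonodromic_on (W : set (X * par))
    (c G : X * par -> sing -> nat -> 'M[C]_N) : Prop :=
  exists (mk : marking) (rho : R) (mon : par -> mon_data)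
         (Phi : sing -> nat -> X * par -> C -> 'M[C]_N)
         (U : X * par -> times -> C -> 'M[C]_N),
    [/\ marking_on W rho mk,
        forall nu j, (j <= (r nu).*2)%N ->
          holomorphic_on p trace_free
            [set y : X * (par * C) | W (y.1, y.2.1) /\ near_sing rho nu y.2.2]
            (fun y : X * (par * C) => Phi nu j (y.1, y.2.1) y.2.2),
        forall q, W q ->
          has_monodromy mk rho q.1 (c q) (G q) (fun nu j => Phi nu j q)
            (mon q.2) &
        forall q v, W q -> trace_free v ->
          rational_at (p q.1) (U q v) /\ deformation c Phi rho q v (U q v)].

(* A family of systems [A(z; t; M)] with formal solutions [G], over the domain
   [D] of (lifted) times and local coordinates [u] on the space of monodromy
   data.  Since Stokes rays move with [t], a choice of standard sectors is valid
   only near a given time; hence isomonodromy is required locally.  The slices of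
   the set where the inverse monodromy problem is solvable are complements of
   analytic hypersurfaces in the universal cover of the space of times; this is
   the origin of the connectedness requirement. *)
Record isomonodromic_family (D : set (X * par))
    (c G : X * par -> sing -> nat -> 'M[C]_N) : Prop := IsomonodromicFamily {
  if_open : open D;
  if_connected : forall u, connected [set x | D (x, u)];
  if_coef : forall nu k, (k < ncoef nu)%N ->
    holomorphic_on p trace_free D (fun q => c q nu k);
  if_formal : forall nu k, holomorphic_on p trace_free D (fun q => G q nu k);
  if_isomonodromic : forall q, D q -> exists W : set (X * par),
    [/\ open W, W q, W `<=` D & isomonodromic_on W c G] }.

(* The coefficients of [dG^(nu)], with [d] acting at fixed [z]. *)
Definition dG (G : X * par -> sing -> nat -> 'M[C]_N) (q : X * par)
    (w : times * par) (nu : sing) (k : nat) : 'M[C]_N :=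
  dirder p (fun q' => G q' nu k) w q - center w.1 nu *: ps_dz nu (G q nu) k.

Definition omega (c G : X * par -> sing -> nat -> 'M[C]_N) (q : X * par)
    (w : times * par) : C :=
  \sum_nu residue nu (pole_order nu) (fun k =>
    \tr (ps_mul (ps_mul (sys_laurent (p q.1) (c q) nu) (dG G q w nu))
                (ps_inv (G q nu)) k)).

End Family.
End Systems.

(* Main.v *)
Require Import Defs.
From HB Require Import structures.
From mathcomp Require Import all_boot all_order all_algebra.
From mathcomp Require Import complex.
From mathcomp Require Import all_classical all_reals all_analysis.
From mathcomp Require Import ring lra zify.
Set Implicit Arguments.
Unset Strict Implicit.
Unset Printing Implicit Defensive.
Import Order.TTheory GRing.Theory Num.Theory.
Import numFieldNormedType.Exports.
Local Open Scope classical_set_scope.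
Local Open Scope ring_scope.

(* Multiplied by a suitable power of the local parameter xi, the system reads
   a G = xi^r (xi dG/dxi) + G theta with theta diagonal.  Conjugation by G turns the local
   contribution to omega into the coefficient of xi^r in Tr (theta G^-1 dG), and d omega, on a time
   direction v and any direction w, into - sum_nu res Tr (d_w A U_v) at fixed z, provided that
   U_v has at each a_nu the expansion prescribed by the formal solution.  As Tr (d_w A U_v) is
   rational, the sum vanishes.

   The expansion of U_v comes from differentiating the asymptotics of the first canonical solution
   with respect to the times.  No uniformity in the times is assumed, but along a sequence of points
   tending to a_nu Baire's theorem makes the remainders uniformly bounded on some small disc in
   any given disc of times, and Cauchy's estimate then bounds their derivatives.  Hence d omega
   (v, w) vanishes on a dense set, and everywhere by continuity.

   So d omega has no time components; being closed, it is locally constant in the times, and constant on the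
   connected slices. *)

(** * Complex differentiation in one variable *)

(** Two features of the setting shape the proof. [holomorphic_on] only speaks of iterated
    directional derivatives along germs of lifts, and Cauchy's estimate is obtained for such
    functions without contour integrals, from a maximum principle that uses three complex
    derivatives. The canonical asymptotics hold for each time separately, with constants depending
    on it. Since U is rational and common to all canonical solutions, one solution along one ray per
    singular point determines as many of its Laurent coefficients as wanted. Expansions and residues
    are therefore taken along numerical sequences, where asymptotic coefficients are unique.
    Derivatives at fixed z and at fixed xi differ by the velocity of a_nu times d/dxi, the source of
    all terms in [center]. The power xi^(r+2) clears the poles of d_w A and xi^(r+1) those of U_v,
    so the residue at a finite point is the coefficient of index [r.+1 + r.+1]. The exponents of
    formal monodromy come with no regularity in the parameters; that of theta follows from theta =
    G^-1 (a G - xi^r (xi dG/dxi)). *)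

Section ComplexModulus.
Variable R : realType.
Local Notation C := (Cx R).

Definition rc (x : R) : C := (x%:C)%C.
(** The norm of [Cx R] is itself a complex number, and the order of [Cx R] is partial; estimates are
    therefore carried out on its real value. *)
Definition cabs (z : C) : R := complex.Re `|z|.

Lemma normE (z : C) : `|z| = rc (cabs z).
Proof. by rewrite /cabs normc_def. Qed.

Lemma rc_le (x y : R) : (rc x <= rc y) = (x <= y). Proof. exact: lecR. Qed.
Lemma rc_lt (x y : R) : (rc x < rc y) = (x < y). Proof. exact: ltcR. Qed.
Lemma rcD (x y : R) : rc (x + y) = rc x + rc y. Proof. exact: rmorphD. Qed.
Lemma rcM (x y : R) : rc (x * y) = rc x * rc y. Proof. exact: rmorphM. Qed.
Lemma rcB (x y : R) : rc (x - y) = rc x - rc y. Proof. exact: rmorphB. Qed.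
Lemma rcX (x : R) n : rc (x ^+ n) = rc x ^+ n. Proof. exact: rmorphXn. Qed.
Lemma rc_inj : injective rc. Proof. exact: complexI. Qed.

Lemma cabs_ge0 z : 0 <= cabs z. Proof. by rewrite -rc_le -normE normr_ge0. Qed.
Lemma cabsD z w : cabs (z + w) <= cabs z + cabs w.
Proof. by rewrite -rc_le rcD -!normE ler_normD. Qed.
Lemma cabsM z w : cabs (z * w) = cabs z * cabs w.
Proof. by apply: rc_inj; rewrite rcM -!normE normrM. Qed.
Lemma cabsN z : cabs (- z) = cabs z. Proof. by rewrite /cabs normrN. Qed.
Lemma cabsBC z w : cabs (z - w) = cabs (w - z). Proof. by rewrite /cabs distrC. Qed.
Lemma cabs_rc x : cabs (rc x) = `|x|.
Proof.
apply: rc_inj; rewrite -normE [LHS]normc_def /=.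
by rewrite expr0n /= addr0 sqrtr_sqr.
Qed.
Lemma cabs0 : cabs 0 = 0. Proof. by rewrite /cabs normr0. Qed.
Lemma cabs1 : cabs 1 = 1. Proof. by rewrite /cabs normr1. Qed.
Lemma cabsX z n : cabs (z ^+ n) = cabs z ^+ n.
Proof. by apply: rc_inj; rewrite rcX -!normE normrX. Qed.
Lemma cabs_eq0 z : (cabs z == 0) = (z == 0).
Proof. by rewrite -(inj_eq rc_inj) -normE [rc 0]/(0 : C) normr_eq0. Qed.
Lemma cabs_gt0 z : (0 < cabs z) = (z != 0).
Proof. by rewrite lt0r cabs_eq0 cabs_ge0 andbT. Qed.
Lemma cabsV z : cabs z^-1 = (cabs z)^-1.
Proof. by apply: rc_inj; rewrite -normE normfV normE [RHS]fmorphV. Qed.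
Lemma cabs_nat n : cabs n%:R = n%:R.
Proof. by apply: rc_inj; rewrite -normE normr_nat [RHS]rmorph_nat. Qed.

Lemma cabsB z w : cabs (z - w) <= cabs z + cabs w.
Proof. by rewrite -(cabsN w) cabsD. Qed.

Lemma cabs_sum (I : Type) (s : seq I) (P : pred I) (F : I -> C) :
  cabs (\sum_(i <- s | P i) F i) <= \sum_(i <- s | P i) cabs (F i).
Proof.
elim/big_rec2: _ => [|i y z _ le_yz]; first by rewrite cabs0.
by apply: le_trans (cabsD _ _) _; rewrite lerD2l.
Qed.

Lemma cabs_dist z w v : cabs (z - v) <= cabs (z - w) + cabs (w - v).
Proof. by rewrite -[z - v](subrKA w) cabsD. Qed.

Lemma Re_le_cabs (z : C) : `|complex.Re z| <= cabs z.
Proof. by rewrite -rc_le -normE; exact: (@normc_ge_Re R z). Qed.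

Lemma Im_le_cabs (z : C) : `|complex.Im z| <= cabs z.
Proof.
rewrite -[cabs z]mul1r -(_ : cabs ('i%C : C) = 1); last first.
  by rewrite /cabs normc_def /= expr0n expr1n /= add0r sqrtr1.
rewrite -cabsM mulrC -normrN -ReiNIm; exact: Re_le_cabs.
Qed.

Lemma cabs_le (z : C) : cabs z <= `|complex.Re z| + `|complex.Im z|.
Proof.
rewrite {1}[z]complexE; apply: le_trans (cabsD _ _) _.
rewrite cabsM !cabs_rc (_ : cabs ('i%C : C) = 1) ?mul1r //.
by rewrite /cabs normc_def /= expr0n expr1n /= add0r sqrtr1.
Qed.

Lemma near_disc (a : C) (P : C -> Prop) :
  (\forall h \near nbhs a, P h) <->
  exists2 r : R, 0 < r & forall h, cabs (h - a) < r -> P h.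
Proof.
split=> [/nbhs_ballP[e /= e0 eP]|[r r0 rP]].
  have er : e = rc (complex.Re e).
    by rewrite /rc (@RRe_real R e) // gtr0_real.
  exists (complex.Re e); first by rewrite -rc_lt -er.
  by move=> h hr; apply: eP; rewrite -ball_normE /= distrC normE er rc_lt.
apply/nbhs_ballP; exists (rc r) => /=; first by rewrite [0 < _]rc_lt.
by move=> h; rewrite -ball_normE /= distrC normE rc_lt; apply: rP.
Qed.

Lemma cvg_cabs (T : Type) (F : set_system T) (FF : Filter F) (f : T -> C) (l : C) :
  f @ F --> l <-> forall e : R, 0 < e -> \forall t \near F, cabs (f t - l) < e.
Proof.
split=> [/cvgrPdist_lt h e e0|h].
  have /h : 0 < rc e by rewrite [0 < _]rc_lt.
  by apply: filterS => t /=; rewrite distrC normE rc_lt.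
apply/cvgrPdist_lt => e e0.
have er : e = rc (complex.Re e) by rewrite /rc (@RRe_real R e) // gtr0_real.
have /h : 0 < complex.Re e by rewrite -rc_lt -er.
by apply: filterS => t /=; rewrite distrC normE er rc_lt.
Qed.

(** Clearing the denominator removes the punctured neighbourhood from the definition of the
    derivative; most of the one-variable calculus below rests on this estimate. *)
Lemma is_deriveP (f : C -> C) (x l : C) :
  is_derive x 1 f l <-> forall e : R, 0 < e -> exists2 r : R, 0 < r &
    forall h, cabs h < r -> cabs (f (x + h) - f x - l * h) <= e * cabs h.
Proof.
have key : ((fun h => h^-1 *: ((f \o shift x) (h *: 1) - f x)) @ 0^' --> l) <->
  forall e : R, 0 < e -> exists2 r : R, 0 < r &
    forall h, cabs h < r -> cabs (f (x + h) - f x - l * h) <= e * cabs h.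
  split=> [fl e e0|h].
    have /cvg_cabs/(_ _ e0) := fl; rewrite near_withinE => /near_disc[r r0 rP].
    exists r => // h hr; have [->|h0] := eqVneq h 0.
      by rewrite addr0 mulr0 subrr subr0 cabs0 mulr0.
    have := rP h; rewrite subr0 => /(_ hr h0) /ltW.
    rewrite /= -ler_pdivrMr ?cabs_gt0 // -cabsV -cabsM mulrBl mulfK // [_ + x]addrC.
    by rewrite [h *: 1]mulr1 [_ *: _]mulrC.
  apply/cvg_cabs => e e0; rewrite near_withinE; apply/near_disc.
  have e20 : 0 < e / 2 by rewrite divr_gt0.
  have [r r0 rP] := h _ e20; exists r => // z; rewrite subr0 => zr z0 /=.
  have := rP z zr.
  rewrite -ler_pdivrMr ?cabs_gt0 // -cabsV -cabsM mulrBl mulfK // [x + _]addrC => H.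
  apply: le_lt_trans (_ : _ <= e / 2) _; last by rewrite ltr_pdivrMr // mulr_natr mulr2n ltrDl.
  by rewrite [z *: 1]mulr1 [_ *: _]mulrC.
split=> [[df dl]|H]; first by apply/(key.1); rewrite -dl; exact: df.
have fl := key.2 H.
by apply: DeriveDef; [apply/cvg_ex; exists l | apply/cvg_lim].
Qed.

Lemma is_derive_cvg (f : C -> C) (x l : C) :
  is_derive x 1 f l -> f @ nbhs x --> f x.
Proof.
move=> /is_deriveP df; apply/cvg_cabs => e e0; apply/near_disc.
have [r r0 rP] := df 1 ltr01; pose M := 1 + cabs l.
have M0 : 0 < M by rewrite ltr_pwDl ?cabs_ge0.
exists (Num.min r (e / M)); first by rewrite lt_min r0 divr_gt0.
move=> h; rewrite lt_min => /andP[hr he].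
have {}rP := rP _ hr; rewrite [x + _]addrC subrK in rP.
rewrite -[f h - f x](subrK (l * (h - x))); apply: le_lt_trans (cabsD _ _) _.
rewrite cabsM; apply: le_lt_trans (lerD rP (lexx _)) _.
by rewrite -mulrDl mulrC -ltr_pdivlMr.
Qed.

(** Restriction to a real line, followed by a real linear functional of the value: this brings the
    real mean value theorem to bear on complex functions. *)
Lemma is_derive_Re_line (f : C -> C) (w a v : C) (s : R) (l : C) :
  is_derive (a + rc s * v) 1 f l ->
  is_derive s 1 (fun s => complex.Re (w * f (a + rc s * v))) (complex.Re (w * (l * v))).
Proof.
move=> /is_deriveP df.
suff H : (fun h : R => h^-1 *: (complex.Re (w * f (a + rc (h + s) * v)) -
      complex.Re (w * f (a + rc s * v)))) @ 0^' --> complex.Re (w * (l * v)).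
  have H' : (fun h : R => h^-1 *: (((fun s => complex.Re (w * f (a + rc s * v)))
     \o shift s) (h *: 1) - complex.Re (w * f (a + rc s * v)))) @ 0^' -->
       complex.Re (w * (l * v)).
    by under eq_fun do rewrite /= [_ *: 1]mulr1.
  by apply: DeriveDef; [apply/cvg_ex; eexists; exact: H' | apply/cvg_lim].
apply/cvgrPdist_le => e e0; rewrite near_withinE.
pose M := 1 + cabs w * cabs v; pose M' := 1 + cabs v.
have M0 : 0 < M by rewrite ltr_pwDl ?mulr_ge0 ?cabs_ge0.
have M0' : 0 < M' by rewrite ltr_pwDl ?mulr_ge0 ?cabs_ge0.
have [r r0 rP] := df (e / M) (divr_gt0 e0 M0).
have : 0 < r / M' by rewrite divr_gt0.
move=> rM; apply/nbhs_ballP; exists (r / M') => // h.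
rewrite -ball_normE /= sub0r normrN => hlt h0.
have hv : cabs (rc h * v) <= `|h| * M'.
  by rewrite cabsM cabs_rc ler_wpM2l // lerDr.
have hr : cabs (rc h * v) < r.
  by apply: le_lt_trans hv _; rewrite -ltr_pdivlMr.
have := rP _ hr.
have -> : a + rc s * v + rc h * v = a + rc (h + s) * v by rewrite rcD mulrDl [rc h * v + _]addrC addrA.
move=> {}rP.
rewrite distrC -(@ler_pM2l _ `|h|) ?normr_gt0 // -normrM mulrBr [h^-1 *: _]/(_ * _).
rewrite mulVKf //.
have -> : complex.Re (w * f (a + rc (h + s) * v)) - complex.Re (w * f (a + rc s * v))
   - h * complex.Re (w * (l * v)) =
   complex.Re (w * (f (a + rc (h + s) * v) - f (a + rc s * v) - l * (rc h * v))).
  have E u : h * complex.Re u = complex.Re (rc h * u) by case: u => u1 u2 /=; rewrite mul0r subr0.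
  have EB u u' : complex.Re u - complex.Re u' = complex.Re (u - u') by case: u u' => [? ?][].
  rewrite E !EB; congr complex.Re; rewrite !mulrBr; congr (_ - _).
  by ring.
apply: le_trans (Re_le_cabs _) _; rewrite cabsM.
apply: le_trans (ler_wpM2l (cabs_ge0 _) rP) _.
rewrite cabsM cabs_rc.
rewrite (_ : _ * _ = `|h| * e * (cabs w * cabs v) / M); last by ring.
rewrite ler_pdivrMr // ler_wpM2l ?mulr_ge0 ?(ltW e0) //.
by rewrite /M lerDr.
Qed.

(** With [w = f b - f a], the real mean value theorem is applied to the real part of [conj w * f] on
    the segment from [a] to [b]: its increment is the squared modulus of [w], and its derivative is
    at most [|w| M |b - a|]. *)
Lemma mean_value_bound (f f' : C -> C) (a b : C) (M : R) :
  (forall s : R, 0 <= s <= 1 ->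
     is_derive (a + rc s * (b - a)) 1 f (f' (a + rc s * (b - a))) /\
     cabs (f' (a + rc s * (b - a))) <= M) ->
  cabs (f b - f a) <= M * cabs (b - a).
Proof.
move=> H; set w := f b - f a.
have [->|w0] := eqVneq w 0.
  by rewrite cabs0 mulr_ge0 ?cabs_ge0 // (le_trans (cabs_ge0 _) (H 0 _).2) ?lexx ?ler01.
pose wb : C := (w^*)%C.
pose g := fun s => complex.Re (wb * f (a + rc s * (b - a))).
pose dg := fun s => complex.Re (wb * (f' (a + rc s * (b - a)) * (b - a))).
have D (s : R) : 0 <= s <= 1 -> is_derive (s : R) 1 g (dg s).
  by move=> /H[? _]; exact: is_derive_Re_line.
have [||c c01 E] := @MVT _ g dg 0 1 ltr01.
- by move=> s /itvP h; apply: D; rewrite !h.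
- apply: derivable_within_continuous => s; rewrite in_itv /= => /D [+ _].
  exact.
have {E} : complex.Re (wb * w) = dg c.
  move: E; rewrite subr0 mulr1 /g /rc.
  rewrite mul0r addr0 mul1r [a + _]addrC subrK => <-.
  rewrite /w mulrBr; by case: (wb * f b) => ? ?; case: (wb * f a).
have -> : complex.Re (wb * w) = cabs w ^+ 2.
  by apply: rc_inj; rewrite rcX -normE (@sqr_normc R w) mulrC /rc (@RRe_real R) // ger0_real // (@mulcJ_ge0 R).
move=> E.
have : cabs w ^+ 2 <= cabs w * (M * cabs (b - a)).
  rewrite E; apply: le_trans (ler_norm _) _; apply: le_trans (Re_le_cabs _) _.
  rewrite !cabsM (_ : cabs wb = cabs w); last by rewrite /cabs (@normcJ R).
  rewrite ler_wpM2l ?cabs_ge0 // ler_wpM2r ?cabs_ge0 //.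
  by apply: (H c _).2; move: c01; rewrite in_itv /= => /andP[/ltW -> /ltW ->].
by rewrite expr2 ler_pM2l // cabs_gt0.
Qed.

Lemma disc_convex (a b c : C) (r s : R) : 0 <= s <= 1 ->
  cabs (a - c) < r -> cabs (b - c) < r -> cabs (a + rc s * (b - a) - c) < r.
Proof.
move=> /andP[s0 s1] ar br.
have -> : a + rc s * (b - a) - c = rc (1 - s) * (a - c) + rc s * (b - c).
  by rewrite rcB [rc 1]/(1 : C); ring.
apply: le_lt_trans (cabsD _ _) _; rewrite !cabsM !cabs_rc !ger0_norm ?subr_ge0 //.
have [->|sn1] := eqVneq s 1; first by rewrite subrr mul0r add0r mul1r.
have {sn1} s1' : 0 < 1 - s by rewrite subr_gt0 lt_neqAle sn1.
rewrite (_ : r = (1 - s) * r + s * r); last by ring.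
by rewrite ltr_leD ?ltr_pM2l // ler_wpM2l // ltW.
Qed.

Lemma mean_value_disc (f f' : C -> C) (c : C) (r M : R) :
  (forall h, cabs (h - c) < r -> is_derive h 1 f (f' h)) ->
  (forall h, cabs (h - c) < r -> cabs (f' h) <= M) ->
  forall a b, cabs (a - c) < r -> cabs (b - c) < r ->
  cabs (f b - f a) <= M * cabs (b - a).
Proof.
move=> df bf a b ar br; apply: mean_value_bound (f') _ _ _ _ => s s01.
by split; [apply: df | apply: bf]; apply: disc_convex.
Qed.

Lemma mean_value_disc0 (f f' : C -> C) (r M : R) :
  (forall h, cabs h < r -> is_derive h 1 f (f' h)) ->
  (forall h, cabs h < r -> cabs (f' h) <= M) ->
  forall h, cabs h < r -> cabs (f h - f 0) <= M * cabs h.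
Proof.
move=> df bf h hr; rewrite -{2}[h]subr0.
apply: (@mean_value_disc f f' 0 r M); rewrite ?subr0 ?cabs0 //.
- by move=> k; rewrite subr0; apply: df.
- by move=> k; rewrite subr0; apply: bf.
- by apply: le_lt_trans (cabs_ge0 _) hr.
Qed.

(** A partial derivative in [s] that is continuous at the origin and a bare derivative in [h] there
    are enough: the mean value bound in [s] controls the first increment. This is what makes
    directional derivatives additive. *)
Lemma is_derive_diagonal (phi phi1 : C -> C -> C) (l2 : C) (r0 : R) : 0 < r0 ->
  (forall s h, cabs s < r0 -> cabs h < r0 -> is_derive s 1 (phi ^~ h) (phi1 s h)) ->
  (forall e : R, 0 < e -> exists2 r : R, 0 < r &
     forall s h, cabs s < r -> cabs h < r -> cabs (phi1 s h - phi1 0 0) <= e) ->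
  is_derive (0 : C) 1 (phi 0) l2 ->
  is_derive (0 : C) 1 (fun h => phi h h) (phi1 0 0 + l2).
Proof.
move=> r00 d1 c1 /is_deriveP d2; apply/is_deriveP => e e0.
have e20 : 0 < e / 2 by rewrite divr_gt0.
have [r r0' rP] := c1 _ e20; have [r' r0'' rP'] := d2 _ e20.
exists (Num.min r0 (Num.min r r')); first by rewrite !lt_min r00 r0'.
move=> h; rewrite !lt_min => /and3P[h0 hr hr'].
rewrite !add0r.
have -> : phi h h - phi 0 0 - (phi1 0 0 + l2) * h =
  ((phi h h - phi1 0 0 * h) - (phi 0 h - phi1 0 0 * 0)) + (phi 0 (0 + h) - phi 0 0 - l2 * h).
  by rewrite add0r; ring.
apply: le_trans (cabsD _ _) _.
rewrite [e]splitr mulrDl; apply: lerD; last exact: rP'.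
have := @mean_value_disc0 (fun s => phi s h - phi1 0 0 * s) (fun s => phi1 s h - phi1 0 0)
  (Num.min r0 r) (e / 2) _ _ h.
apply.
- move=> s; rewrite lt_min => /andP[s0 sr].
  have := d1 s h s0 h0 => ?.
  have H : is_derive s 1 (phi ^~ h - (fun s => phi1 0 0 * s)) (phi1 s h - phi1 0 0 * 1).
    by apply: is_deriveB; exact: (is_deriveZ id).
  by rewrite mulr1 in H.
- by move=> s; rewrite lt_min => /andP[s0 sr]; apply: rP.
- by rewrite lt_min h0.
Qed.

(** The mean value bound is used twice: in [s] on the increments in [h], and inside it in [h] on
    [phi1]. *)
Lemma mixed_difference (phi phi1 phi12 : C -> C -> C) (r0 : R) : 0 < r0 ->
  (forall s h, cabs s < r0 -> cabs h < r0 -> is_derive s 1 (phi ^~ h) (phi1 s h)) ->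
  (forall s h, cabs s < r0 -> cabs h < r0 -> is_derive h 1 (phi1 s) (phi12 s h)) ->
  (forall e : R, 0 < e -> exists2 r : R, 0 < r &
     forall s h, cabs s < r -> cabs h < r -> cabs (phi12 s h - phi12 0 0) <= e) ->
  forall e : R, 0 < e -> exists2 r : R, 0 < r & forall h, cabs h < r ->
    cabs (phi h h - phi h 0 - phi 0 h + phi 0 0 - phi12 0 0 * h ^+ 2) <= e * cabs h ^+ 2.
Proof.
move=> r00 d1 d12 c12 e e0; have [r r0' rP] := c12 _ e0.
exists (Num.min r0 r); first by rewrite !lt_min r00 r0'.
move=> h hr; have := hr; rewrite !lt_min => /andP[h0 hr'].
have z0 : cabs 0 < r0 by rewrite cabs0.
have -> : phi h h - phi h 0 - phi 0 h + phi 0 0 - phi12 0 0 * h ^+ 2 =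
  ((phi h h - phi h 0) - (phi12 0 0 * h) * h) - ((phi 0 h - phi 0 0) - (phi12 0 0 * h) * 0).
  by ring.
have := @mean_value_disc0 (fun s => (phi s h - phi s 0) - (phi12 0 0 * h) * s)
  (fun s => phi1 s h - phi1 s 0 - phi12 0 0 * h)
  (Num.min r0 r) (e * cabs h) _ _ h.
rewrite expr2 mulrA; apply.
- move=> s; rewrite lt_min => /andP[s0 sr].
  have := d1 s h s0 h0 => ?; have := d1 s 0 s0 z0 => ?.
  have H : is_derive s 1 ((phi ^~ h - phi ^~ 0) - (fun s => phi12 0 0 * h * s))
     ((phi1 s h - phi1 s 0) - phi12 0 0 * h * 1).
    by apply: is_deriveB; exact: (is_deriveZ id).
  by rewrite mulr1 in H.
- move=> s; rewrite lt_min => /andP[s0 sr].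
  have -> : phi1 s h - phi1 s 0 - phi12 0 0 * h =
    (phi1 s h - phi12 0 0 * h) - (phi1 s 0 - phi12 0 0 * 0) by ring.
  have := @mean_value_disc0 (fun k => phi1 s k - phi12 0 0 * k)
    (fun k => phi12 s k - phi12 0 0) (Num.min r0 r) e _ _ h.
  apply => [k|k|].
  + rewrite lt_min => /andP[k0 kr].
    have := d12 s k s0 k0 => ?.
    have H : is_derive k 1 (phi1 s - (fun s => phi12 0 0 * s)) (phi12 s k - phi12 0 0 * 1).
      by apply: is_deriveB; exact: (is_deriveZ id).
    by rewrite mulr1 in H.
  + by rewrite lt_min => /andP[k0 kr]; apply: rP.
  + by rewrite lt_min h0.
- by rewrite lt_min h0.
Qed.

(** Schwarz's theorem: the second difference is symmetric in the two variables, so after division by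
    [h^2] it approximates both mixed derivatives. Were they at distance [e], two errors of [e / 3]
    could not bridge it. *)
Lemma mixed_derivatives_commute (phi phi1 phi2 phi12 phi21 : C -> C -> C) (r0 : R) : 0 < r0 ->
  (forall s h, cabs s < r0 -> cabs h < r0 -> is_derive s 1 (phi ^~ h) (phi1 s h)) ->
  (forall s h, cabs s < r0 -> cabs h < r0 -> is_derive h 1 (phi s) (phi2 s h)) ->
  (forall s h, cabs s < r0 -> cabs h < r0 -> is_derive h 1 (phi1 s) (phi12 s h)) ->
  (forall s h, cabs s < r0 -> cabs h < r0 -> is_derive s 1 (phi2 ^~ h) (phi21 s h)) ->
  (forall e : R, 0 < e -> exists2 r : R, 0 < r &
     forall s h, cabs s < r -> cabs h < r -> cabs (phi12 s h - phi12 0 0) <= e) ->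
  (forall e : R, 0 < e -> exists2 r : R, 0 < r &
     forall s h, cabs s < r -> cabs h < r -> cabs (phi21 s h - phi21 0 0) <= e) ->
  phi12 0 0 = phi21 0 0.
Proof.
move=> r00 d1 d2 d12 d21 c12 c21.
apply/eqP; rewrite -subr_eq0 -cabs_eq0; apply/negPn/negP => n0.
set e := cabs _ in n0.
have e0 : 0 < e by rewrite lt0r n0 cabs_ge0.
have e30 : 0 < e / 3%:R by rewrite divr_gt0.
have [r r0' rP] := mixed_difference r00 d1 d12 c12 e30.
have [|||r' r0'' rP'] := @mixed_difference (fun s h => phi h s) (fun s h => phi2 h s)
  (fun s h => phi21 h s) r0 r00 _ _ _ _ e30.
- by move=> s h s0 h0; apply: d2.
- by move=> s h s0 h0; apply: d21.
- by move=> e' /c21[r1 r10 r1P]; exists r1 => // s h sr hr; apply: r1P.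
pose t := Num.min r r' / 2.
have mm : 0 < Num.min r r' by rewrite lt_min r0'.
have t0 : 0 < t by rewrite divr_gt0.
have : t < Num.min r r' by rewrite /t ltr_pdivrMr // mulr_natr mulr2n ltrDl.
rewrite lt_min => /andP[tr tr'].
have H1 := rP (rc t); have H2 := rP' (rc t).
rewrite cabs_rc ger0_norm ?(ltW t0) // in H1 H2.
have {}H1 := H1 tr; have {}H2 := H2 tr'.
have : e * t ^+ 2 <= e / 3%:R * t ^+ 2 + e / 3%:R * t ^+ 2.
  rewrite -{1}[t ^+ 2]ger0_norm ?sqr_ge0 // -cabs_rc rcX /e -cabsM.
  apply: le_trans _ (lerD H2 H1); apply: le_trans _ (cabsB _ _).
  by rewrite le_eqVlt; apply/orP; left; apply/eqP; congr cabs; ring.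
rewrite -mulrDl ler_pM2r ?exprn_gt0 //; lra.
Qed.

End ComplexModulus.

(** * Cauchy's estimate by the maximum principle *)

Section CauchyEstimate.
Variable R : realType.
Local Notation C := (Cx R).
Implicit Types f g : C -> C.

Lemma cabs_continuous : continuous (@cabs R).
Proof.
move=> z; apply/(@cvgrPdist_lt R R C (nbhs z)) => e e0.
apply/near_disc; exists e => // h he.
apply: le_lt_trans _ he; rewrite ler_norml; apply/andP; split.
  rewrite lerNl opprB lerBlDr; have := cabsD (h - z) z; by rewrite subrK.
by rewrite lerBlDr cabsBC; have := cabsD (z - h) h; rewrite subrK.
Qed.

Definition little_o f (n : nat) := forall e : R, 0 < e -> exists2 r : R, 0 < r &
  forall h, cabs h < r -> cabs (f h) <= e * cabs h ^+ n.

Lemma little_o_primitive (f f1 : C -> C) (n : nat) (r : R) : 0 < r ->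
  (forall h, cabs h < r -> is_derive h 1 f (f1 h)) -> f 0 = 0 ->
  little_o f1 n -> little_o f n.+1.
Proof.
move=> r0 df f0 of1 e e0; have [r1 r10 r1P] := of1 e e0.
exists (Num.min r r1); first by rewrite lt_min r0.
move=> h; rewrite lt_min => /andP[hr hr1].
have := @mean_value_bound R f f1 0 h (e * cabs h ^+ n); rewrite f0 !subr0.
rewrite exprSr mulrA; apply => s /andP[s0 s1]; rewrite add0r.
have sh : cabs (rc s * h) <= cabs h.
  by rewrite cabsM cabs_rc ger0_norm // ler_piMl ?cabs_ge0.
split; first by apply: df; apply: le_lt_trans sh hr.
apply: le_trans (r1P _ (le_lt_trans sh hr1)) _.
by rewrite ler_wpM2l ?(ltW e0) // lerXn2r ?nnegrE ?cabs_ge0.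
Qed.

Lemma is_derive_shift0 f (a x l : C) : is_derive (a + x) 1 f l ->
  is_derive x 1 (fun h => f (a + h)) l.
Proof.
by move=> /is_deriveP df; apply/is_deriveP => e /df[r r0 rP]; exists r => // h /rP; rewrite addrA.
Qed.

Lemma is_derive_lincomb f g (x k lf lg : C) : is_derive x 1 f lf -> is_derive x 1 g lg ->
  is_derive x 1 (fun h => f h - k * g h) (lf - k * lg).
Proof. by move=> df dg; apply: (@is_deriveB _ _ _ f (fun h => k * g h)); exact: is_deriveZ. Qed.

Lemma is_derive_affine (x a b : C) : is_derive x 1 (fun h : C => a + b * h) b.
Proof.
apply/is_deriveP => e e0; exists 1 => // h _.
rewrite (_ : _ - _ = 0); last by ring.
by rewrite cabs0 mulr_ge0 ?cabs_ge0 // ltW.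
Qed.

Lemma is_derive_pow (x : C) n : is_derive x 1 (fun h : C => h ^+ n) (n%:R * x ^+ n.-1).
Proof.
by apply: DeriveDef; [exact: exprn_derivable | rewrite exp_derive [_ *: 1]mulr1].
Qed.

Lemma taylor1 f (l : C) : is_derive (0 : C) 1 f l -> little_o (fun h => f h - f 0 - l * h) 1.
Proof.
move=> /is_deriveP df e /df[r r0 rP]; exists r => // h /rP.
by rewrite add0r expr1.
Qed.

Lemma taylor2 (f f1 : C -> C) (l : C) (r : R) : 0 < r ->
  (forall h, cabs h < r -> is_derive h 1 f (f1 h)) -> is_derive (0 : C) 1 f1 l ->
  little_o (fun h => f h - f 0 - f1 0 * h - l / 2 * h ^+ 2) 2.
Proof.
move=> r0 df df1.
apply: (little_o_primitive (f1 := fun h => f1 h - f1 0 - l * h) r0 _ _ _).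
- move=> h /df d.
  have H := @is_derive_lincomb _ (fun h : C => h ^+ 2) h (l / 2) _ _
    (@is_derive_lincomb _ (fun h : C => f 0 + f1 0 * h) h 1 _ _ d (is_derive_affine _ _ _)) (is_derive_pow h 2).
  rewrite !mul1r in H.
  have -> : f1 h - f1 0 - l * h = f1 h - f1 0 - l / 2 * (2%:R * h ^+ 1).
    by field.
  move: H; congr (is_derive _ _ _ _).
  by apply/funext => k; rewrite mul1r opprD addrA.
- by rewrite subrr mulr0 expr0n /= mulr0 !subr0.
- exact: taylor1.
Qed.

Lemma taylor3 (f f1 f2 : C -> C) (l : C) (r : R) : 0 < r ->
  (forall h, cabs h < r -> is_derive h 1 f (f1 h)) ->
  (forall h, cabs h < r -> is_derive h 1 f1 (f2 h)) -> is_derive (0 : C) 1 f2 l ->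
  little_o (fun h => f h - f 0 - f1 0 * h - f2 0 / 2 * h ^+ 2 - l / 6%:R * h ^+ 3) 3.
Proof.
move=> r0 df df1 df2.
apply: (little_o_primitive (f1 := fun h => f1 h - f1 0 - f2 0 * h - l / 2 * h ^+ 2) r0 _ _ _).
- move=> h /df d.
  have H := @is_derive_lincomb _ (fun h : C => h ^+ 3) h (l / 6%:R) _ _
    (@is_derive_lincomb _ (fun h : C => h ^+ 2) h (f2 0 / 2) _ _
    (@is_derive_lincomb _ (fun h : C => f 0 + f1 0 * h) h 1 _ _ d (is_derive_affine _ _ _))
      (is_derive_pow h 2)) (is_derive_pow h 3).
  rewrite !mul1r in H.
  have -> : f1 h - f1 0 - f2 0 * h - l / 2 * h ^+ 2 =
     f1 h - f1 0 - f2 0 / 2 * (2%:R * h ^+ 1) - l / 6%:R * (3%:R * h ^+ 2).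
    by field.
  move: H; congr (is_derive _ _ _ _).
  by apply/funext => k; rewrite mul1r opprD addrA.
- by rewrite subrr mulr0 !expr0n /= !mulr0 !subr0.
- exact: taylor2 df1 df2.
Qed.

(** A mean value property of second order: the discrete Laplacian over [h0 + t], [h0 - t],
    [h0 + i t], [h0 - i t] is [o(t^2)]. Together with continuity it is all that the maximum
    principle asks of a holomorphic function. *)
Definition four_point g (h0 : C) := forall e : R, 0 < e -> exists2 r : R, 0 < r &
  forall t : R, 0 < t < r ->
  cabs (g (h0 + rc t) + g (h0 - rc t) + g (h0 + 'i%C * rc t) + g (h0 - 'i%C * rc t)
    - 4%:R * g h0) <= e * t ^+ 2.

Lemma cabs_i : cabs ('i%C : C) = 1.
Proof. by rewrite /cabs normc_def /= expr0n expr1n /= add0r sqrtr1. Qed.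

Lemma sqr_iC : ('i%C : C) ^+ 2 = -1. Proof. exact: sqr_i. Qed.

(** The four displacements sum to zero, and so do their squares because [i^2 = -1]; only the
    remainder of a quadratic Taylor formula survives. *)
Lemma four_point_taylor g (h0 q1 q2 : C) :
  little_o (fun k => g (h0 + k) - g h0 - q1 * k - q2 * k ^+ 2) 2 -> four_point g h0.
Proof.
move=> H e e0; have [r r0 rP] := H (e / 4%:R) (divr_gt0 e0 (ltr0Sn _ _)).
exists r => // t /andP[t0 tr].
have h1 := rP (rc t); have h2 := rP (- rc t).
have h3 := rP ('i%C * rc t); have h4 := rP (- ('i%C * rc t)).
rewrite ?cabsN ?cabsM cabs_rc ger0_norm ?(ltW t0) ?cabs_i ?mul1r in h1 h2 h3 h4.
have {}h1 := h1 tr; have {}h2 := h2 tr; have {}h3 := h3 tr; have {}h4 := h4 tr.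
rewrite (_ : e * t ^+ 2 = e / 4%:R * t ^+ 2 + e / 4%:R * t ^+ 2 + e / 4%:R * t ^+ 2
   + e / 4%:R * t ^+ 2); last by field.
apply: le_trans _ (lerD (lerD (lerD h1 h2) h3) h4).
apply: le_trans _ (lerD (lerD (cabsD _ _) (lexx _)) (lexx _)).
apply: le_trans _ (lerD (cabsD _ _) (lexx _)).
apply: le_trans _ (cabsD _ _).
rewrite le_eqVlt; apply/orP; left; apply/eqP; congr cabs.
have i2 := sqr_iC.
by rewrite !sqrrN !exprMn i2; ring. by [].
Qed.

(** If [|g 0| > B], the modulus of [g] is perturbed by [ep |z|^2]. On the square of half-side [rho]
    the sum attains its maximum inside the disc of radius [rho]. There the four-point property
    bounds [4 |g|] by the sum over the four neighbours up to [ep t^2], whereas the quadratic term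
    gains [4 ep t^2]: a contradiction. *)
Lemma maximum_modulus g (r rho B : R) : 0 < rho -> 2 * rho < r ->
  (forall h, cabs h < r -> {for h, continuous g}) ->
  (forall h, cabs h < r -> four_point g h) ->
  (forall h, rho <= cabs h -> cabs h < r -> cabs (g h) <= B) ->
  cabs (g 0) <= B.
Proof.
move=> rho0 rho_r cg fg bg; rewrite leNgt; apply/negP => Blt.
pose mk (x : R * R) : C := (x.1 +i* x.2)%C.
pose nrm2 (z : C) := complex.Re z ^+ 2 + complex.Im z ^+ 2.
have cabs2 z : cabs z ^+ 2 = nrm2 z.
  by apply: rc_inj; rewrite rcX -normE -(@add_Re2_Im2 R).
(* On the square [|z|^2 <= 2 rho^2], so the perturbation is at most half of the excess
   [|g 0| - B]. *)
pose ep := (cabs (g 0) - B) / (4%:R * rho ^+ 2).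
have ep0 : 0 < ep by rewrite divr_gt0 ?subr_gt0 // mulr_gt0 ?exprn_gt0.
pose psi z := cabs (g z) + ep * cabs z ^+ 2.
pose Sq : set (R * R) := `[-rho, rho] `*` `[-rho, rho].
have SqP x : Sq x -> cabs (mk x) <= 2 * rho.
  rewrite /Sq /= !in_itv /= -!ler_norml => -[h1 h2].
  by apply: le_trans (cabs_le _) _; rewrite mulr_natl mulr2n lerD.
have [|||c] := @compact_EVT_max (R * R)%type R (psi \o mk) Sq.
- by exists (0, 0); split; rewrite /= in_itv /= oppr_le0 ltW.
- by apply: compact_setX; exact: segment_compact.
- apply: continuous_in_subspaceT => x /set_mem xS.
  have cmk : {for x, continuous mk}.
    apply/cvg_cabs => e e0; have e20 : 0 < e / 2 by rewrite divr_gt0.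
    exists (ball x.1 (e / 2), ball x.2 (e / 2)); first by split; exact: nbhsx_ballx.
    move=> y [/=]; rewrite -!ball_normE /= => y1 y2; apply: le_lt_trans (cabs_le _) _ => /=.
    by rewrite [e]splitr ltrD // distrC.
  apply: continuous_comp => //.
  have xr : cabs (mk x) < r by apply: le_lt_trans (SqP _ xS) rho_r.
  have c1 : cabs (g z) @[z --> nbhs (mk x)] --> cabs (g (mk x)).
    by apply: continuous_comp; [exact: cg | exact: cabs_continuous].
  have c2 : ep * (cabs z * cabs z) @[z --> nbhs (mk x)] --> ep * (cabs (mk x) * cabs (mk x)).
    by apply: cvgM; [exact: cvg_cst | apply: cvgM; exact: cabs_continuous].
  have -> : psi = (fun z => cabs (g z)) + (fun z => ep * (cabs z * cabs z)).
    by apply/funext.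
  exact: (cvgD c1 c2).
move=> /set_mem cS cmax.
have cr : cabs (mk c) < r by apply: le_lt_trans (SqP _ cS) rho_r.
have big : cabs (g 0) <= psi (mk c).
  have := cmax (0, 0); rewrite /psi /= [mk _]/(0 : C) cabs0 expr0n /= mulr0 addr0; apply.
  by apply/mem_set; split; rewrite /= in_itv /= oppr_le0 ltW.
have inside : cabs (mk c) < rho.
  rewrite ltNge; apply/negP => /bg/(_ cr) gB.
  have : psi (mk c) < cabs (g 0).
    rewrite /psi; apply: le_lt_trans (_ : _ <= B + ep * (2 * rho) ^+ 2 / 2) _; last first.
      rewrite /ep (_ : _ * _ / 2 = (cabs (g 0) - B) / 2); last by field; rewrite gt_eqF.
      lra.
    rewrite -mulrA lerD // ler_wpM2l ?(ltW ep0) // cabs2 /nrm2 /=.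
    move: cS => [/=]; rewrite !in_itv /= -!ler_norml => h1 h2.
    have sq (x : R) : `|x| <= rho -> x ^+ 2 <= rho ^+ 2.
      by move=> h; rewrite -[x ^+ 2]real_normK ?num_real // lerXn2r ?nnegrE // ltW.
    have := sq _ h1; have := sq _ h2; lra.
  by rewrite ltNge big.
have [d d0 dP] := fg _ cr ep ep0.
pose t := Num.min d (rho - cabs (mk c)) / 2.
have mm : 0 < Num.min d (rho - cabs (mk c)) by rewrite lt_min d0 subr_gt0.
have t0 : 0 < t by rewrite divr_gt0.
have : t < Num.min d (rho - cabs (mk c)) by rewrite /t ltr_pdivrMr // mulr_natr mulr2n ltrDl.
rewrite lt_min => /andP[td tc].
have := dP t; rewrite t0 td => /(_ isT) fp.
have bnd (v : C) : cabs v = t -> psi (mk c + v) <= psi (mk c).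
  move=> vt; have cv : cabs (mk c + v) < rho.
    by apply: le_lt_trans (cabsD _ _) _; rewrite vt addrC -ltrBrDr.
  have -> : mk c + v = mk (complex.Re (mk c + v), complex.Im (mk c + v)).
    by case: (mk c + v).
  apply: (cmax (_, _)); apply/mem_set; split; rewrite /= in_itv /= -ler_norml.
    by apply: le_trans (Re_le_cabs _) (ltW cv).
  by apply: le_trans (Im_le_cabs _) (ltW cv).
have tt : `|t| = t by rewrite ger0_norm // ltW.
have b1 := bnd (rc t); have b2 := bnd (- rc t).
have b3 := bnd ('i%C * rc t); have b4 := bnd (- ('i%C * rc t)).
rewrite ?cabsN ?cabsM cabs_rc tt ?cabs_i ?mul1r in b1 b2 b3 b4.
have {}b1 := b1 erefl; have {}b2 := b2 erefl; have {}b3 := b3 erefl; have {}b4 := b4 erefl.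
move: b1 b2 b3 b4; rewrite /psi.
have par : cabs (mk c + rc t) ^+ 2 + cabs (mk c - rc t) ^+ 2 + cabs (mk c + 'i%C * rc t) ^+ 2 +
    cabs (mk c - 'i%C * rc t) ^+ 2 = 4%:R * cabs (mk c) ^+ 2 + 4%:R * t ^+ 2.
  by rewrite !cabs2 /nrm2 /mk; case: (c) => x y /=; ring.
have tri : 4%:R * cabs (g (mk c)) <= cabs (g (mk c + rc t)) + cabs (g (mk c - rc t)) +
   cabs (g (mk c + 'i%C * rc t)) + cabs (g (mk c - 'i%C * rc t)) + ep * t ^+ 2.
  apply: le_trans _ (lerD (lexx _) fp).
  apply: le_trans _ (lerD (lerD (lerD (cabsD _ _) (lexx _)) (lexx _)) (lexx _)).
  apply: le_trans _ (lerD (lerD (cabsD _ _) (lexx _)) (lexx _)).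
  apply: le_trans _ (lerD (cabsD _ _) (lexx _)).
  apply: le_trans _ (cabsB _ _).
  by rewrite opprB addrC subrK cabsM cabs_nat.
move=> b1 b2 b3 b4.
have ept : 0 < ep * t ^+ 2 by rewrite mulr_gt0 ?exprn_gt0.
have : ep * (cabs (mk c + rc t) ^+ 2 + cabs (mk c - rc t) ^+ 2 + cabs (mk c + 'i%C * rc t) ^+ 2 +
    cabs (mk c - 'i%C * rc t) ^+ 2) = ep * (4%:R * cabs (mk c) ^+ 2 + 4%:R * t ^+ 2) by rewrite par.
rewrite !mulrDr; lra.
Qed.


(** The divided difference at the origin with its removable singularity filled in by [l], as in the
    proof of Schwarz's lemma. *)
Definition slope f (l : C) (h : C) : C := if h == 0 then l else (f h - f 0) / h.

(** Away from the origin, a second-order Taylor formula for [f] can be divided by [h]; at the origin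
    division costs one order, which is why a third derivative is asked for. *)
Lemma four_point_slope (f f1 f2 f3 : C -> C) (r : R) (h0 : C) : cabs h0 < r ->
  (forall h, cabs h < r -> is_derive h 1 f (f1 h)) ->
  (forall h, cabs h < r -> is_derive h 1 f1 (f2 h)) ->
  (forall h, cabs h < r -> is_derive h 1 f2 (f3 h)) ->
  four_point (slope f (f1 0)) h0.
Proof.
move=> hr df df1 df2.
have r0 : 0 < r by apply: le_lt_trans (cabs_ge0 _) hr.
have z0 : cabs 0 < r by rewrite cabs0.
have [->|h00] := eqVneq h0 0.
  apply: (@four_point_taylor _ _ (f2 0 / 2) (f3 0 / 6%:R)) => e e0.
  have [r1 r10 r1P] := @taylor3 f f1 f2 (f3 0) r r0 df df1 (df2 _ z0) e e0.
  exists r1 => // h hr1; rewrite add0r /slope eqxx.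
  have [->|h0'] := eqVneq h 0.
    by rewrite !expr0n /= !mulr0 subrr !subr0 cabs0 expr0n /= mulr0.
  have := r1P _ hr1; rewrite [cabs h ^+ 3]exprSr mulrA -ler_pdivrMr ?cabs_gt0 // -cabsV -cabsM.
  by congr (cabs _ <= _); field.
(* The Taylor coefficients of the quotient at [h0], found by comparing coefficients in [f (h0 + h) -
   f 0 = (h0 + h) (q0 + q1 h + q2 h^2 + ...)]. *)
set q0 := slope f (f1 0) h0; pose q1 := (f1 h0 - q0) / h0; pose q2 := (f2 h0 / 2 - q1) / h0.
apply: (@four_point_taylor _ _ q1 q2) => e e0.
pose M := cabs h0 / 2.
have M0 : 0 < M by rewrite divr_gt0 ?cabs_gt0.
pose e' := e * M / 2.
have e'0 : 0 < e' by apply: divr_gt0 => //; apply: mulr_gt0.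
have rh : 0 < r - cabs h0 by rewrite subr_gt0.
have dom h : cabs h < r - cabs h0 -> cabs (h0 + h) < r.
  by move=> ?; apply: le_lt_trans (cabsD _ _) _; rewrite addrC -ltrBrDr.
have [||r1 r10 r1P] := @taylor2 (fun h => f (h0 + h)) (fun h => f1 (h0 + h)) (f2 h0) (r - cabs h0) rh _ _ e' e'0.
- by move=> h /dom/df; exact: is_derive_shift0.
- by apply: is_derive_shift0; rewrite addr0; exact: df1.
pose Q := 1 + cabs q2.
have Q0 : 0 < Q by rewrite ltr_pwDl ?cabs_ge0.
exists (Num.min r1 (Num.min M (e' / Q))); first by rewrite !lt_min r10 M0 divr_gt0.
move=> h; rewrite !lt_min => /and3P[h1 hM hQ].
have := r1P _ h1; rewrite addr0.
have nz : M <= cabs (h0 + h).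
  have := cabsB (h0 + h) h; rewrite addrK.
  by move: hM; rewrite /M; lra.
have hn0 : h0 + h != 0 by rewrite -cabs_gt0 (lt_le_trans M0).
have E : (h0 + h) * (slope f (f1 0) (h0 + h) - q0 - q1 * h - q2 * h ^+ 2) =
  (f (h0 + h) - f h0 - f1 h0 * h - f2 h0 / 2 * h ^+ 2) - q2 * h ^+ 3.
  rewrite /q2 /q1 /q0 /slope (negbTE hn0) (negbTE h00); field.
  by rewrite h00.
move=> H; rewrite -(@ler_pM2l _ (cabs (h0 + h))) ?cabs_gt0 // -cabsM E.
apply: le_trans (cabsB _ _) _; apply: le_trans (lerD H (lexx _)) _.
rewrite cabsM cabsX [cabs h ^+ 3]exprS mulrA -mulrDl [leRHS]mulrA.
rewrite ler_wpM2r ?exprn_ge0 ?cabs_ge0 //.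
apply: (@le_trans _ _ (M * e)); last by rewrite ler_wpM2r // ltW.
have : cabs q2 * cabs h <= e'.
  have : Q * cabs h <= e' by move: hQ; rewrite ltr_pdivlMr // mulrC => /ltW.
  apply: le_trans; rewrite ler_wpM2r ?cabs_ge0 // /Q lerDr //.
rewrite /e'; lra.
Qed.

Lemma slope_continuous (f f1 : C -> C) (r : R) (h0 : C) : cabs h0 < r ->
  (forall h, cabs h < r -> is_derive h 1 f (f1 h)) ->
  {for h0, continuous (slope f (f1 0))}.
Proof.
move=> hr df; have [->|h00] := eqVneq h0 0.
  have z0 : cabs 0 < r by rewrite cabs0 (le_lt_trans (cabs_ge0 _) hr).
  have /is_deriveP d := df _ z0.
  apply/(@cvg_cabs R C (nbhs (0 : C))) => e e0; apply/near_disc; have e20 : 0 < e / 2 by rewrite divr_gt0.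
  have [r1 r10 r1P] := d _ e20; exists r1 => // h; rewrite subr0 => hr1.
  rewrite /slope eqxx; case: eqVneq => [_|h0']; first by rewrite subrr cabs0.
  apply: le_lt_trans (_ : _ <= e / 2) _; last by rewrite ltr_pdivrMr // mulr_natr mulr2n ltrDl.
  have := r1P _ hr1; rewrite add0r -ler_pdivrMr ?cabs_gt0 // -cabsV -cabsM.
  by congr (cabs _ <= _); field.
have c1 : ((f h - f 0) / h) @[h --> nbhs h0] --> ((f h0 - f 0) / h0).
  apply: cvgM; first by apply: cvgB; [exact: is_derive_cvg (df _ hr) | exact: cvg_cst].
  by apply: cvgV.
suff : slope f (f1 0) @ nbhs h0 --> slope f (f1 0) h0 by [].
rewrite {2}/slope (negbTE h00).
apply: cvg_trans c1; apply: near_eq_cvg.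
apply/near_disc; exists (cabs h0); first by rewrite cabs_gt0.
move=> h; rewrite /slope; case: eqVneq => // ->.
by rewrite sub0r cabsN ltxx.
Qed.

(** The derivative at the origin is the value there of the divided difference. On [r/4 <= |h| < r]
    this quotient is at most [2 M / (r/4)], whence the constant 8, and the maximum principle carries
    the bound to the origin. *)
Theorem cauchy_estimate (f f1 f2 f3 : C -> C) (r M : R) : 0 < r ->
  (forall h, cabs h < r -> is_derive h 1 f (f1 h)) ->
  (forall h, cabs h < r -> is_derive h 1 f1 (f2 h)) ->
  (forall h, cabs h < r -> is_derive h 1 f2 (f3 h)) ->
  (forall h, cabs h < r -> cabs (f h) <= M) ->
  cabs (f1 0) <= 8%:R * M / r.
Proof.
move=> r0 df df1 df2 bf.
pose rho := r / 4%:R.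
have rho0 : 0 < rho by rewrite divr_gt0.
have -> : f1 0 = slope f (f1 0) 0 by rewrite /slope eqxx.
apply: (@maximum_modulus _ r rho) => //.
- by rewrite /rho; lra.
- by move=> h hr; exact: slope_continuous df.
- by move=> h hr; exact: four_point_slope df1 df2.
move=> h hrho hr; have h0 : h != 0 by rewrite -cabs_gt0 (lt_le_trans rho0).
rewrite /slope (negbTE h0) cabsM cabsV ler_pdivrMr ?cabs_gt0 //.
apply: le_trans (cabsB _ _) _.
apply: le_trans (lerD (bf _ hr) (bf _ _)) _; first by rewrite cabs0.
have M0 : 0 <= M by apply: le_trans (cabs_ge0 _) (bf _ hr).
apply: (@le_trans _ _ (8%:R * M / r * rho)); last first.
  by rewrite ler_wpM2l // divr_ge0 ?mulr_ge0 // ltW.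
rewrite /rho (_ : 8%:R * M / r * (r / 4%:R) = 2 * M); last by field; rewrite gt_eqF.
lra.
Qed.

End CauchyEstimate.

(** * From pointwise to uniform bounds: Baire's theorem in the plane *)

HB.instance Definition _ (R : realType) (m n : nat) :=
  NormedModule.copy 'M[R]_(m, n) 'M[R]_(m, n).

Section Osgood.
Variable R : realType.
Local Notation C := (Cx R).

Let toC (x : 'rV[R]_2) : C := (x 0 0 +i* x 0 1)%C.
Let ofC (z : C) : 'rV[R]_2 := \row_j (if j == 0 then complex.Re z else complex.Im z).

Let ofCK z : toC (ofC z) = z.
Proof. by rewrite /toC !mxE /=; case: z. Qed.

Let toC_continuous : continuous toC.
Proof.
move=> x; apply/(@cvg_cabs R 'rV[R]_2 (nbhs x)) => e e0.
have e20 : 0 < e / 2 by rewrite divr_gt0.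
apply/nbhs_ballP; exists (e / 2) => // y.
rewrite -ball_normE /= => xy; apply: le_lt_trans (cabs_le _) _.
have ent j : `|y 0 j - x 0 j| < e / 2.
  apply: le_lt_trans _ xy; rewrite [leRHS]/Num.Def.normr /= mx_normrE.
  apply: le_trans (le_bigmax _ (fun ij : 'I_1 * 'I_2 => `|(x - y) ij.1 ij.2|) (0, j)).
  by rewrite /= !mxE distrC.
by rewrite [e]splitr ltrD //= ent.
Qed.

(** The set [U n] where some [f i] exceeds [n] in modulus is open by continuity. If every [U n] were
    dense in the disc of radius [r / 2], Baire's theorem, applied in the real plane, would give a
    point there at which the family is unbounded. Hence some [U n] misses a small disc, on which [n]
    is a common bound. *)
Theorem osgood (I : Type) (f : I -> C -> C) (r : R) : 0 < r ->
  (forall i h, cabs h < r -> {for h, continuous (f i)}) ->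
  (forall h, cabs h < r -> exists M : R, forall i, cabs (f i h) <= M) ->
  exists (h1 : C) (rho M : R), 0 < rho /\ forall h, cabs (h - h1) < rho ->
    cabs h < r /\ forall i, cabs (f i h) <= M.
Proof.
move=> r0 cf bf.
pose U (n : nat) : set 'rV[R]_2 :=
  [set x | cabs (toC x) < r /\ exists i, n%:R < cabs (f i (toC x))].
(* Adding the outside of the smaller disc turns density in that disc into density in the plane, and
   confines an open set disjoint from the union to the smaller disc. *)
pose V : set 'rV[R]_2 := [set x | r / 2 < cabs (toC x)].
have cabs_toC x : {for x, continuous (fun y => cabs (toC y))}.
  by apply: continuous_comp; [exact: toC_continuous | exact: cabs_continuous].
have oV : open V.
  rewrite openE => x Vx; exact: (cvgr_gt _ (cabs_toC x) _ Vx).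
have oU n : open (U n).
  rewrite openE => x [xr [i xi]]; rewrite /interior.
  have n1 : \forall y \near nbhs x, cabs (toC y) < r.
    exact: (cvgr_lt _ (cabs_toC x) _ xr).
  have n2 : \forall y \near nbhs x, n%:R < cabs (f i (toC y)).
    have c : {for x, continuous (fun y => cabs (f i (toC y)))}.
      apply: (@continuous_comp _ _ _ toC (@cabs R \o f i)); first exact: toC_continuous.
      by apply: continuous_comp; [exact: cf | exact: cabs_continuous].
    exact: (cvgr_gt _ c _ xi).
  by apply: filterS2 n1 n2 => y yr yn; split => //; exists i.
have [n nd] : exists n, ~ dense (U n `|` V).
  apply/not_existsP => H.
  have dd n : open (U n `|` V) /\ dense (U n `|` V).
    split; [exact: openU | exact: contrapT (H n)].
  have [||x [xr xU]] := @Baire R 'rV[R]_2 _ dd [set x | cabs (toC x) < r / 2].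
  - by exists (ofC 0); rewrite /= ofCK cabs0 divr_gt0.
  - rewrite openE => x Vx; exact: (cvgr_lt _ (cabs_toC x) _ Vx).
  rewrite /= in xr.
  have xr' : cabs (toC x) < r.
    by apply: lt_trans xr _; rewrite ltr_pdivrMr // mulr_natr mulr2n ltrDl.
  have [M MP] := bf _ xr'.
  have := xU (Num.Def.archi_bound M) Logic.I; move=> [ [_ [i iM] ] | Vx]; last by move: Vx; rewrite /V /= ltNge (ltW xr).
  move: iM; rewrite ltNge => /negP; apply; apply: le_trans (MP i) _.
  have M0 : 0 <= M by apply: le_trans (cabs_ge0 _) (MP i).
  by apply: ltW; have := archi_boundP M0.
have [Os [Os0 [oO OU]]] : exists Os : set 'rV[R]_2, Os !=set0 /\ open Os /\ Os `&` (U n `|` V) = set0.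
  apply: contrapT => H; apply: nd => Os Os0 oO; apply: contrapT => N.
  apply: H; exists Os; split => //; split => //.
  by apply/eqP; apply/negPn/negP => /set0P.
case: Os0 => x0 Ox0.
have nOU x : Os x -> ~ (U n `|` V) x by move=> Ox Ux; have : set0 x by rewrite -OU.
have {}oO : nbhs x0 Os by apply: open_nbhs_nbhs.
move/nbhs_ballP: oO => [rho /= rho0 rhoP].
(* The centre has modulus at most [r / 2], so a radius of at most [r / 4] stays within the disc of
   radius [r]. *)
exists (toC x0), (Num.min rho (r / 4%:R)), n%:R.
split; first by rewrite lt_min rho0 divr_gt0.
move=> h; rewrite lt_min => /andP[h1 h2].
have Oh : Os (ofC h).
  apply: rhoP; rewrite -ball_normE /=; apply: le_lt_trans _ h1.
  rewrite [leLHS]/Num.Def.normr /= mx_normrE; apply: bigmax_le; first exact: cabs_ge0.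
  move=> [i j] _ /=; rewrite !mxE ord1 distrC; case: ifP => [/eqP->|j0].
    by apply: le_trans (Re_le_cabs _); case: (h).
  have -> : j = 1 by case: j j0 => [[|[|?]]] //= ? _; apply/val_inj.
  by apply: le_trans (Im_le_cabs _); case: (h).
have hr : cabs h < r.
  have := cabsD (h - toC x0) (toC x0); rewrite subrK => H.
  have : cabs (toC x0) <= r / 2 by rewrite leNgt; apply/negP => ?; apply: (nOU _ Ox0); right.
  lra.
split => // i; rewrite leNgt; apply/negP => fi.
by apply: (nOU _ Oh); left; split; rewrite ofCK //; exists i.
Qed.

End Osgood.
(** * Charts of a covering *)

Section Charts.
Variables (R : realType) (E : normedModType (Cx R)).
Local Notation C := (Cx R).

Definition rnorm (V : normedModType (Cx R)) (v : V) : R := complex.Re `|v|.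

Lemma rnormE (V : normedModType C) (v : V) : `|v| = rc (rnorm v).
Proof. by rewrite /rc /rnorm (@RRe_real R `|v|) // ger0_real. Qed.

Lemma rnorm_ge0 (V : normedModType C) (v : V) : 0 <= rnorm v.
Proof. by rewrite -rc_le -rnormE normr_ge0. Qed.

Lemma rnorm0 (V : normedModType C) : rnorm (0 : V) = 0.
Proof. by rewrite /rnorm normr0. Qed.

Lemma rnormD (V : normedModType C) (v w : V) : rnorm (v + w) <= rnorm v + rnorm w.
Proof. by rewrite -rc_le rcD -!rnormE ler_normD. Qed.

Lemma rnormZ (V : normedModType C) (h : C) (v : V) : rnorm (h *: v) = cabs h * rnorm v.
Proof. by apply: rc_inj; rewrite rcM -rnormE -normE -rnormE normrZ. Qed.

Lemma near_rnorm (V : normedModType C) (a : V) (P : V -> Prop) :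
  (\forall y \near nbhs a, P y) <->
  exists2 r : R, 0 < r & forall y, rnorm (y - a) < r -> P y.
Proof.
split=> [/nbhs_ballP[e /= e0 eP]|[r r0 rP]].
  have er : e = rc (complex.Re e).
    by rewrite /rc (@RRe_real R e) // gtr0_real.
  exists (complex.Re e); first by rewrite -rc_lt -er.
  by move=> h hr; apply: eP; rewrite -ball_normE /= distrC rnormE er rc_lt.
apply/nbhs_ballP; exists (rc r) => /=; first by rewrite [0 < _]rc_lt.
by move=> h; rewrite -ball_normE /= distrC rnormE rc_lt; apply: rP.
Qed.

Definition submodule (V : set E) := V 0 /\ forall a u v, V u -> V v -> V (a *: u + v).

(** The space of times is open not in all coordinates but in the subspace of trace-free ones; points
    and directions are restricted to such a subspace [V] throughout. *)
Definition open_in (V T : set E) := T `<=` V /\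
  forall t, T t -> exists2 r : R, 0 < r & forall y, V y -> rnorm (y - t) < r -> T y.

Variables (X : topologicalType) (p : X -> E) (V T : set E).
Hypotheses (Vsub : submodule V) (TV : open_in V T) (cov : covering_map T p).

Lemma submoduleD u v : V u -> V v -> V (u + v).
Proof. by move=> Vu Vv; rewrite -[u]scale1r; apply: Vsub.2. Qed.
Lemma submoduleZ a u : V u -> V (a *: u).
Proof. by move=> Vu; rewrite -[_ *: _]addr0; apply: Vsub.2 => //; exact: Vsub.1. Qed.
Lemma submoduleB u v : V u -> V v -> V (u - v).
Proof. by move=> Vu Vv; rewrite addrC -scaleN1r; apply: Vsub.2. Qed.

Lemma covered x : T (p x).
Proof. by case: cov => _ <- _; exists x. Qed.

(** A continuous local section over a ball of [V]. The field [chart_lift] makes the germ chosen by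
    [lift] computable: near 0 it is the section evaluated along the line. *)
Record chart_at (x0 : X) (s : E -> X) (del : R) : Prop := ChartAt {
  chart_gt0 : 0 < del;
  chart_center : s (p x0) = x0;
  chart_section : forall y, V y -> rnorm (y - p x0) < del -> p (s y) = y;
  chart_continuous : forall y, V y -> rnorm (y - p x0) < del ->
    forall O, nbhs (s y) O -> exists2 e : R, 0 < e &
      forall y', V y' -> rnorm (y' - y) < e -> O (s y');
  chart_onto : \forall x \near x0, s (p x) = x /\ rnorm (p x - p x0) < del;
  chart_lift : forall y v, V y -> rnorm (y - p x0) < del -> V v ->
    \forall h \near nbhs (0 : C), Defs.lift p (s y) v h = s (y + h *: v) }.

Lemma covering_chart x0 : exists s del, chart_at x0 s del.
Proof.
have [cp _ /(_ _ (covered x0))[Os [oO Ox0 [I [S [s [oS _ SO sP]]]]]]] := cov.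
have [i _ Si] : (\bigcup_i S i) x0 by rewrite SO.
have {}sP := sP i; case: sP => cs sP sK.
have [r1 r10 r1P] := TV.2 _ (covered x0).
have /near_rnorm[r2 r20 r2P] : \forall y \near nbhs (p x0), Os y by exact: open_nbhs_nbhs.
pose del := Num.min r1 r2.
have del0 : 0 < del by rewrite lt_min r10.
have dom y : V y -> rnorm (y - p x0) < del -> Os y /\ T y.
  by move=> Vy; rewrite lt_min => /andP[/r1P-/(_ Vy) ? /r2P].
have contP y : V y -> rnorm (y - p x0) < del -> forall O', nbhs (s i y) O' ->
   exists2 e : R, 0 < e & forall y', V y' -> rnorm (y' - y) < e -> O' (s i y').
  move=> Vy yd O' nO'.
  have [Oy Ty] := dom _ Vy yd.
  have /subspace_continuousP/(_ y (conj Oy Ty) O' nO') := cs.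
  move=> /near_rnorm[e e0 eP].
  exists (Num.min e (del - rnorm (y - p x0))); first by rewrite lt_min e0 subr_gt0.
  move=> y' Vy'; rewrite lt_min => /andP[y'e y'd].
  apply: (eP _ y'e); apply: dom => //.
  rewrite -[y' - p x0](subrKA y); apply: le_lt_trans (rnormD _ _) _.
  by rewrite -ltrBrDr.
have lineP y v h : V y -> V v -> V (y + h *: v).
  by move=> Vy Vv; rewrite addrC; apply: Vsub.2.
have lineB y v : V y -> rnorm (y - p x0) < del -> \forall h \near nbhs (0 : C),
    rnorm (y + h *: v - p x0) < del.
  move=> Vy yd; apply/near_disc.
  have r0 : 0 < del - rnorm (y - p x0) by rewrite subr_gt0.
  have v1 : 0 < rnorm v + 1 by rewrite ltr_wpDl ?rnorm_ge0.
  exists ((del - rnorm (y - p x0)) / (rnorm v + 1)); first by rewrite divr_gt0.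
  move=> h; rewrite subr0 ltr_pdivlMr // => hr.
  rewrite addrAC addrC; apply: le_lt_trans (rnormD _ _) _.
  rewrite -ltrBrDr rnormZ; apply: le_lt_trans _ hr.
  by rewrite ler_wpM2l ?cabs_ge0 // lerDl.
exists (s i), del; split => //.
- exact: sK.
- by move=> y Vy yd; apply: (sP _ _ _).2; have [] := dom _ Vy yd.
- have n1 : \forall x \near x0, S i x by exact: open_nbhs_nbhs.
  have n2 : \forall x \near x0, rnorm (p x - p x0) < del.
    by apply: (cp x0 [set y | rnorm (y - p x0) < del]); apply/near_rnorm; exists del.
  by apply: filterS2 n1 n2 => x /sK.
move=> y v Vy yd Vv.
have [Oy Ty] := dom _ Vy yd.
have psy : p (s i y) = y by apply: (sP _ _ _).2.
pose good := [set c : C -> X | c 0 = s i y /\ \forall h \near (0 : C),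
    {for h, continuous c} /\ p (c h) = p (s i y) + h *: v].
have good0 : good (fun h => s i (y + h *: v)).
  split; first by rewrite scale0r addr0.
  near=> h.
  have hd : rnorm (y + h *: v - p x0) < del by near: h; exact: lineB.
  have Vh := lineP y v h Vy Vv.
  split; last first.
    by rewrite psy; apply: (sP _ _ _).2; have [] := dom _ Vh hd.
  move=> O' /(contP _ Vh hd)[e e0 eP]; apply/near_disc.
  have v1 : 0 < rnorm v + 1 by rewrite ltr_wpDl ?rnorm_ge0.
  exists (e / (rnorm v + 1)); first by rewrite divr_gt0.
  move=> k; rewrite ltr_pdivlMr // => kr; apply: eP; first exact: lineP.
  rewrite opprD addrACA subrr add0r -scalerBl rnormZ; apply: le_lt_trans _ kr.
  by rewrite ler_wpM2l ?cabs_ge0 // lerDl.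
(* A lift exists, so the chosen one has the defining properties. It begins in the sheet [S i], stays
   in it by continuity, and on this sheet [s i] inverts [p]. *)
have : good (Defs.lift p (s i y) v) by apply: (xgetPex (fun=> s i y)); exists (fun h => s i (y + h *: v)).
case=> l0 lP.
have lc : {for (0 : C), continuous (Defs.lift p (s i y) v)} by exact: (nbhs_singleton lP).1.
have : \forall h \near nbhs (0 : C), S i (Defs.lift p (s i y) v h).
  apply: (lc (S i)); rewrite l0; apply: open_nbhs_nbhs; split => //.
  exact: (sP _ _ _).1.
move=> near_S; apply: filterS2 near_S lP => h Sh [_ ph].
by rewrite -(sK _ Sh) ph psy.
Unshelve. all: by end_near. Qed.
End Charts.
(** * Holomorphic functions on the covering *)

Section Calculus.
Variable R : realType.
Local Notation C := (Cx R).

Lemma is_derive_unshift (f : C -> C) (x l : C) : is_derive (0 : C) 1 (fun h => f (x + h)) l ->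
  is_derive x 1 f l.
Proof.
move=> /is_deriveP df; apply/is_deriveP => e /df[r r0 rP]; exists r => // h /rP.
by rewrite add0r addr0.
Qed.

Lemma is_derive_scale (f : C -> C) (a x l : C) : is_derive (a * x) 1 f l ->
  is_derive x 1 (fun h => f (a * h)) (a * l).
Proof.
move=> /is_deriveP df; apply/is_deriveP => e e0.
have a1 : 0 < cabs a + 1 by rewrite ltr_wpDl ?cabs_ge0.
have [r r0 rP] := df (e / (cabs a + 1)) (divr_gt0 e0 a1).
exists (r / (cabs a + 1)); first by rewrite divr_gt0.
move=> h; rewrite ltr_pdivlMr // => hr.
have ah : cabs (a * h) <= cabs h * (cabs a + 1).
  by rewrite cabsM mulrC ler_wpM2l ?cabs_ge0 // lerDl.
have := rP _ (le_lt_trans ah hr); rewrite -mulrDr (_ : l * (a * h) = a * l * h); last by ring.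
move=> H.
apply: le_trans H _; rewrite -mulrA ler_wpM2l ?(ltW e0) //.
by rewrite mulrC ler_pdivrMr.
Qed.

Lemma near_eq_derive0 (f g : C -> C) (x l : C) : (\forall h \near nbhs x, f h = g h) ->
  is_derive x 1 f l -> is_derive x 1 g l.
Proof. exact: near_eq_is_derive. Qed.

Lemma is_derive_mul (f g : C -> C) (x lf lg : C) : is_derive x 1 f lf -> is_derive x 1 g lg ->
  is_derive x 1 (fun h => f h * g h) (lf * g x + f x * lg).
Proof.
move=> df dg; have := is_deriveM df dg.
by rewrite addrC [_ *: lf]mulrC.
Qed.

Lemma is_derive_inv (f : C -> C) (x lf : C) : is_derive x 1 f lf -> f x != 0 ->
  is_derive x 1 (fun h => (f h)^-1) (- (f x)^-1 * lf * (f x)^-1).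
Proof.
move=> [df <-] f0; apply: DeriveDef; first exact: derivableV.
rewrite deriveV //; transitivity (- f x ^- 2 * 'D_1 f x) => //; rewrite -exprVn; ring.
Qed.

Lemma is_derive_add (f g : C -> C) (x lf lg : C) : is_derive x 1 f lf -> is_derive x 1 g lg ->
  is_derive x 1 (fun h => f h + g h) (lf + lg).
Proof. by move=> df dg; exact: is_deriveD. Qed.

Lemma is_derive_uniq (f : C -> C) (x l l' : C) : is_derive x 1 f l -> is_derive x 1 f l' -> l = l'.
Proof. by move=> [_ <-] [_ <-]. Qed.
End Calculus.

Section Holomorphic.
Variables (R : realType) (E : normedModType (Cx R)) (X : topologicalType) (p : X -> E).
Local Notation C := (Cx R).
Variables (V T : set E) (P : normedModType (Cx R)) (D : set (X * P)).
Hypotheses (Vsub : submodule V) (TV : open_in V T) (cov : covering_map T p) (oD : open D).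

Definition move (w : E * P) (q : X * P) (j : C) : X * P :=
  (Defs.lift p q.1 w.1 j, q.2 + j *: w.2).

(** A lifted piece of the plane through [q0] spanned by [w1] and [w2]. The germs [lift] are chosen
    at each point separately; that they all agree with the coordinates of [Q] turns directional
    derivatives on the covering into partial derivatives in two complex variables. *)
Record plane_at (q0 : X * P) (w1 w2 : E * P) (Q : C -> C -> X * P) (r : R) : Prop := PlaneAt {
  plane_gt0 : 0 < r;
  plane_center : Q 0 0 = q0;
  plane_in : forall h k, cabs h < r -> cabs k < r -> D (Q h k);
  plane_fst : forall h k, cabs h < r -> cabs k < r ->
    p (Q h k).1 = p q0.1 + h *: w1.1 + k *: w2.1;
  plane_snd : forall h k, (Q h k).2 = q0.2 + h *: w1.2 + k *: w2.2;
  plane_move1 : forall h k, cabs h < r -> cabs k < r ->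
    \forall j \near nbhs (0 : C), move w1 (Q h k) j = Q (h + j) k;
  plane_move2 : forall h k, cabs h < r -> cabs k < r ->
    \forall j \near nbhs (0 : C), move w2 (Q h k) j = Q h (k + j);
  plane_move : forall a, \forall j \near nbhs (0 : C),
    move (a *: w1.1 + w2.1, a *: w1.2 + w2.2) q0 j = Q (a * j) j;
  plane_continuous : forall h k, cabs h < r -> cabs k < r -> forall O, nbhs (Q h k) O ->
    exists2 e : R, 0 < e & forall h' k', cabs (h' - h) < e -> cabs (k' - k) < e -> O (Q h' k') }.

Lemma plane q0 w1 w2 : D q0 -> V w1.1 -> V w2.1 -> exists Q r, plane_at q0 w1 w2 Q r.
Proof.
move=> Dq0 V1 V2.
have [s [del [del0 sc sp scont sonto slift]]] := covering_chart Vsub TV cov q0.1.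
have Vp x : V (p x) by apply: TV.1; exact: covered cov x.
pose y h k := p q0.1 + h *: w1.1 + k *: w2.1.
pose u h k := q0.2 + h *: w1.2 + k *: w2.2.
have Vy h k : V (y h k).
  by rewrite /y; do 2 ?apply: submoduleD => //; apply: submoduleZ.
(* [M] exceeds the sum of the norms of the two time components and that of the two parameter
   components, so changes of [h] and [k] below [e / M] displace either part by less than [e]. *)
pose M := 1 + rnorm w1.1 + rnorm w2.1 + rnorm w1.2 + rnorm w2.2.
have n1 := rnorm_ge0 w1.1; have n2 := rnorm_ge0 w2.1.
have n3 := rnorm_ge0 w1.2; have n4 := rnorm_ge0 w2.2.
have M0 : 0 < M by rewrite /M; lra.
have dy h k h' k' e : cabs (h' - h) < e / M -> cabs (k' - k) < e / M ->
    rnorm (y h' k' - y h k) < e /\ rnorm (u h' k' - u h k) < e.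
  rewrite !ltr_pdivlMr // => he ke.
  have -> : y h' k' - y h k = (h' - h) *: w1.1 + (k' - k) *: w2.1.
    rewrite /y opprD addrACA -scalerBl; congr (_ + _).
    by rewrite opprD addrACA subrr add0r -scalerBl.
  have -> : u h' k' - u h k = (h' - h) *: w1.2 + (k' - k) *: w2.2.
    rewrite /u opprD addrACA -scalerBl; congr (_ + _).
    by rewrite opprD addrACA subrr add0r -scalerBl.
  have a1 := cabs_ge0 (h' - h); have a2 := cabs_ge0 (k' - k).
  have e0 : 0 < e by apply: le_lt_trans he; rewrite mulr_ge0 // ltW.
  have key (a b c d : R) : 0 <= a -> 0 <= b -> 0 <= c -> 0 <= d -> 1 + c + d <= M ->
    a * M < e -> b * M < e -> a * c + b * d < e.
    move=> a0 b0 c0 d0 cdM aM bM.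
    pose t := Num.max a b.
    have tM : t * M < e by rewrite /t /Order.max; case: ifP.
    have at_ : a <= t by rewrite /t le_max lexx.
    have bt_ : b <= t by rewrite /t le_max lexx orbT.
    apply: le_lt_trans _ tM; apply: (@le_trans _ _ (t * (c + d))).
      by rewrite mulrDr lerD // ler_wpM2r.
    by rewrite ler_wpM2l ?(le_trans a0) //; lra.
  split; apply: le_lt_trans (rnormD _ _) _; rewrite !rnormZ; apply: key => //; rewrite /M; lra.
pose Q h k : X * P := (s (y h k), u h k).
have y00 : y 0 0 = p q0.1 by rewrite /y !scale0r !addr0.
have u00 : u 0 0 = q0.2 by rewrite /u !scale0r !addr0.
have Q00 : Q 0 0 = q0 by rewrite /Q y00 u00 sc; case: (q0).
have inB h k : cabs h < del / M -> cabs k < del / M -> rnorm (y h k - p q0.1) < del.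
  by move=> hd kd; rewrite -y00; apply: (dy _ _ _ _ _ _ _).1; rewrite subr0.
have contQ h k : cabs h < del / M -> cabs k < del / M -> forall Ob, nbhs (Q h k) Ob ->
    exists2 e : R, 0 < e & forall h' k', cabs (h' - h) < e -> cabs (k' - k) < e -> Ob (Q h' k').
  move=> hd kd Ob [[B1 B2] /= [nB1 nB2] B12].
  have [e1 e10 e1P] := scont _ (Vy h k) (inB _ _ hd kd) _ nB1.
  have /near_rnorm[e2 e20 e2P] := nB2.
  exists (Num.min e1 e2 / M); first by rewrite divr_gt0 // lt_min e10.
  move=> h' k' h1 k1; have := dy _ _ _ _ _ h1 k1.
  rewrite !lt_min => -[/andP[a1 _] /andP[_ a2]].
  by apply: B12; split => /=; [apply: e1P | apply: e2P].
have dM : 0 < del / M by rewrite divr_gt0.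
have [] := contQ 0 0 _ _ D; rewrite ?cabs0 //.
  by rewrite Q00; apply: open_nbhs_nbhs.
move=> e0 e00 e0P.
exists Q, (Num.min (del / M) e0).
split => //.
- by rewrite lt_min dM.
- by move=> h k; rewrite !lt_min => /andP[_ he] /andP[_ ke]; apply: e0P; rewrite subr0.
- by move=> h k; rewrite !lt_min => /andP[hd _] /andP[kd _]; apply: sp => //; apply: inB.
- move=> h k; rewrite !lt_min => /andP[hd _] /andP[kd _].
  have := slift _ _ (Vy h k) (inB _ _ hd kd) V1; apply: filterS => j E1.
  rewrite /move /Q /= E1; congr (s _, _).
    by rewrite /y scalerDl addrAC addrA.
  by rewrite /u scalerDl addrAC addrA.
- move=> h k; rewrite !lt_min => /andP[hd _] /andP[kd _].
  have := slift _ _ (Vy h k) (inB _ _ hd kd) V2; apply: filterS => j E1.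
  rewrite /move /Q /= E1; congr (s _, _).
    by rewrite /y scalerDl addrA.
  by rewrite /u scalerDl addrA.
- move=> a.
  have Vw : V (a *: w1.1 + w2.1) by apply: Vsub.2.
  have := slift _ _ (Vy 0 0) (inB 0 0 _ _) Vw; rewrite cabs0 => /(_ dM dM).
  apply: filterS => j; rewrite y00 sc => E1.
  rewrite /move /Q /= E1; congr (s _, _).
    by rewrite /y scalerDr scalerA [j * a]mulrC addrA.
  by rewrite /u scalerDr scalerA [j * a]mulrC addrA.
- move=> h k; rewrite !lt_min => /andP[hd _] /andP[kd _]; exact: contQ.
Qed.

Lemma move_near q w : D q -> V w.1 -> \forall j \near nbhs (0 : C), D (move w q j).
Proof.
move=> Dq Vw; have [Q [r pl]] := plane Dq Vw Vw.
have r0 := plane_gt0 pl.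
have := plane_move1 pl (h := 0) (k := 0); rewrite cabs0 => /(_ r0 r0); rewrite (plane_center pl).
have n2 : \forall j \near nbhs (0 : C), cabs j < r by apply/near_disc; exists r => // j; rewrite subr0.
apply: filterS2 n2 => j jr ->; rewrite add0r.
by apply: plane_in pl _ _ _ _; rewrite ?cabs0.
Qed.

Lemma move0 q w : D q -> V w.1 -> move w q 0 = q.
Proof.
move=> Dq Vw; have [Q [r pl]] := plane Dq Vw Vw.
have r0 := plane_gt0 pl.
have := plane_move1 pl (h := 0) (k := 0); rewrite cabs0 => /(_ r0 r0).
by move=> /nbhs_singleton; rewrite addr0 (plane_center pl).
Qed.

Lemma along0 (F : Type) (f : X * P -> F) q w : D q -> V w.1 -> along p f w q 0 = f q.
Proof. by move=> Dq Vw; rewrite -[along _ _ _ _ _]/(f (move w q 0)) move0. Qed.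

Definition stable_family (F : normedModType C) (S : set (X * P -> F)) := forall g, S g ->
  (forall q, D q -> {for q, continuous g}) /\
  (forall w, V w.1 -> exists2 g', S g' &
     forall q, D q -> is_derive (0 : C) 1 (along p g w q) (g' q)).

Definition holo (f : X * P -> C) : Prop := holomorphic_on p V D f.

Lemma holo_stable : stable_family holo.
Proof.
move=> g [S Sg good]; split; first exact: (good g Sg).1.
move=> w /(good g Sg).2[g' Sg' dg]; exists g' => //.
by exists S.
Qed.

(** [holomorphic_on] asks for a family of functions closed under differentiation. Closure under
    algebraic operations is therefore shown by exhibiting a family: everything obtained from
    holomorphic functions by these operations, whose derivatives are again of this kind by the
    Leibniz rule and the rule for inverses. *)
Inductive generated (S : set (X * P -> C)) : (X * P -> C) -> Prop :=
| GenBase f of S f : generated S f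
| GenCst a : generated S (fun=> a)
| GenAdd f g of generated S f & generated S g : generated S (fun q => f q + g q)
| GenMul f g of generated S f & generated S g : generated S (fun q => f q * g q)
| GenInv f of generated S f & (forall q, D q -> f q != 0) : generated S (fun q => (f q)^-1)
| GenEq f g of generated S f & (forall q, D q -> f q = g q) : generated S g.

Lemma generated_stable (S : set (X * P -> C)) : stable_family S -> stable_family (generated S).
Proof.
move=> good f; elim=> {f} [f Sf|a|f g Sf [cf df] Sg [cg dg]|f g Sf [cf df] Sg [cg dg]|f Sf [cf df] f0|f g Sf [cf df] fg].
- split; first exact: (good f Sf).1.
  by move=> w /(good f Sf).2[g' Sg' dg]; exists g' => //; exact: GenBase.
- split; first by move=> q _; exact: cst_continuous.
  move=> w _; exists (fun=> 0); first exact: GenCst.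
  by move=> q _; exact: is_derive_cst.
- split; first by move=> q Dq; exact: (cvgD (F := nbhs q) (cf _ Dq) (cg _ Dq)).
  move=> w Vw; have [f' Sf' df'] := df w Vw; have [g' Sg' dg'] := dg w Vw.
  exists (fun q => f' q + g' q); first exact: GenAdd.
  by move=> q Dq; exact: (is_derive_add (df' _ Dq) (dg' _ Dq)).
- split; first by move=> q Dq; exact: (cvgM (F := nbhs q) (cf _ Dq) (cg _ Dq)).
  move=> w Vw; have [f' Sf' df'] := df w Vw; have [g' Sg' dg'] := dg w Vw.
  exists (fun q => f' q * g q + f q * g' q); first by apply: GenAdd; apply: GenMul.
  move=> q Dq; have := is_derive_mul (df' _ Dq) (dg' _ Dq).
  by rewrite !along0.
- split; first by move=> q Dq; exact: (cvgV (F := nbhs q) (f0 _ Dq) (cf _ Dq)).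
  move=> w Vw; have [f' Sf' df'] := df w Vw.
  exists (fun q => (-1 * (f q)^-1) * f' q * (f q)^-1).
    apply: GenMul; last exact: GenInv.
    apply: GenMul => //; apply: GenMul; [exact: GenCst | exact: GenInv].
  move=> q Dq; have := is_derive_inv (df' _ Dq); rewrite !along0 // mulN1r.
  by apply; exact: f0.
- split.
    move=> q Dq; suff : g @ nbhs q --> g q by [].
    rewrite -(fg _ Dq); apply: cvg_trans (cf _ Dq); apply: near_eq_cvg.
    have : \forall q \near nbhs q, D q by exact: open_nbhs_nbhs.
    by apply: filterS => q' Dq'; rewrite fg.
  move=> w Vw; have [f' Sf' df'] := df w Vw; exists f' => // q Dq.
  apply: near_eq_derive0 (df' _ Dq).
  by have := move_near Dq Vw; apply: filterS => j Dj; exact: fg.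
Qed.

Lemma holo_generated f : generated holo f -> holo f.
Proof. by move=> gf; exists (generated holo) => //; apply: generated_stable; exact: holo_stable. Qed.

Lemma holo_cst a : holo (fun=> a). Proof. exact/holo_generated/GenCst. Qed.
Lemma holoD f g : holo f -> holo g -> holo (fun q => f q + g q).
Proof. by move=> hf hg; apply/holo_generated/GenAdd; exact: GenBase. Qed.
Lemma holoM f g : holo f -> holo g -> holo (fun q => f q * g q).
Proof. by move=> hf hg; apply/holo_generated/GenMul; exact: GenBase. Qed.
Lemma holoV f : holo f -> (forall q, D q -> f q != 0) -> holo (fun q => (f q)^-1).
Proof. by move=> hf f0; apply/holo_generated/GenInv => //; exact: GenBase. Qed.
Lemma holo_eq f g : holo f -> (forall q, D q -> f q = g q) -> holo g.
Proof. by move=> hf fg; apply/holo_generated/(GenEq _ fg); exact: GenBase. Qed.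
Lemma holoN f : holo f -> holo (fun q => - f q).
Proof.
by move=> hf; apply: (holo_eq (holoM (holo_cst (-1)) hf)) => q _; rewrite mulN1r.
Qed.
Lemma holoB f g : holo f -> holo g -> holo (fun q => f q - g q).
Proof. by move=> hf hg; apply: holoD => //; exact: holoN. Qed.
Lemma holo_sum (I : Type) (s : seq I) (Pr : pred I) (f : I -> X * P -> C) :
  (forall i, Pr i -> holo (f i)) -> holo (fun q => \sum_(i <- s | Pr i) f i q).
Proof.
move=> hf; elim: s => [|i s IH].
  by apply: (holo_eq (holo_cst 0)) => q _; rewrite big_nil.
case Pi: (Pr i).
  by apply: (holo_eq (holoD (hf i Pi) IH)) => q _; rewrite big_cons Pi.
by apply: (holo_eq IH) => q _; rewrite big_cons Pi.
Qed.
Lemma holoX f n : holo f -> holo (fun q => f q ^+ n).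
Proof.
move=> hf; elim: n => [|n IH]; first exact: holo_cst.
by apply: (holo_eq (holoM hf IH)) => q _; rewrite exprS.
Qed.
Lemma holo_prod (I : Type) (s : seq I) (Pr : pred I) (f : I -> X * P -> C) :
  (forall i, Pr i -> holo (f i)) -> holo (fun q => \prod_(i <- s | Pr i) f i q).
Proof.
move=> hf; elim: s => [|i s IH].
  by apply: (holo_eq (holo_cst 1)) => q _; rewrite big_nil.
case Pi: (Pr i).
  by apply: (holo_eq (holoM (hf i Pi) IH)) => q _; rewrite big_cons Pi.
by apply: (holo_eq IH) => q _; rewrite big_cons Pi.
Qed.

Lemma holo_continuous f q : holo f -> D q -> {for q, continuous f}.
Proof. by move=> /holo_stable[+ _]; apply. Qed.

Lemma dirder_is_derive f (w : E * P) q : holo f -> V w.1 -> D q ->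
  is_derive (0 : C) 1 (along p f w q) (dirder p f w q).
Proof.
move=> /holo_stable[_ df] /df[g' _ dg] /dg d.
rewrite /dirder derive1E; suff -> : 'D_1 (along p f w q) 0 = g' q by [].
by case: d.
Qed.

Lemma dirderE (f : X * P -> C) (w : E * P) q l : is_derive (0 : C) 1 (along p f w q) l -> dirder p f w q = l.
Proof. by move=> [_ <-]; rewrite /dirder derive1E. Qed.

Lemma holo_dirder f w : holo f -> V w.1 -> holo (dirder p f w).
Proof.
move=> hf Vw; have [_ /(_ w Vw)[g' hg' dg]] := holo_stable hf.
by apply: (holo_eq hg') => q /dg/dirderE.
Qed.

Lemma dirderD f g w q : holo f -> holo g -> V w.1 -> D q ->
  dirder p (fun q => f q + g q) w q = dirder p f w q + dirder p g w q.
Proof.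
move=> hf hg Vw Dq; apply: dirderE.
exact: (is_derive_add (dirder_is_derive hf Vw Dq) (dirder_is_derive hg Vw Dq)).
Qed.
Lemma dirderM f g w q : holo f -> holo g -> V w.1 -> D q ->
  dirder p (fun q => f q * g q) w q = dirder p f w q * g q + f q * dirder p g w q.
Proof.
move=> hf hg Vw Dq; apply: dirderE.
have := is_derive_mul (dirder_is_derive hf Vw Dq) (dirder_is_derive hg Vw Dq).
by rewrite !along0.
Qed.
Lemma dirderV f w q : holo f -> f q != 0 -> V w.1 -> D q ->
  dirder p (fun q => (f q)^-1) w q = - (f q)^-1 * dirder p f w q * (f q)^-1.
Proof.
move=> hf f0 Vw Dq; apply: dirderE.
have := is_derive_inv (dirder_is_derive hf Vw Dq).
by rewrite !along0 //; apply.
Qed.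
Lemma dirder_cst (a : C) (w : E * P) (q : X * P) :
  dirder p (fun _ : X * P => a) w q = 0.
Proof. by apply: dirderE; exact: is_derive_cst. Qed.
Lemma dirder_eq f g w q : holo f -> (forall q, D q -> f q = g q) -> V w.1 -> D q ->
  dirder p g w q = dirder p f w q.
Proof.
move=> hf fg Vw Dq; apply: dirderE.
apply: near_eq_derive0 (dirder_is_derive hf Vw Dq).
by have := move_near Dq Vw; apply: filterS => j Dj; exact: fg.
Qed.
Lemma dirderZ a f w q : holo f -> V w.1 -> D q ->
  dirder p (fun q => a * f q) w q = a * dirder p f w q.
Proof.
move=> hf Vw Dq; by rewrite (dirderM (holo_cst a) hf Vw Dq) dirder_cst mul0r add0r.
Qed.
Lemma dirderN f w q : holo f -> V w.1 -> D q ->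
  dirder p (fun q => - f q) w q = - dirder p f w q.
Proof.
move=> hf Vw Dq; rewrite -mulN1r -(dirderZ _ hf Vw Dq).
by congr (dirder p _ w q); apply/funext => x; rewrite mulN1r.
Qed.
Lemma dirderB f g w q : holo f -> holo g -> V w.1 -> D q ->
  dirder p (fun q => f q - g q) w q = dirder p f w q - dirder p g w q.
Proof. by move=> hf hg Vw Dq; rewrite (dirderD hf (holoN hg) Vw Dq) (dirderN hg Vw Dq). Qed.
Lemma dirder_sum (I : Type) (s : seq I) (Pr : pred I) (f : I -> X * P -> C) w q :
  (forall i, Pr i -> holo (f i)) -> V w.1 -> D q ->
  dirder p (fun q => \sum_(i <- s | Pr i) f i q) w q = \sum_(i <- s | Pr i) dirder p (f i) w q.
Proof.
move=> hf Vw Dq; elim: s => [|i s IH].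
  rewrite big_nil -[RHS](dirder_cst 0 w q).
  by congr (dirder p _ w q); apply/funext => x; rewrite big_nil.
rewrite big_cons; case Pi: (Pr i).
  rewrite -IH -(dirderD (hf i Pi) (holo_sum s hf) Vw Dq).
  by congr (dirder p _ w q); apply/funext => x; rewrite big_cons Pi.
by rewrite -IH; congr (dirder p _ w q); apply/funext => x; rewrite big_cons Pi.
Qed.

Lemma plane_derive1 q0 w1 w2 Q r f : plane_at q0 w1 w2 Q r -> holo f -> V w1.1 ->
  forall h k, cabs h < r -> cabs k < r ->
  is_derive h 1 (fun h => f (Q h k)) (dirder p f w1 (Q h k)).
Proof.
move=> pl hf V1 h k hr kr; apply: is_derive_unshift.
apply: near_eq_derive0 (dirder_is_derive hf V1 (plane_in pl hr kr)).
by have := plane_move1 pl hr kr; apply: filterS => j E1; rewrite -E1.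
Qed.

Lemma plane_derive2 q0 w1 w2 Q r f : plane_at q0 w1 w2 Q r -> holo f -> V w2.1 ->
  forall h k, cabs h < r -> cabs k < r ->
  is_derive k 1 (fun k => f (Q h k)) (dirder p f w2 (Q h k)).
Proof.
move=> pl hf V1 h k hr kr; apply: is_derive_unshift.
apply: near_eq_derive0 (dirder_is_derive hf V1 (plane_in pl hr kr)).
by have := plane_move2 pl hr kr; apply: filterS => j E1; rewrite -E1.
Qed.

Lemma plane_holo_continuous q0 w1 w2 Q r f : plane_at q0 w1 w2 Q r -> holo f -> 
  forall e : R, 0 < e -> exists2 r : R, 0 < r &
     forall s h, cabs s < r -> cabs h < r -> cabs (f (Q s h) - f (Q 0 0)) <= e.
Proof.
move=> pl hf e e0; have r0 := plane_gt0 pl; have z0 : cabs (0 : C) < r by rewrite cabs0.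
have /cvg_cabs/(_ _ e0) := holo_continuous hf (plane_in pl z0 z0).
move=> /(plane_continuous pl z0 z0)[r1 r10 r1P]; exists r1 => // s h sr hr.
by apply/ltW/r1P; rewrite subr0.
Qed.

(** Linearity is not formal, since each direction has its own lift. By [plane_move] the derivative
    along [a w1 + w2] is that of [j |-> f (Q (a j) j)], a function restricted to the diagonal. *)
Lemma dirder_linear f w1 w2 a q : holo f -> V w1.1 -> V w2.1 -> D q ->
  dirder p f (a *: w1.1 + w2.1, a *: w1.2 + w2.2) q = a * dirder p f w1 q + dirder p f w2 q.
Proof.
move=> hf V1 V2 Dq; have [Q [r pl]] := plane Dq V1 V2; have r0 := plane_gt0 pl.
have z0 : cabs (0 : C) < r by rewrite cabs0.
apply: dirderE.
apply: (@near_eq_derive0 _ (fun j => f (Q (a * j) j))).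
  by have := plane_move pl a; apply: filterS => j E1; rewrite -E1.
have a1 : 0 < cabs a + 1 by rewrite ltr_wpDl ?cabs_ge0.
have ar (s : C) (e : R) : 0 < e -> cabs s < e / (cabs a + 1) -> cabs (a * s) < e /\ cabs s < e.
  move=> e0; rewrite ltr_pdivlMr // mulrDr mulr1 cabsM mulrC => H.
  by have := cabs_ge0 s; have := mulr_ge0 (cabs_ge0 s) (cabs_ge0 a); lra.
have := @is_derive_diagonal R (fun h k => f (Q (a * h) k))
  (fun h k => a * dirder p f w1 (Q (a * h) k)) (dirder p f w2 q) (r / (cabs a + 1)).
rewrite !mulr0 (plane_center pl); apply.
- by rewrite divr_gt0.
- move=> s h /(ar _ _ r0)[asr _] /(ar _ _ r0)[_ hr].
  exact: (@is_derive_scale _ (fun h' => f (Q h' h)) _ _ _ (plane_derive1 pl hf V1 asr hr)).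
- move=> e e0; have [r1 r10 r1P] := plane_holo_continuous pl (holo_dirder hf V1) (divr_gt0 e0 a1).
  exists (r1 / (cabs a + 1)); first by rewrite divr_gt0.
  move=> s h /(ar _ _ r10)[asr _] /(ar _ _ r10)[_ hr].
  have := r1P _ _ asr hr; rewrite (plane_center pl) ler_pdivlMr // => H.
  rewrite -mulrBr cabsM mulrC; apply: le_trans H.
  by rewrite ler_wpM2l ?cabs_ge0 // lerDl.
- by have := plane_derive2 pl hf V2 z0 z0; rewrite (plane_center pl).
Qed.

Lemma dirder_comm f w1 w2 q : holo f -> V w1.1 -> V w2.1 -> D q ->
  dirder p (dirder p f w1) w2 q = dirder p (dirder p f w2) w1 q.
Proof.
move=> hf V1 V2 Dq; have [Q [r pl]] := plane Dq V1 V2; have r0 := plane_gt0 pl.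
have := @mixed_derivatives_commute R (fun h k => f (Q h k)) (fun h k => dirder p f w1 (Q h k))
  (fun h k => dirder p f w2 (Q h k)) (fun h k => dirder p (dirder p f w1) w2 (Q h k))
  (fun h k => dirder p (dirder p f w2) w1 (Q h k)) r r0.
rewrite (plane_center pl); apply.
- exact: plane_derive1 pl hf V1.
- exact: plane_derive2 pl hf V2.
- exact: plane_derive2 pl (holo_dirder hf V1) V2.
- exact: plane_derive1 pl (holo_dirder hf V2) V1.
- by have := plane_holo_continuous pl (holo_dirder (holo_dirder hf V1) V2); rewrite (plane_center pl).
- by have := plane_holo_continuous pl (holo_dirder (holo_dirder hf V2) V1); rewrite (plane_center pl).
Qed.

End Holomorphic.

(** * Matrix-valued holomorphic functions *)

Section MatrixHolomorphic.
Variables (R : realType) (E : normedModType (Cx R)) (X : topologicalType) (p : X -> E).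
Local Notation C := (Cx R).
Variables (V T : set E) (P : normedModType (Cx R)) (D : set (X * P)).
Hypotheses (Vsub : submodule V) (TV : open_in V T) (cov : covering_map T p) (oD : open D).

Local Notation holo := (holo p V D).

Definition mholo m n (f : X * P -> 'M[C]_(m, n)) := forall i j, holo (fun q => f q i j).

(* Sealed, since unification would otherwise unfold the limit defining [dirder]. *)
Fact mdir_spec : {md : forall m n, (X * P -> 'M[C]_(m, n)) -> E * P -> X * P -> 'M[C]_(m, n) |
  forall m n (f : X * P -> 'M[C]_(m, n)) w q i j,
    md m n f w q i j = dirder p (fun q => f q i j) w q}.
Proof.
exists (fun m n f w q => \matrix_(i, j) dirder p (fun q => f q i j) w q).
by move=> *; rewrite mxE.
Qed.

Definition mdir m n : (X * P -> 'M[C]_(m, n)) -> E * P -> X * P -> 'M[C]_(m, n) :=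
  sval mdir_spec m n.

Lemma mdirE m n (f : X * P -> 'M[C]_(m, n)) w q i j :
  mdir f w q i j = dirder p (fun q => f q i j) w q.
Proof. exact: (svalP mdir_spec). Qed.

Lemma is_derive_entry m n (f : C -> 'M[C]_(m, n)) (x : C) (l : 'M[C]_(m, n)) i j :
  is_derive x 1 f l -> is_derive x 1 (fun h => f h i j) (l i j).
Proof.
move=> [df dl].
have c : (fun h : C => h^-1 *: ((f \o shift x) (h *: (1 : C)) - f x)) @ 0^' --> l.
  by rewrite -dl; exact: df.
have c' : (fun h : C => h^-1 *: (((fun h => f h i j) \o shift x) (h *: (1 : C)) - f x i j))
    @ 0^' --> l i j.
  rewrite (_ : (fun h : C => _) = (fun M : 'M[C]_(m, n) => M i j) \o
    (fun h : C => h^-1 *: ((f \o shift x) (h *: (1 : C)) - f x))); last first.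
    by apply/funext => h /=; rewrite !mxE.
  exact: (@cvg_comp _ _ _ _ (fun M : 'M[C]_(m, n) => M i j) _ _ _ c (@coord_continuous _ _ _ i j l)).
by apply: DeriveDef; [apply/cvg_ex; exists (l i j) | apply/cvg_lim].
Qed.

Lemma holomorphic_on_mholo m n (f : X * P -> 'M[C]_(m, n)) : holomorphic_on p V D f -> mholo f.
Proof.
move=> [S Sf good] i j.
exists [set g | exists2 F, S F & g = fun q => F q i j]; first by exists f.
move=> g [F SF ->]; split.
  move=> q Dq; have c := (good F SF).1 q Dq.
  exact: (@cvg_comp _ _ _ _ (fun M : 'M[C]_(m, n) => M i j) _ _ _ c (@coord_continuous _ _ _ i j (F q))).
move=> w /(good F SF).2[F' SF' dF]; exists (fun q => F' q i j); first by exists F'.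
by move=> q /dF; exact: is_derive_entry.
Qed.

Lemma holomorphic_on_dirder m n (f : X * P -> 'M[C]_(m, n)) w q : holomorphic_on p V D f ->
  V w.1 -> D q -> dirder p f w q = mdir f w q.
Proof.
move=> [S Sf good] Vw Dq; have [F' SF' dF] := (good f Sf).2 w Vw.
have d := dF q Dq.
have -> : dirder p f w q = F' q by rewrite /dirder derive1E; case: d.
apply/matrixP => i j; rewrite mdirE; apply/esym/dirderE.
exact: is_derive_entry d.
Qed.

Lemma mholo_cst m n (a : 'M[C]_(m, n)) : mholo (fun=> a).
Proof. by move=> i j; exact: (holo_cst Vsub TV cov oD). Qed.

Lemma mholo_eq m n (f g : X * P -> 'M[C]_(m, n)) : mholo f -> (forall q, D q -> f q = g q) -> mholo g.
Proof. by move=> hf fg i j; apply: (holo_eq Vsub TV cov oD (hf i j)) => q /fg ->. Qed.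

Lemma mholoD m n (f g : X * P -> 'M[C]_(m, n)) : mholo f -> mholo g -> mholo (fun q => f q + g q).
Proof.
move=> hf hg i j.
by apply: (holo_eq Vsub TV cov oD (holoD Vsub TV cov oD (hf i j) (hg i j))) => q _; rewrite mxE.
Qed.

Lemma mholoZ m n (a : X * P -> C) (f : X * P -> 'M[C]_(m, n)) : holo a -> mholo f ->
  mholo (fun q => a q *: f q).
Proof.
move=> hf hg i j.
by apply: (holo_eq Vsub TV cov oD (holoM Vsub TV cov oD hf (hg i j))) => q _; rewrite mxE.
Qed.

Lemma mholoN m n (f : X * P -> 'M[C]_(m, n)) : mholo f -> mholo (fun q => - f q).
Proof.
move=> hf i j.
by apply: (holo_eq Vsub TV cov oD (holoN Vsub TV cov oD (hf i j))) => q _; rewrite mxE.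
Qed.

Lemma mholoM m n k (f : X * P -> 'M[C]_(m, n)) (g : X * P -> 'M[C]_(n, k)) :
  mholo f -> mholo g -> mholo (fun q => f q *m g q).
Proof.
move=> hf hg i j.
have H := holo_sum Vsub TV cov oD (index_enum 'I_n) (Pr := xpredT)
  (fun l _ => holoM Vsub TV cov oD (hf i l) (hg l j)).
by apply: (holo_eq Vsub TV cov oD H) => q _; rewrite mxE.
Qed.

Lemma mholo_sum m n (I : Type) (s : seq I) (Pr : pred I) (f : I -> X * P -> 'M[C]_(m, n)) :
  (forall i, Pr i -> mholo (f i)) -> mholo (fun q => \sum_(i <- s | Pr i) f i q).
Proof.
move=> hf i j.
have H := holo_sum Vsub TV cov oD s (Pr := Pr) (fun l Pl => hf l Pl i j).
by apply: (holo_eq Vsub TV cov oD H) => q _; rewrite summxE.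
Qed.

Lemma holo_trace n (f : X * P -> 'M[C]_n) : mholo f -> holo (fun q => \tr (f q)).
Proof. by move=> hf; apply: (holo_sum Vsub TV cov oD) => i _; exact: hf. Qed.

Lemma holo_det n (f : X * P -> 'M[C]_n) : mholo f -> holo (fun q => \det (f q)).
Proof.
move=> hf; apply: (holo_sum Vsub TV cov oD) => s _.
apply: (holoM Vsub TV cov oD); first exact: (holo_cst Vsub TV cov oD).
by apply: (holo_prod Vsub TV cov oD) => i _; exact: hf.
Qed.

Lemma mholo_inv n (f : X * P -> 'M[C]_n) : mholo f -> (forall q, D q -> f q \in unitmx) ->
  mholo (fun q => invmx (f q)).
Proof.
move=> hf fu.
have du q : D q -> \det (f q) != 0 by move=> /fu; rewrite unitmxE unitfE.
have H : mholo (fun q => (\det (f q))^-1 *: \adj (f q)).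
  apply: mholoZ; first by apply: (holoV Vsub TV cov oD) => //; exact: holo_det.
  move=> i j.
  have H : holo (fun q => (-1) ^+ (j + i) * \det (row' j (col' i (f q)))).
    apply: (holoM Vsub TV cov oD); first exact: (holo_cst Vsub TV cov oD).
    apply: holo_det => k l.
    apply: (holo_eq Vsub TV cov oD (hf (fintype.lift j k) (fintype.lift i l))) => q _.
    by rewrite !mxE.
  by apply: (holo_eq Vsub TV cov oD H) => q _; rewrite mxE.
by apply: mholo_eq H _ => q Dq; rewrite /invmx fu.
Qed.

Lemma mdir_cst m n (a : 'M[C]_(m, n)) w q : mdir (fun=> a) w q = 0.
Proof. by apply/matrixP => i j; rewrite mdirE mxE dirder_cst. Qed.

Lemma mdir_eq m n (f g : X * P -> 'M[C]_(m, n)) w q : mholo f -> (forall q, D q -> f q = g q) ->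
  V w.1 -> D q -> mdir g w q = mdir f w q.
Proof.
move=> hf fg Vw Dq; apply/matrixP => i j; rewrite (mdirE f) (mdirE g).
have fg' q' : D q' -> f q' i j = g q' i j by move=> /fg ->.
exact: (dirder_eq Vsub TV cov oD (g := fun q => g q i j) (hf i j) fg' Vw Dq).
Qed.

Lemma mdirD m n (f g : X * P -> 'M[C]_(m, n)) w q : mholo f -> mholo g -> V w.1 -> D q ->
  mdir (fun q => f q + g q) w q = mdir f w q + mdir g w q.
Proof.
move=> hf hg Vw Dq; apply/matrixP => i j; rewrite [RHS]mxE [LHS]mdirE (mdirE f) (mdirE g).
rewrite -(dirderD (hf i j) (hg i j) Vw Dq).
by congr (dirder p _ w q); apply/funext => x; rewrite mxE.
Qed.

Lemma mdirN m n (f : X * P -> 'M[C]_(m, n)) w q : mholo f -> V w.1 -> D q ->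
  mdir (fun q => - f q) w q = - mdir f w q.
Proof.
move=> hf Vw Dq; apply/matrixP => i j; rewrite [RHS]mxE [LHS]mdirE (mdirE f).
rewrite -(dirderN Vsub TV cov oD (hf i j) Vw Dq).
by congr (dirder p _ w q); apply/funext => x; rewrite mxE.
Qed.

Lemma mdirZ m n (a : X * P -> C) (f : X * P -> 'M[C]_(m, n)) w q :
  holo a -> mholo f -> V w.1 -> D q ->
  mdir (fun q => a q *: f q) w q = dirder p a w q *: f q + a q *: mdir f w q.
Proof.
move=> ha hf Vw Dq; apply/matrixP => i j; rewrite [RHS]mxE [X in X + _]mxE [X in _ + X]mxE [LHS]mdirE (mdirE f).
rewrite -(dirderM Vsub TV cov oD ha (hf i j) Vw Dq).
by congr (dirder p _ w q); apply/funext => x; rewrite mxE.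
Qed.

Lemma mdirM m n k (f : X * P -> 'M[C]_(m, n)) (g : X * P -> 'M[C]_(n, k)) w q :
  mholo f -> mholo g -> V w.1 -> D q ->
  mdir (fun q => f q *m g q) w q = mdir f w q *m g q + f q *m mdir g w q.
Proof.
move=> hf hg Vw Dq; apply/matrixP => i j; rewrite [RHS]mxE [X in X + _]mxE [X in _ + X]mxE [LHS]mdirE -big_split /=.
have -> : (fun q => (f q *m g q) i j) = (fun q => \sum_l f q i l * g q l j).
  by apply/funext => x; rewrite mxE.
rewrite (dirder_sum Vsub TV cov oD _ _ Vw Dq); last first.
  by move=> l _; exact: (holoM Vsub TV cov oD (hf i l) (hg l j)).
apply: eq_bigr => l _; rewrite (mdirE f) (mdirE g).
exact: (dirderM Vsub TV cov oD (hf i l) (hg l j) Vw Dq).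
Qed.

Lemma mdir_sum m n (I : Type) (s : seq I) (Pr : pred I) (f : I -> X * P -> 'M[C]_(m, n)) w q :
  (forall i, Pr i -> mholo (f i)) -> V w.1 -> D q ->
  mdir (fun q => \sum_(i <- s | Pr i) f i q) w q = \sum_(i <- s | Pr i) mdir (f i) w q.
Proof.
move=> hf Vw Dq; apply/matrixP => i j; rewrite [LHS]mdirE summxE.
have -> : (fun q => (\sum_(i <- s | Pr i) f i q) i j) = (fun q => \sum_(l <- s | Pr l) f l q i j).
  by apply/funext => x; rewrite summxE.
rewrite (dirder_sum Vsub TV cov oD s (fun l Pl => hf l Pl i j) Vw Dq).
by apply: eq_bigr => l _; rewrite [RHS]mdirE.
Qed.

Lemma dirder_trace n (f : X * P -> 'M[C]_n) w q : mholo f -> V w.1 -> D q ->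
  dirder p (fun q => \tr (f q)) w q = \tr (mdir f w q).
Proof.
move=> hf Vw Dq.
rewrite /mxtrace (dirder_sum Vsub TV cov oD (index_enum 'I_n) (fun i _ => hf i i) Vw Dq).
by apply: eq_bigr => l _; rewrite mdirE.
Qed.

Lemma mholo_mdir m n (f : X * P -> 'M[C]_(m, n)) w : mholo f -> V w.1 -> mholo (mdir f w).
Proof.
move=> hf Vw i j; apply: (holo_eq Vsub TV cov oD (holo_dirder Vsub TV cov oD (hf i j) Vw)).
by move=> q _; rewrite mdirE.
Qed.

Lemma mdir_comm m n (f : X * P -> 'M[C]_(m, n)) w1 w2 q : mholo f -> V w1.1 -> V w2.1 -> D q ->
  mdir (mdir f w1) w2 q = mdir (mdir f w2) w1 q.
Proof.
move=> hf V1 V2 Dq; apply/matrixP => i j; rewrite (mdirE (mdir f w1)) (mdirE (mdir f w2)).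
have := dirder_comm Vsub TV cov oD (hf i j) V1 V2 Dq.
have Em w : (fun q => mdir f w q i j) = dirder p (fun q => f q i j) w.
  by apply/funext => x; rewrite mdirE.
by rewrite !Em.
Qed.

Lemma mdir_linear m n (f : X * P -> 'M[C]_(m, n)) w1 w2 a q : mholo f -> V w1.1 -> V w2.1 -> D q ->
  mdir f (a *: w1.1 + w2.1, a *: w1.2 + w2.2) q = a *: mdir f w1 q + mdir f w2 q.
Proof.
move=> hf V1 V2 Dq; apply/matrixP => i j; rewrite [LHS]mdirE [RHS]mxE [in RHS]mxE (mdirE f w1) (mdirE f w2).
exact: (dirder_linear Vsub TV cov oD a (hf i j) V1 V2 Dq).
Qed.

End MatrixHolomorphic.
(** * Formal power series with matrix coefficients *)

Section FormalSeries.
Variables (K : numFieldType) (N : nat).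

(** Power series in a central parameter with matrix coefficients. The ring structure on this alias
    lets gauge transformations be written as products and conjugations. *)
Definition series_ring : Type := nat -> 'M[K]_N.
Local Notation A := series_ring.
HB.instance Definition _ := GRing.Zmodule.copy A (nat -> 'M[K]_N).

Lemma series_addE (f g : A) k : (f + g) k = f k + g k. Proof. by []. Qed.
Lemma series_oppE (f : A) k : (- f) k = - f k. Proof. by []. Qed.

(** A sum over a square with an indicator treats both factors alike and has bounds free of [k];
    associativity then becomes an exchange of summations. *)
Lemma ps_mulE (f g : A) (B k : nat) : (k < B)%N ->
  ps_mul f g k = \sum_(i < B) \sum_(j < B) if (i + j == k)%N then f i *m g j else 0.
Proof.
move=> kB; rewrite /ps_mul (big_ord_widen _ (fun i => f i *m g (k - i)%N) kB) big_mkcond /=.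
apply: eq_bigr => i _; rewrite ltnS; case: leqP => ik.
  have jB : (k - i < B)%N by apply: leq_ltn_trans (leq_subr _ _) kB.
  rewrite (bigD1 (Ordinal jB)) //= subnKC // eqxx big1 ?addr0 // => j jn.
  case: eqP => // ijk; move: jn; rewrite -val_eqE /= -ijk addKn eqxx //.
rewrite big1 // => j _; case: eqP => // ijk.
by move: ik; rewrite -ijk ltnNge leq_addr.
Qed.

Lemma ps_mulA : associative (@ps_mul K N).
Proof.
move=> f g h; apply/funext => k.
have kB : (k < k.+1)%N by [].
rewrite !(ps_mulE _ _ kB).
transitivity (\sum_(i < k.+1) \sum_(j < k.+1) \sum_(l < k.+1)
   if (i + j + l == k)%N then f i *m g j *m h l else 0).
  apply: eq_bigr => i _.
  transitivity (\sum_(m < k.+1) \sum_(j < k.+1) \sum_(l < k.+1)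
    if (i + m == k)%N && (j + l == m)%N then f i *m g j *m h l else 0).
    apply: eq_bigr => m _; case: eqP => im /=; last by rewrite !big1 // => j _; rewrite big1.
    rewrite (ps_mulE _ _ (ltn_ord m)) mulmx_sumr; apply: eq_bigr => j _.
    rewrite mulmx_sumr; apply: eq_bigr => l _.
    by case: ifP => _; rewrite ?mulmxA ?mulmx0.
  rewrite exchange_big /=; apply: eq_bigr => j _; rewrite exchange_big /=; apply: eq_bigr => l _.
  case: ifP => [/eqP ijl|n_ijl].
    have mB : (j + l < k.+1)%N by move: ijl; lia.
    rewrite (bigD1 (Ordinal mB)) //= addnA ijl !eqxx big1 ?addr0 // => m mn.
    by case: ifP => // /andP[_ /eqP E]; move: mn; rewrite -val_eqE /= E eqxx.
  rewrite big1 // => m _; case: ifP => // /andP[/eqP E1 /eqP E2].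
  by move: n_ijl; rewrite -addnA E2 E1 eqxx.
rewrite [in RHS]exchange_big /=.
transitivity (\sum_(l < k.+1) \sum_(i < k.+1) \sum_(j < k.+1)
   if (i + j + l == k)%N then f i *m g j *m h l else 0).
  rewrite [RHS]exchange_big /=; apply: eq_bigr => i _; exact: exchange_big.
apply: eq_bigr => l _.
transitivity (\sum_(m < k.+1) \sum_(i < k.+1) \sum_(j < k.+1)
    if (m + l == k)%N && (i + j == m)%N then f i *m g j *m h l else 0); last first.
  apply: eq_bigr => m _; case: eqP => im /=; last by rewrite !big1 // => j _; rewrite big1.
  rewrite (ps_mulE _ _ (ltn_ord m)) mulmx_suml; apply: eq_bigr => j _.
  rewrite mulmx_suml; apply: eq_bigr => i _.
  by case: ifP => _; rewrite ?mulmxA ?mul0mx.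
rewrite [RHS]exchange_big /=; apply: eq_bigr => i _; rewrite [RHS]exchange_big /=; apply: eq_bigr => j _.
case: ifP => [/eqP ijl|n_ijl].
  have mB : (i + j < k.+1)%N by move: ijl; lia.
  rewrite (bigD1 (Ordinal mB)) //= ijl !eqxx big1 ?addr0 // => m mn.
  by case: ifP => // /andP[_ /eqP E]; move: mn; rewrite -val_eqE /= E eqxx.
rewrite big1 // => m _; case: ifP => // /andP[/eqP E1 /eqP E2].
by move: n_ijl; rewrite E2 E1 eqxx.
Qed.

Lemma ps_mul1 : left_id (@ps_one K N) (@ps_mul K N).
Proof.
move=> f; apply/funext => k; rewrite /ps_mul big_ord_recl big1 => [|i _].
  by rewrite subn0 mul1mx addr0.
by rewrite /ps_one /= mul0mx.
Qed.

Lemma ps_mulr1 : right_id (@ps_one K N) (@ps_mul K N).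
Proof.
move=> f; apply/funext => k; rewrite /ps_mul big_ord_recr big1 /= => [|i _].
  by rewrite /ps_one subnn mulmx1 add0r.
by rewrite /ps_one subn_eq0 leqNgt ltn_ord /= mulmx0.
Qed.

Lemma ps_mulDl : left_distributive (@ps_mul K N) (+%R : A -> A -> A).
Proof.
move=> f g h; apply/funext => k; rewrite series_addE /ps_mul -big_split.
by apply: eq_bigr => i _; rewrite /= -mulmxDl.
Qed.

Lemma ps_mulDr : right_distributive (@ps_mul K N) (+%R : A -> A -> A).
Proof.
move=> f g h; apply/funext => k; rewrite series_addE /ps_mul -big_split.
by apply: eq_bigr => i _; rewrite /= -mulmxDr.
Qed.

HB.instance Definition _ := GRing.Zmodule_isPzRing.Build A
  ps_mulA ps_mul1 ps_mulr1 ps_mulDl ps_mulDr.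

Lemma series_mulE (f g : A) k : (f * g) k = \sum_(i < k.+1) f i *m g (k - i)%N.
Proof. by []. Qed.
Lemma series_oneE k : (1 : A) k = if k == 0%N then 1%:M else 0. Proof. by []. Qed.

Definition series_const (c : K) : A := fun k => if k == 0%N then c%:M else 0.
Definition series_var : A := fun k => if k == 1%N then 1%:M else 0.
Local Notation "'xi'" := series_var.
Local Notation cst := series_const.

Lemma series_constM c (f : A) k : (cst c * f) k = c *: f k.
Proof.
rewrite series_mulE big_ord_recl big1 => [|i _]; first by rewrite subn0 mul_scalar_mx addr0.
by rewrite /cst /= mul0mx.
Qed.

Lemma series_const_comm c (f : A) : cst c * f = f * cst c.
Proof.
apply/funext => k; rewrite series_constM series_mulE big_ord_recr big1 /= => [|i _].
  by rewrite /cst subnn /= mul_mx_scalar add0r.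
by rewrite /cst subn_eq0 leqNgt ltn_ord /= mulmx0.
Qed.

Lemma series_varM (f : A) k : (xi * f) k = if k is k'.+1 then f k' else 0.
Proof.
case: k => [|k]; first by rewrite series_mulE big_ord_recl big_ord0 /series_var /= mul0mx addr0.
rewrite series_mulE big_ord_recl /series_var /= mul0mx add0r big_ord_recl /= big1 => [|i _].
  by rewrite mul1mx addr0 subSS subn0.
by rewrite mul0mx.
Qed.

Lemma series_var_comm (f : A) : xi * f = f * xi.
Proof.
apply/funext => -[|k].
  by rewrite series_varM series_mulE big_ord_recl big_ord0 /series_var /= mulmx0 addr0.
rewrite series_varM series_mulE !big_ord_recr big1 /= => [|i _].
  by rewrite /series_var subSnn subnn /= mulmx1 mulmx0 addr0 add0r.
rewrite /series_var; case: eqP => [E|_]; last by rewrite mulmx0.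
by have := ltn_ord i; move: E; rewrite /=; lia.
Qed.

Lemma series_varX s (f : A) k : (xi ^+ s * f) k = ps_shift s f k.
Proof.
elim: s k => [|s IH] k; first by rewrite expr0 mul1r /ps_shift subn0.
rewrite exprS -mulrA series_varM.
by case: k => [|k]; rewrite ?IH /ps_shift ?ltnS ?subSS.
Qed.

Lemma series_varX_comm s (f : A) : xi ^+ s * f = f * xi ^+ s.
Proof.
elim: s => [|s IH]; first by rewrite expr0 mul1r mulr1.
by rewrite exprS -mulrA IH mulrA series_var_comm mulrA.
Qed.

Lemma series_varI (f g : A) : xi * f = xi * g -> f = g.
Proof.
move=> H; apply/funext => k; have := congr1 (fun h : A => h k.+1) H.
by rewrite !series_varM.
Qed.

(** The Euler operator [xi d/dxi]. With [xi = 1 / z] it equals [- z d/dz], so up to a sign finite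
    points and infinity obey the same equation. *)
Definition eul (f : A) : A := fun k => k%:R *: f k.
Definition pder (f : A) : A := fun k => k.+1%:R *: f k.+1.

Lemma eulE (f : A) : eul f = xi * pder f.
Proof. by apply/funext => -[|k]; rewrite series_varM /eul ?scale0r. Qed.

Lemma eulM (f g : A) : eul (f * g) = eul f * g + f * eul g.
Proof.
apply/funext => k; rewrite series_addE !series_mulE /eul series_mulE scaler_sumr -big_split.
apply: eq_bigr => i _ /=; rewrite -scalemxAl -scalemxAr -scalerDl -natrD subnKC //.
by rewrite -ltnS.
Qed.

Lemma pderM (f g : A) : pder (f * g) = pder f * g + f * pder g.
Proof.
apply: series_varI; rewrite mulrDr mulrA -!eulE (mulrA xi) (series_var_comm f) -mulrA -eulE.
exact: eulM.
Qed.

Lemma pderD (f g : A) : pder (f + g) = pder f + pder g.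
Proof. by apply/funext => k; rewrite /pder !series_addE scalerDr. Qed.
Lemma pderN (f : A) : pder (- f) = - pder f.
Proof. by apply/funext => k; rewrite /pder !series_oppE scalerN. Qed.
Lemma pderB (f g : A) : pder (f - g) = pder f - pder g.
Proof. by rewrite pderD pderN. Qed.
Lemma pder_const c : pder (cst c) = 0.
Proof. by apply/funext => k; rewrite /pder /cst /= scaler0. Qed.
Lemma pder1 : pder 1 = 0.
Proof. by apply/funext => k; rewrite /pder series_oneE /= scaler0. Qed.
Lemma pder_var : pder xi = 1.
Proof.
by apply/funext => -[|k]; rewrite /pder /series_var series_oneE /= ?scale1r ?scaler0.
Qed.
Lemma pder_varX s : xi * pder (xi ^+ s) = cst s%:R * xi ^+ s.
Proof.
elim: s => [|s IH]; first by rewrite expr0 pder1 mulr0; apply/funext => k; rewrite series_constM scale0r.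
rewrite exprS pderM pder_var mul1r mulrDr IH mulrA (series_var_comm (cst _)) -mulrA.
rewrite -[X in X + _]mul1r -mulrDl; congr (_ * _); apply/funext => k.
rewrite series_addE series_oneE /cst; case: eqP => _; last by rewrite addr0.
by rewrite -raddfD /= -nat1r.
Qed.

(** The trace of the residue of [f / xi^(k+1)]. *)
Definition tau (k : nat) (f : A) : K := \tr (f k).

Lemma tauD k f g : tau k (f + g) = tau k f + tau k g.
Proof. by rewrite /tau series_addE raddfD. Qed.
Lemma tauN k f : tau k (- f) = - tau k f.
Proof. by rewrite /tau series_oppE raddfN. Qed.
Lemma tauB k f g : tau k (f - g) = tau k f - tau k g.
Proof. by rewrite tauD tauN. Qed.
Lemma tau_const k c f : tau k (cst c * f) = c * tau k f.
Proof. by rewrite /tau series_constM mxtraceZ. Qed.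
Lemma tau_var k f : tau k.+1 (xi * f) = tau k f.
Proof. by rewrite /tau series_varM. Qed.
Lemma tau_varX s k f : tau (s + k) (xi ^+ s * f) = tau k f.
Proof.
by rewrite /tau series_varX /ps_shift ltnNge leq_addr /= addKn.
Qed.
Lemma tau_varX0 s k f : (k < s)%N -> tau k (xi ^+ s * f) = 0.
Proof. by move=> ks; rewrite /tau series_varX /ps_shift ks mxtrace0. Qed.
Lemma tau_pder k f : tau k (pder f) = k.+1%:R * tau k.+1 f.
Proof. by rewrite /tau /pder mxtraceZ. Qed.

Lemma tauC k f g : tau k (f * g) = tau k (g * f).
Proof.
rewrite /tau !series_mulE !raddf_sum (reindex_inj rev_ord_inj) /=.
by apply: eq_bigr => i _; rewrite mxtrace_mulC /= subSS subKn // -ltnS.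
Qed.

Lemma tau_conj k (G H f : A) : H * G = 1 -> tau k (G * f * H) = tau k f.
Proof. by move=> HG; rewrite tauC mulrA HG mul1r. Qed.

Lemma mx_addE (M M' : 'M[K]_N) i j : (M + M') i j = M i j + M' i j.
Proof. by rewrite mxE. Qed.
Lemma mx_oppE (M : 'M[K]_N) i j : (- M) i j = - M i j.
Proof. by rewrite mxE. Qed.

End FormalSeries.

(** The ring of series is not commutative; identities that only rearrange sums are reduced to
    entries, where [ring] applies. *)
Ltac series_abel := let k := fresh in let i := fresh in let j := fresh in
  apply/funext => k; apply/matrixP => i j;
  rewrite ?(series_addE, series_oppE, mx_addE, mx_oppE); ring.

(** * The local contribution of a singular point to the curvature *)

Section LocalCurvature.
Variables (K : numFieldType) (N r : nat).
Local Notation A := (series_ring K N).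
Local Notation xi := (series_var K N).
Local Notation cst := (@series_const K N).
(** Indices 1 and 2 mark derivatives at fixed [xi] along two directions, the first of them a time
    direction; [c1] and [c2] are the velocities of the singular point. [S1] is [xi^r] times the
    derivative of the exponent [Theta]: as [th = xi^r (xi dTheta/dxi)], its derivative [t1] is
    [xi^r (xi d/dxi) (xi^-r S1)], which is [t1S]. *)
Variables (G H G1 G2 G12 th t1 t2 S1 a a2 : A) (c1 c2 : K).
Hypotheses (HG : H * G = 1) (GH : G * H = 1).
Hypothesis aG : a * G = xi ^+ r * eul G + G * th.
Hypothesis a2G : a2 * G + a * G2 = xi ^+ r * eul G2 + G2 * th + G * t2.
Hypothesis thS : th * S1 = S1 * th.
Hypothesis t1S : t1 = eul S1 - cst r%:R * S1.
(** Derivatives at fixed [z], where [xi] moves with velocity [- c1] or [- c2]: [T2] is [xi^(r+2)]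
    times that of [th / xi^(r+1)], and [Sg1] is [xi^(r+1)] times that of [Theta]. *)
Let T2 := xi * t2 - cst c2 * (xi * pder th - cst r.+1%:R * th).
Let Sg1 := xi * S1 - cst c1 * th.
Hypothesis T2S : tau (r.+1 + r.+1) (T2 * Sg1) = 0.

Let x1 := H * G1.
Let x2 := H * G2.
Let ze := H * pder G.
(** The logarithmic derivatives [G^-1 dG] at fixed [z]; below, [al] is [a] in the gauge of the
    formal solution. *)
Let X1 := x1 - cst c1 * ze.
Let X2 := x2 - cst c2 * ze.
Let al := xi ^+ r.+1 * ze + th.

Let G1E : G1 = G * x1. Proof. by rewrite /x1 mulrA GH mul1r. Qed.
Let G2E : G2 = G * x2. Proof. by rewrite /x2 mulrA GH mul1r. Qed.
Let pderG : pder G = G * ze. Proof. by rewrite /ze mulrA GH mul1r. Qed.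

Let xC s (f : A) : f * xi ^+ s = xi ^+ s * f. Proof. by rewrite series_varX_comm. Qed.
Let x1C (f : A) : f * xi = xi * f. Proof. by rewrite series_var_comm. Qed.
Let cC c (f : A) : f * cst c = cst c * f. Proof. by rewrite series_const_comm. Qed.
Let xL s (f g : A) : f * (xi ^+ s * g) = xi ^+ s * (f * g).
Proof. by rewrite mulrA xC mulrA. Qed.
Let x1L (f g : A) : f * (xi * g) = xi * (f * g). Proof. by rewrite mulrA x1C mulrA. Qed.
Let cL c (f g : A) : f * (cst c * g) = cst c * (f * g). Proof. by rewrite mulrA cC mulrA. Qed.

Let aE : a = G * al * H.
Proof.
rewrite -[a]mulr1 -GH mulrA; congr (_ * _).
by rewrite aG /al mulrDr eulE pderG mulrA -exprSr xL.
Qed.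

Let be := xi ^+ r.+1 * pder x2 + x2 * th - th * x2 + t2.

Let a2E : a2 = G * be * H.
Proof.
rewrite -[a2]mulr1 -GH mulrA; congr (_ * _).
rewrite -[a2 * G](addrK (a * G2)) a2G aE eulE.
have -> : pder G2 = G * (ze * x2 + pder x2) by rewrite G2E pderM pderG mulrDr mulrA.
rewrite [xi ^+ r * _]mulrA -exprSr.
have -> : G * al * H * G2 = G * (al * x2) by rewrite -!mulrA.
rewrite G2E -[G * x2 * th]mulrA -xL -!mulrDr -mulrBr; congr (_ * _).
rewrite /be /al mulrDl mulrDr -mulrA; series_abel.
Qed.

Let pderH : pder H = - (ze * H).
Proof.
have E : pder H * G + H * pder G = 0 by rewrite -pderM HG pder1.
rewrite -[LHS]mulr1 -GH mulrA -[pder H * G](addrK (H * pder G)) E add0r.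
by rewrite mulNr.
Qed.

Let eul_aE : eul a = G * (xi * (ze * al + pder al - al * ze)) * H.
Proof.
rewrite eulE aE !pderM pderH pderG x1L -[RHS]mulrA; congr (_ * _).
by rewrite mulrN !(mulrBr, mulrDr, mulrBl, mulrDl) !mulrA.
Qed.

Let pder_al : xi * pder al - cst r.+1%:R * al =
  xi ^+ r.+2 * pder ze + (xi * pder th - cst r.+1%:R * th).
Proof.
rewrite /al pderD pderM !mulrDr mulrA pder_varX.
rewrite (mulrA xi) -exprS -mulrA; series_abel.
Qed.

(** After conjugation by [G], [b] is [xi^(r+2)] times the derivative of the system along the second
    direction, and [w] is [xi^(r+1)] times the deformation matrix along the first, both at fixed
    [z]. *)
Let b := xi ^+ r.+2 * pder X2 + T2 + xi * (X2 * th - th * X2).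
Let w := xi ^+ r.+1 * X1 + Sg1.

Let B2E : xi * a2 - cst c2 * (eul a - cst r.+1%:R * a) = G * b * H.
Proof.
have cj (f : A) : xi * (G * f * H) = G * (xi * f) * H.
  by rewrite [G * (xi * _)]x1L !mulrA.
have cjc c (f : A) : cst c * (G * f * H) = G * (cst c * f) * H.
  by rewrite [G * (cst c * _)]cL !mulrA.
rewrite a2E eul_aE aE cj !cjc -mulrBl -mulrBr cjc -mulrBl -mulrBr; congr (G * _ * H).
have -> : xi * (ze * al + pder al - al * ze) - cst r.+1%:R * al =
   xi * (ze * al - al * ze) + (xi * pder al - cst r.+1%:R * al).
  by rewrite !mulrBr !mulrDr; series_abel.
rewrite pder_al /b /X2 /T2 /be.
have -> : ze * al - al * ze = ze * th - th * ze.
  by rewrite /al mulrDr mulrDl xL -mulrA; series_abel.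
have -> : (x2 - cst c2 * ze) * th - th * (x2 - cst c2 * ze) =
    (x2 * th - th * x2) - cst c2 * (ze * th - th * ze).
  by rewrite mulrBl [th * (_ - _)]mulrBr [th * (cst c2 * _)]cL [cst c2 * (_ - _)]mulrBr (mulrA (cst c2) ze th); series_abel.
have -> : pder (x2 - cst c2 * ze) = pder x2 - cst c2 * pder ze.
  by rewrite pderB pderM pder_const mul0r add0r.
have e3 : xi ^+ r.+2 * pder x2 = xi * (xi ^+ r.+1 * pder x2) by rewrite mulrA -exprS.
rewrite !(mulrBr, mulrDr) ![xi * (cst c2 * _)]cL [xi ^+ r.+2 * (cst c2 * _)]cL e3.
series_abel.
Qed.

Let W1E : xi * (xi ^+ r * G1 * H + G * S1 * H) - cst c1 * a = G * w * H.
Proof.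
rewrite aE G1E.
have cj (f : A) : xi * (G * f * H) = G * (xi * f) * H.
  by rewrite [G * (xi * _)]x1L !mulrA.
have cjc c (f : A) : cst c * (G * f * H) = G * (cst c * f) * H.
  by rewrite [G * (cst c * _)]cL !mulrA.
have -> : xi ^+ r * (G * x1) * H = G * (xi ^+ r * x1) * H.
  by rewrite [G * (xi ^+ r * _)]xL !mulrA.
rewrite -mulrDl -mulrDr cj cjc -mulrBl -mulrBr; congr (G * _ * H).
rewrite /w /X1 /Sg1 /al !(mulrBr, mulrDr) [xi ^+ r.+1 * (cst c1 * _)]cL.
rewrite (mulrA xi (xi ^+ r) x1) -exprS; series_abel.
Qed.

Let tau_pder_prod (f g : A) :
  r.+1%:R * tau r.+1 (f * g) = tau r (pder f * g) + tau r (f * pder g).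
Proof. by rewrite -tau_pder pderM tauD. Qed.

(** Integration by parts: [tau_pder_prod] moves the derivative from [X2] to [Sg1], and [t1S]
    recognizes [t1] in the outcome. *)
Let tau_X2S : tau r (pder X2 * Sg1) = - tau r (X2 * t1) - c1 * tau r (pder X2 * th).
Proof.
have E1 := tau_pder_prod X2 Sg1; have E2 := tau_pder_prod X2 th.
have E3 : tau r.+1 (X2 * Sg1) = tau r (X2 * S1) - c1 * tau r.+1 (X2 * th).
  by rewrite /Sg1 mulrBr x1L cL tauB tau_var tau_const.
have E4 : tau r (X2 * pder Sg1) =
    tau r (X2 * S1) + tau r (X2 * eul S1) - c1 * tau r (X2 * pder th).
  rewrite /Sg1 pderB !pderM pder_var pder_const mul0r add0r mul1r -eulE.
  by rewrite mulrBr mulrDr cL tauB tauD tau_const.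
have E5 : tau r (X2 * t1) = tau r (X2 * eul S1) - r%:R * tau r (X2 * S1).
  by rewrite t1S mulrBr cL tauB tau_const.
rewrite -[LHS](addrK (tau r (X2 * pder Sg1))) -E1 E3 E4 E5.
have {}E2 : tau r (pder X2 * th) = r.+1%:R * tau r.+1 (X2 * th) - tau r (X2 * pder th).
  by rewrite E2 addrK.
rewrite E2 -natr1; ring.
Qed.

Let tau_T2X : tau r.+1 (T2 * X1) = tau r (t2 * X1) + c2 * tau r (th * pder X1).
Proof.
have E2 := tau_pder_prod th X1.
have {}E2 : tau r (th * pder X1) = r.+1%:R * tau r.+1 (th * X1) - tau r (pder th * X1).
  by rewrite E2; ring.
rewrite /T2 mulrBl -!mulrA mulrBl -!mulrA tauB tau_var tau_const tauB tau_var tau_const E2.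
ring.
Qed.

Let tau_bw : tau (r.+1 + r.+1) (b * w) = - tau r (X2 * t1) - c1 * tau r (pder X2 * th)
  + tau r (t2 * X1) + c2 * tau r (th * pder X1) + tau r ((X2 * th - th * X2) * X1).
Proof.
have Er : (r.+1 + r.+1 = r.+2 + r)%N by lia.
rewrite /b /w mulrDl mulrDl !(mulrDr _ (xi ^+ r.+1 * X1) Sg1) !tauD T2S.
have -> : tau (r.+1 + r.+1) (xi ^+ r.+2 * pder X2 * (xi ^+ r.+1 * X1)) = 0.
  rewrite -mulrA xL mulrA -exprD; apply: tau_varX0.
  by lia.
have -> : tau (r.+1 + r.+1) (xi ^+ r.+2 * pder X2 * Sg1) = tau r (pder X2 * Sg1).
  by rewrite -mulrA Er tau_varX.
have -> : tau (r.+1 + r.+1) (T2 * (xi ^+ r.+1 * X1)) = tau r.+1 (T2 * X1).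
  by rewrite xL tau_varX.
have -> : tau (r.+1 + r.+1) (xi * (X2 * th - th * X2) * (xi ^+ r.+1 * X1)) =
    tau r ((X2 * th - th * X2) * X1).
  by rewrite -mulrA xL mulrA -exprS Er tau_varX.
have -> : tau (r.+1 + r.+1) (xi * (X2 * th - th * X2) * Sg1) = 0.
  have thSg : th * Sg1 = Sg1 * th.
    by rewrite /Sg1 mulrBr mulrBl x1L cL thS !mulrA.
  rewrite -mulrA mulrBl addSn tau_var tauB -!mulrA thSg.
  by rewrite [X in _ - X]tauC -mulrA subrr.
rewrite tau_X2S tau_T2X; ring.
Qed.

Let dX1 := - (H * G2 * H) * (G1 - cst c1 * pder G) + H * (G12 - cst c1 * pder G2).
Let dX2 := - (H * G1 * H) * (G2 - cst c2 * pder G) + H * (G12 - cst c2 * pder G1).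

Let dX1E : dX1 = H * G12 - x2 * X1 - cst c1 * (ze * x2 + pder x2).
Proof.
rewrite /dX1; have -> : H * (G12 - cst c1 * pder G2) = H * G12 - cst c1 * (ze * x2 + pder x2).
  rewrite mulrBr [H * (cst _ * _)]cL; congr (_ - _ * _).
  by rewrite G2E pderM pderG -mulrA -mulrDr mulrA HG mul1r.
have e : H * (G1 - cst c1 * pder G) = X1 by rewrite mulrBr [H * (cst _ * _)]cL.
rewrite mulNr -(mulrA (H * G2) H) e -[H * G2]/x2; series_abel.
Qed.

Let dX2E : dX2 = H * G12 - x1 * X2 - cst c2 * (ze * x1 + pder x1).
Proof.
rewrite /dX2; have -> : H * (G12 - cst c2 * pder G1) = H * G12 - cst c2 * (ze * x1 + pder x1).
  rewrite mulrBr [H * (cst _ * _)]cL; congr (_ - _ * _).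
  by rewrite G1E pderM pderG -mulrA -mulrDr mulrA HG mul1r.
have e : H * (G2 - cst c2 * pder G) = X2 by rewrite mulrBr [H * (cst _ * _)]cL.
rewrite mulNr -(mulrA (H * G1) H) e -[H * G1]/x1; series_abel.
Qed.

(** Conjugation by [G] reduces the right-hand side to [b * w]. Of its six products, that of the two
    gauge terms starts beyond the coefficient in question, the diagonal one vanishes by [T2S], and
    the commutator with [th] is orthogonal to [Sg1], which commutes with [th]. The other three give
    the left-hand side after integration by parts; the mixed derivative [G12] occurs symmetrically
    and cancels. *)
Theorem local_curvature :
  tau r (t1 * (H * (G2 - cst c2 * pder G)) + th * dX2)
  - tau r (t2 * (H * (G1 - cst c1 * pder G)) + th * dX1) =
  - tau (r.+1 + r.+1) ((xi * a2 - cst c2 * (eul a - cst r.+1%:R * a)) *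
     (xi * (xi ^+ r * G1 * H + G * S1 * H) - cst c1 * a)).
Proof.
rewrite B2E W1E.
have -> : G * b * H * (G * w * H) = G * (b * w) * H.
  by rewrite -!mulrA (mulrA H G) HG mul1r.
rewrite tau_conj // tau_bw dX1E dX2E.
have -> : H * (G1 - cst c1 * pder G) = X1 by rewrite mulrBr [H * (cst _ * _)]cL.
have -> : H * (G2 - cst c2 * pder G) = X2 by rewrite mulrBr [H * (cst _ * _)]cL.
have cyc1 : tau r (X2 * t1) = tau r (t1 * X2) by rewrite tauC.
have cyc2 : tau r (pder X2 * th) = tau r (th * pder X2) by rewrite tauC.
have cyc3 : tau r ((X2 * th - th * X2) * X1) = tau r (th * X1 * X2) - tau r (th * X2 * X1).
  by rewrite mulrBl tauB -[X2 * th * X1]mulrA tauC.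
rewrite cyc1 cyc2 cyc3.
have split_l (x y : A) c : tau r (th * (x - cst c * ze) * y) =
    tau r (th * x * y) - c * tau r (th * ze * y).
  rewrite mulrBr [th * (cst c * _)]cL mulrBl -(mulrA (cst c)) tauB.
  by rewrite tau_const.
have split_r (x y : A) c : tau r (th * y * (x - cst c * ze)) =
    tau r (th * y * x) - c * tau r (th * y * ze).
  by rewrite mulrBr [th * y * (cst c * _)]cL tauB tau_const.
rewrite (split_l x1 X2 c1) (split_l x2 X1 c2) (split_r x2 ze c2) (split_r x1 ze c1).
have pX c x : tau r (th * pder (x - cst c * ze)) = tau r (th * pder x) - c * tau r (th * pder ze).
  by rewrite pderB pderM pder_const mul0r add0r mulrBr [th * (cst c * _)]cL tauB tau_const.
rewrite (pX c2 x2) (pX c1 x1).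
have dX (x X y : A) c : tau r (th * (H * G12 - x * X - cst c * (ze * y + pder y))) =
    tau r (th * (H * G12)) - tau r (th * x * X) - c * (tau r (th * ze * y) + tau r (th * pder y)).
  rewrite !mulrBr [th * (cst c * _)]cL !tauB tau_const [th * (_ + _)]mulrDr tauD.
  by rewrite !mulrA.
rewrite !tauD (dX x1 X2 x1) (dX x2 X1 x2); ring.
Qed.

End LocalCurvature.
(** * Asymptotic expansions along a sequence *)

Section Expansions.
Variables (R : realType) (u : nat -> Cx R).
Local Notation C := (Cx R).
Hypothesis u_neq0 : forall k, u k != 0.
Hypothesis u_to0 : forall e : R, 0 < e -> exists k0, forall k, (k0 <= k)%N -> cabs (u k) < e.

(** Every estimate is along one sequence [u] that tends to zero without reaching it. The canonical
    solutions will be evaluated at such a sequence only, and this suffices for the uniqueness of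
    expansions. *)
Definition bigO (n : nat) (g : nat -> C) := exists M : R, exists k0 : nat,
  forall k, (k0 <= k)%N -> cabs (g k) <= M * cabs (u k) ^+ n.

Lemma bigO_gt0 n g : bigO n g -> exists M : R, 0 < M /\ exists k0 : nat,
  forall k, (k0 <= k)%N -> cabs (u k) <= 1 /\ cabs (g k) <= M * cabs (u k) ^+ n.
Proof.
move=> [M [k0 H]]; exists (`|M| + 1); split; first by rewrite ltr_wpDl.
have [k1 H1] := u_to0 (@ltr01 R).
exists (maxn k0 k1) => k; rewrite geq_max => /andP[/H h /H1 /ltW h1]; split => //.
apply: le_trans h _; rewrite ler_wpM2r ?exprn_ge0 ?cabs_ge0 //.
by have := ler_norm M; lra.
Qed.

Lemma bigO_eq n g g' : (exists k0, forall k, (k0 <= k)%N -> g k = g' k) -> bigO n g -> bigO n g'.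
Proof.
move=> [k0 E] [M [k1 H]]; exists M, (maxn k0 k1) => k.
by rewrite geq_max => /andP[/E <- /H].
Qed.

Lemma bigOD n g g' : bigO n g -> bigO n g' -> bigO n (fun k => g k + g' k).
Proof.
move=> [M [k0 H]] [M' [k0' H']]; exists (M + M'), (maxn k0 k0') => k.
rewrite geq_max => /andP[/H h /H' h']; apply: le_trans (cabsD _ _) _.
by rewrite mulrDl lerD.
Qed.

Lemma bigOM n n' g g' : bigO n g -> bigO n' g' -> bigO (n + n') (fun k => g k * g' k).
Proof.
move=> [M [k0 H]] [M' [k0' H']]; exists (M * M'), (maxn k0 k0') => k.
rewrite geq_max => /andP[/H h /H' h']; rewrite cabsM exprD mulrACA.
by apply: ler_pM => //; exact: cabs_ge0.
Qed.

Lemma bigO_le m n g : (m <= n)%N -> bigO n g -> bigO m g.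
Proof.
move=> mn /bigO_gt0[M [M0 [k0 H]]]; exists M, k0 => k /H[u1 h]; apply: le_trans h _.
rewrite ler_wpM2l ?(ltW M0) // -(subnKC mn) exprD ler_piMr ?exprn_ge0 ?cabs_ge0 //.
by rewrite exprn_ile1 ?cabs_ge0.
Qed.

Lemma bigO_cst a : bigO 0 (fun=> a).
Proof. by exists (cabs a), 0%N => k _; rewrite expr0 mulr1. Qed.

Lemma bigO_u n : bigO n (fun k => u k ^+ n).
Proof. by exists 1, 0%N => k _; rewrite cabsX mul1r. Qed.

Lemma bigO_scale n g a : bigO n g -> bigO n (fun k => a * g k).
Proof. by move=> H; have := bigOM (bigO_cst a) H. Qed.

Lemma bigON n g : bigO n g -> bigO n (fun k => - g k).
Proof.
move=> /(bigO_scale (-1)); apply: bigO_eq.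
by exists 0%N => k _; rewrite mulN1r.
Qed.

Lemma bigO_sum n (I : Type) (s : seq I) (P : pred I) (g : I -> nat -> C) :
  (forall i, P i -> bigO n (g i)) -> bigO n (fun k => \sum_(i <- s | P i) g i k).
Proof.
move=> H; elim: s => [|i s IH].
  exists 0, 0%N => k _; rewrite big_nil cabs0 mul0r //.
case Pi: (P i).
  apply: bigO_eq (bigOD (H i Pi) IH).
  by exists 0%N => k _; rewrite big_cons Pi.
by apply: bigO_eq IH; exists 0%N => k _; rewrite big_cons Pi.
Qed.

Lemma bigO_zero n : bigO n (fun=> 0).
Proof. by exists 0, 0%N => k _; rewrite cabs0 mul0r. Qed.

Definition poly_part (K : nat) (L : nat -> C) (k : nat) : C := \sum_(j < K) L j * u k ^+ j.

(** Only the first [K] terms of [L] count; the later ones are arbitrary, so formal series can be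
    used without regard to convergence. *)
Definition expands (K : nat) (f L : nat -> C) := bigO K (fun k => f k - poly_part K L k).

Lemma expands_eq K f g L L' : (exists k0, forall k, (k0 <= k)%N -> f k = g k) ->
  (forall j, (j < K)%N -> L j = L' j) -> expands K f L -> expands K g L'.
Proof.
move=> [k0 fg] LL'; apply: bigO_eq; exists k0 => k /fg ->; congr (_ - _).
by apply: eq_bigr => j _; rewrite LL'.
Qed.

Lemma expands_ext K f g L L' : f =1 g ->
  (forall j, (j < K)%N -> L j = L' j) -> expands K f L -> expands K g L'.
Proof. by move=> fg; apply: expands_eq; exists 0%N. Qed.

Lemma poly_partS K L k : poly_part K.+1 L k = poly_part K L k + L K * u k ^+ K.
Proof. by rewrite /poly_part big_ord_recr. Qed.

Lemma bigO_poly K L : bigO 0 (poly_part K L).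
Proof.
apply: bigO_sum => j _; apply: bigO_scale; apply: (@bigO_le _ j) => //; exact: bigO_u.
Qed.

Lemma expandsS K f L : expands K.+1 f L -> expands K f L.
Proof.
move=> H.
have H1 : bigO K (fun k => f k - poly_part K.+1 L k) by apply: bigO_le H.
apply: bigO_eq (bigOD H1 (bigO_scale (L K) (bigO_u K))); exists 0%N => k _.
by rewrite poly_partS; ring.
Qed.

Lemma expands_le K' K f L : (K' <= K)%N -> expands K f L -> expands K' f L.
Proof.
move=> /subnKC <-; elim: (K - K')%N => [|d IH]; first by rewrite addn0.
by rewrite addnS => /expandsS.
Qed.

Lemma expands_bounded K f L : expands K f L -> bigO 0 f.
Proof.
move=> H; apply: bigO_eq (bigOD (bigO_le (leq0n K) H) (bigO_poly K L)).
by exists 0%N => k _; rewrite subrK.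
Qed.

Lemma bigO_expands K f : bigO K f -> expands K f (fun=> 0).
Proof.
apply: bigO_eq; exists 0%N => k _; rewrite /poly_part big1 ?subr0 // => j _; exact: mul0r.
Qed.

Lemma expandsD K f g L L' : expands K f L -> expands K g L' ->
  expands K (fun k => f k + g k) (fun j => L j + L' j).
Proof.
move=> H H'; apply: bigO_eq (bigOD H H'); exists 0%N => k _.
rewrite addrACA -opprD -big_split; congr (_ - _).
by apply: eq_bigr => j _; rewrite /= -mulrDl.
Qed.

Lemma expandsZ K f L a : expands K f L -> expands K (fun k => a * f k) (fun j => a * L j).
Proof.
move=> H; apply: bigO_eq (bigO_scale a H); exists 0%N => k _.
rewrite mulrBr mulr_sumr; congr (_ - _).
by apply: eq_bigr => j _; rewrite mulrA.
Qed.

Lemma expands_sum K (I : Type) (s : seq I) (P : pred I) (f L : I -> nat -> C) :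
  (forall i, P i -> expands K (f i) (L i)) ->
  expands K (fun k => \sum_(i <- s | P i) f i k) (fun j => \sum_(i <- s | P i) L i j).
Proof.
move=> H; elim: s => [|i s IH].
  apply: (expands_ext _ _ (bigO_expands (bigO_zero K))) => [k|j _]; by rewrite big_nil.
case Pi: (P i).
  by apply: (expands_ext _ _ (expandsD (H i Pi) IH)) => [k|j _]; rewrite big_cons Pi.
by apply: (expands_ext _ _ IH) => [k|j _]; rewrite big_cons Pi.
Qed.

Definition conv (L L' : nat -> C) (k : nat) : C := \sum_(i < k.+1) L i * L' (k - i)%N.

Lemma convE L L' B k : (k < B)%N ->
  conv L L' k = \sum_(i < B) \sum_(j < B) if (i + j == k)%N then L i * L' j else 0.
Proof.
move=> kB; rewrite /conv (big_ord_widen _ (fun i => L i * L' (k - i)%N) kB) big_mkcond /=.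
apply: eq_bigr => i _; rewrite ltnS; case: leqP => ik.
  have jB : (k - i < B)%N by apply: leq_ltn_trans (leq_subr _ _) kB.
  rewrite (bigD1 (Ordinal jB)) //= subnKC // eqxx big1 ?addr0 // => j jn.
  case: eqP => // ijk; move: jn; rewrite -val_eqE /= -ijk addKn eqxx //.
rewrite big1 // => j _; case: eqP => // ijk.
by move: ik; rewrite -ijk ltnNge leq_addr.
Qed.

(** In the product of the two truncations the terms with [i + j < K] make up the convolution; the
    others carry a factor [u^K]. *)
Lemma bigO_poly_conv K L L' :
  bigO K (fun k => poly_part K L k * poly_part K L' k - poly_part K (conv L L') k).
Proof.
have H : bigO K (fun k => \sum_(i < K) \sum_(j < K | (K <= i + j)%N) (L i * L' j) * u k ^+ (i + j)).
  apply: bigO_sum => i _; apply: bigO_sum => j Kij; apply: bigO_scale.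
  by apply: bigO_le Kij _; exact: bigO_u.
apply: bigO_eq H; exists 0%N => k _.
apply/eqP; rewrite eq_sym subr_eq; apply/eqP.
have -> : poly_part K (conv L L') k =
    \sum_(i < K) \sum_(j < K | (i + j < K)%N) (L i * L' j) * u k ^+ (i + j).
  transitivity (\sum_(l < K) \sum_(i < K) \sum_(j < K)
      if (i + j == l)%N then L i * L' j * u k ^+ (i + j) else 0).
    apply: eq_bigr => l _; rewrite (convE _ _ (ltn_ord l)) mulr_suml; apply: eq_bigr => i _.
    rewrite mulr_suml; apply: eq_bigr => j _; case: eqP => [->//|_]; exact: mul0r.
  rewrite exchange_big /=; apply: eq_bigr => i _; rewrite exchange_big /= [RHS]big_mkcond.
  apply: eq_bigr => j _; case: ifP => [ijK|ijK].
    rewrite (bigD1 (Ordinal ijK)) //= eqxx big1 ?addr0 // => l ln.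
    by case: eqP => // E; move: ln; rewrite -val_eqE /= E eqxx.
  rewrite big1 // => l _; case: eqP => // E.
  by move: ijK; rewrite E ltn_ord.
rewrite -big_split mulr_suml; apply: eq_bigr => i _ /=.
rewrite mulr_sumr (bigID (fun j : 'I_K => (K <= i + j)%N)) /=; congr (_ + _).
  by apply: eq_bigr => j _; rewrite exprD; ring.
by apply: eq_big => j; [rewrite -ltnNge | move=> _; rewrite exprD; ring].
Qed.

Lemma expandsM K f g L L' : expands K f L -> expands K g L' ->
  expands K (fun k => f k * g k) (conv L L').
Proof.
move=> H H'.
have B1 := bigOM H (expands_bounded H'); have B2 := bigOM (bigO_poly K L) H'.
rewrite addn0 in B1; rewrite add0n in B2.
apply: bigO_eq (bigOD (bigOD B1 B2) (bigO_poly_conv K L L')).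
by exists 0%N => k _; ring.
Qed.

Definition shift_seq (s : nat) (L : nat -> C) (j : nat) : C := if (j < s)%N then 0 else L (j - s)%N.

Lemma poly_part_shift s K L k : poly_part (s + K) (shift_seq s L) k = u k ^+ s * poly_part K L k.
Proof.
rewrite /poly_part big_split_ord /= big1 => [|j _]; last by rewrite /shift_seq ltn_ord mul0r.
rewrite add0r mulr_sumr; apply: eq_bigr => j _.
by rewrite /shift_seq ltnNge leq_addr /= addKn exprD; ring.
Qed.

Lemma expands_shift s K f L : expands K f L ->
  expands (s + K) (fun k => u k ^+ s * f k) (shift_seq s L).
Proof.
move=> H; apply: bigO_eq (bigOM (bigO_u s) H); exists 0%N => k _.
by rewrite poly_part_shift mulrBr.
Qed.

Lemma expands_cst K a : expands K (fun=> a) (fun j => if j == 0%N then a else 0).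
Proof.
apply: (@expands_le _ K.+1) => //.
apply: bigO_eq (bigO_zero _); exists 0%N => k _.
rewrite /poly_part big_ord_recl big1 => [|j _]; last exact: mul0r.
by rewrite expr0 mulr1 addr0 subrr.
Qed.

(** Once the lower coefficients vanish, [L j] satisfies [|L j| <= M |u k|] for all large [k], and
    [u k] tends to zero. *)
Lemma poly_uniq n L : bigO n (poly_part n L) -> forall j, (j < n)%N -> L j = 0.
Proof.
move=> H j; elim/ltn_ind: j => j IH jn.
have Hj : bigO j.+1 (poly_part n L) by apply: bigO_le H.
have H2 : bigO j.+1 (fun k => L j * u k ^+ j).
  have H3 : bigO j.+1 (fun k => \sum_(i < n | (j < i)%N) L i * u k ^+ i).
    by apply: bigO_sum => i ji; apply: bigO_scale; apply: bigO_le ji _; exact: bigO_u.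
  apply: bigO_eq (bigOD Hj (bigON H3)); exists 0%N => k _.
  apply/eqP; rewrite subr_eq; apply/eqP.
  rewrite /poly_part (bigD1 (Ordinal jn)) //=; congr (_ + _).
  rewrite (bigID (fun i : 'I_n => (j < i)%N)) /= [X in _ + X]big1 ?addr0.
    by apply: eq_bigl => i; rewrite -val_eqE /=; case: ltngtP.
  move=> i /andP[ij]; rewrite -leqNgt leq_eqVlt -val_eqE in ij *.
  by rewrite (negbTE ij) /= => /IH -> //; rewrite mul0r.
apply/eqP/negPn/negP => Lj0.
have [M [M0 [k0 HM]]] := bigO_gt0 H2.
have e0 : 0 < cabs (L j) / M by rewrite divr_gt0 ?cabs_gt0.
have [k1 Hk1] := u_to0 e0.
have [_] := HM _ (leq_maxl k0 k1); have := Hk1 _ (leq_maxr k0 k1).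
set k := maxn k0 k1; rewrite ltr_pdivlMr // => h1.
rewrite cabsM cabsX exprS mulrA ler_pM2r ?exprn_gt0 ?cabs_gt0 //.
by rewrite mulrC leNgt h1.
Qed.

Lemma expands_uniq K f L L' : expands K f L -> expands K f L' ->
  forall j, (j < K)%N -> L j = L' j.
Proof.
move=> H H' j jK; apply/eqP; rewrite -subr_eq0; apply/eqP.
apply: (@poly_uniq K (fun j => L j - L' j)) => //.
apply: bigO_eq (bigOD H' (bigON H)); exists 0%N => k _.
have -> : poly_part K (fun j => L j - L' j) k = poly_part K L k - poly_part K L' k.
  by rewrite /poly_part -sumrB; apply: eq_bigr => i _; rewrite mulrBl.
ring.
Qed.

Section MatrixExpansions.
Implicit Types m n : nat.

Definition mexpands m n (K : nat) (F L : nat -> 'M[C]_(m, n)) :=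
  forall i j, expands K (fun k => F k i j) (fun l => L l i j).

Lemma mexpands_eq m n K (F F' L L' : nat -> 'M[C]_(m, n)) :
  (exists k0, forall k, (k0 <= k)%N -> F k = F' k) ->
  (forall j, (j < K)%N -> L j = L' j) -> mexpands K F L -> mexpands K F' L'.
Proof.
move=> [k0 FF'] LL' H i j; apply: expands_eq (H i j).
  by exists k0 => k /FF' ->.
by move=> l /LL' ->.
Qed.

Lemma mexpandsD m n K (F F' L L' : nat -> 'M[C]_(m, n)) : mexpands K F L -> mexpands K F' L' ->
  mexpands K (fun k => F k + F' k) (fun j => L j + L' j).
Proof.
move=> H H' i j; apply: expands_ext (expandsD (H i j) (H' i j)) => [k|l _]; by rewrite mxE.
Qed.

Lemma mexpandsZ m n K a (F L : nat -> 'M[C]_(m, n)) : mexpands K F L ->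
  mexpands K (fun k => a *: F k) (fun j => a *: L j).
Proof.
move=> H i j; apply: expands_ext (expandsZ a (H i j)) => [k|l _]; by rewrite mxE.
Qed.

Lemma mexpandsN m n K (F L : nat -> 'M[C]_(m, n)) : mexpands K F L ->
  mexpands K (fun k => - F k) (fun j => - L j).
Proof.
move=> /(mexpandsZ (-1)); apply: mexpands_eq; last by move=> j _; rewrite scaleN1r.
by exists 0%N => k _; rewrite scaleN1r.
Qed.

Lemma mexpands_sum m n K (I : Type) (s : seq I) (P : pred I) (F L : I -> nat -> 'M[C]_(m, n)) :
  (forall i, P i -> mexpands K (F i) (L i)) ->
  mexpands K (fun k => \sum_(i <- s | P i) F i k) (fun j => \sum_(i <- s | P i) L i j).
Proof.
move=> H i j.
apply: expands_ext (expands_sum s (fun l Pl => H l Pl i j)) => [k|l _]; by rewrite summxE.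
Qed.

Lemma mexpands_scalar m n K (f L : nat -> C) (M : 'M[C]_(m, n)) : expands K f L ->
  mexpands K (fun k => f k *: M) (fun j => L j *: M).
Proof.
move=> H i j; apply: expands_ext (expandsZ (M i j) H) => [k|l _]; by rewrite mxE mulrC.
Qed.

Lemma mexpandsM n K (F F' L L' : nat -> 'M[C]_n) : mexpands K F L -> mexpands K F' L' ->
  mexpands K (fun k => F k *m F' k) (ps_mul L L').
Proof.
move=> H H' i j.
have := expands_sum (index_enum 'I_n) (P := xpredT) (fun l _ => expandsM (H i l) (H' l j)).
apply: expands_ext => [k|k _]; first by rewrite mxE.
rewrite /ps_mul summxE /conv exchange_big; apply: eq_bigr => a _.
by rewrite mxE.
Qed.

Lemma expands_trace n K (F L : nat -> 'M[C]_n) : mexpands K F L ->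
  expands K (fun k => \tr (F k)) (fun j => \tr (L j)).
Proof. by move=> H; apply: expands_sum => i _; exact: H. Qed.

Lemma mexpands_shift m n s K (F L : nat -> 'M[C]_(m, n)) : mexpands K F L ->
  mexpands (s + K) (fun k => u k ^+ s *: F k) (fun j => if (j < s)%N then 0 else L (j - s)%N).
Proof.
move=> H i j; apply: expands_ext (expands_shift s (H i j)) => [k|l _]; first by rewrite mxE.
by rewrite /shift_seq; case: ifP; rewrite ?mxE.
Qed.

Lemma mexpands_le m n K' K (F L : nat -> 'M[C]_(m, n)) : (K' <= K)%N ->
  mexpands K F L -> mexpands K' F L.
Proof. by move=> KK H i j; apply: expands_le KK _. Qed.

Lemma mexpands_poly m n K (L : nat -> 'M[C]_(m, n)) :
  mexpands K (fun k => \sum_(j < K) u k ^+ j *: L j) L.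
Proof.
move=> i j; apply: bigO_eq (bigO_zero K); exists 0%N => k _.
apply/esym/eqP; rewrite subr_eq0 summxE; apply/eqP; apply: eq_bigr => l _.
by rewrite mxE mulrC.
Qed.

(** The sum of the moduli of the entries is submultiplicative, unlike their maximum. *)
Definition sumnorm m n (M : 'M[C]_(m, n)) : R := \sum_i \sum_j cabs (M i j).

Lemma sumnorm_ge0 m n (M : 'M[C]_(m, n)) : 0 <= sumnorm M.
Proof. by apply: sumr_ge0 => i _; apply: sumr_ge0 => j _; exact: cabs_ge0. Qed.

Lemma sumnormD m n (M M' : 'M[C]_(m, n)) : sumnorm (M + M') <= sumnorm M + sumnorm M'.
Proof.
rewrite /sumnorm -big_split; apply: ler_sum => i _; rewrite -big_split; apply: ler_sum => j _ /=.
by rewrite mxE cabsD.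
Qed.

Lemma sumnormN m n (M : 'M[C]_(m, n)) : sumnorm (- M) = sumnorm M.
Proof. by apply: eq_bigr => i _; apply: eq_bigr => j _; rewrite mxE cabsN. Qed.

Lemma sumnormM m n l (M : 'M[C]_(m, n)) (M' : 'M[C]_(n, l)) :
  sumnorm (M *m M') <= sumnorm M * sumnorm M'.
Proof.
rewrite /sumnorm mulr_suml; apply: ler_sum => i _; rewrite mulr_suml.
apply: (@le_trans _ _ (\sum_j \sum_k cabs (M i k) * cabs (M' k j))).
  apply: ler_sum => j _; rewrite mxE; apply: le_trans (cabs_sum _ _ _) _.
  by apply: ler_sum => k _; rewrite cabsM.
rewrite exchange_big; apply: ler_sum => k _ /=; rewrite -mulr_sumr.
rewrite ler_wpM2l ?cabs_ge0 // [leRHS](bigD1 k) //= lerDl; apply: sumr_ge0 => a _.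
by apply: sumr_ge0 => b _; exact: cabs_ge0.
Qed.

Lemma entry_le_sumnorm m n (M : 'M[C]_(m, n)) i j : cabs (M i j) <= sumnorm M.
Proof.
rewrite /sumnorm (bigD1 i) //= (bigD1 j) //= -addrA lerDl addr_ge0 //.
  by apply: sumr_ge0 => k _; exact: cabs_ge0.
by apply: sumr_ge0 => k _; apply: sumr_ge0 => l _; exact: cabs_ge0.
Qed.

Lemma sumnorm_bigO m n K (F : nat -> 'M[C]_(m, n)) :
  (forall i j, bigO K (fun k => F k i j)) ->
  exists M : R, 0 < M /\ exists k0 : nat, forall k, (k0 <= k)%N -> sumnorm (F k) <= M * cabs (u k) ^+ K.
Proof.
move=> H.
have : bigO K (fun k => rc (sumnorm (F k))).
  have HH i j : bigO K (fun k => rc (cabs (F k i j))).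
    have [M [k0 Hk]] := H i j; exists M, k0 => k /Hk.
    by rewrite cabs_rc ger0_norm ?cabs_ge0.
  have := bigO_sum (index_enum 'I_m) (P := xpredT)
    (fun i _ => bigO_sum (index_enum 'I_n) (P := xpredT) (fun j _ => HH i j)).
  apply: bigO_eq; exists 0%N => k _.
  rewrite /rc /sumnorm rmorph_sum; apply: eq_bigr => i _.
  by rewrite rmorph_sum.
move=> /bigO_gt0[M [M0 [k0 Hk]]]; exists M; split => //; exists k0 => k /Hk[_].
by rewrite cabs_rc ger0_norm ?sumnorm_ge0.
Qed.

(** [Q k] is inverted approximately by the truncation [PH] of [H]. The error [E] of [F] satisfies
    [E = E Q PH - E (Q PH - 1)]. Here [E Q] is of order [u^K], and as [K > 0] the factor [Q PH - 1]
    eventually has norm at most 1/2, so that the last term is absorbed by the left-hand side. *)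
Lemma mexpands_cancel n K (F Q : nat -> 'M[C]_n) (Y G H : series_ring C n) : (0 < K)%N ->
  mexpands K (fun k => F k *m Q k) (Y * G) -> mexpands K Q G -> G * H = 1 -> mexpands K F Y.
Proof.
move=> K0 HFQ HQ GH.
pose PY k := \sum_(j < K) u k ^+ j *: Y j; pose PH k := \sum_(j < K) u k ^+ j *: H j.
have HPY : mexpands K PY Y by exact: mexpands_poly.
have HPH : mexpands K PH H by exact: mexpands_poly.
pose E k := F k - PY k.
have b1 i j : bigO K (fun k => (E k *m Q k) i j).
  have H2 : mexpands K (fun k => PY k *m Q k) (Y * G) by exact: mexpandsM.
  apply: bigO_eq (bigOD (HFQ i j) (bigON (H2 i j))); exists 0%N => k _.
  by rewrite /E mulmxBl mx_addE mx_oppE; ring.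
have b2 i j : bigO K (fun k => (Q k *m PH k - 1%:M) i j).
  have h2 := mexpandsM HQ HPH i j.
  rewrite -[ps_mul G H]/(G * H) GH in h2.
  apply: bigO_eq h2; exists 0%N => k _; rewrite !mxE; congr (_ - _).
  rewrite /poly_part; case: K K0 {HFQ HQ PY PH HPY HPH E b1} => // K' _.
  rewrite big_ord_recl expr0 mulr1 big1 ?addr0; first by rewrite series_oneE mxE.
  by move=> l _; rewrite series_oneE mxE mul0r.
have [M1 [M10 [k1 H1]]] := sumnorm_bigO b1.
have [M2 [M20 [k2 H2]]] := sumnorm_bigO b2.
have b3 i j : bigO 0 (fun k => PH k i j) by exact: expands_bounded (HPH i j).
have [M3 [M30 [k3 H3]]] := sumnorm_bigO b3.
have e0 : 0 < 1 / (2 * M2) by rewrite divr_gt0 // mulr_gt0.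
have [k4 H4] := u_to0 e0; have [k5 H5] := u_to0 (@ltr01 R).
move=> i j; exists (2 * (M1 * M3)), (maxn (maxn k1 k2) (maxn k3 (maxn k4 k5))) => k.
rewrite !geq_max => /and4P[/andP[/H1 h1 /H2 h2] /H3 h3 /H4 h4 /H5 h5].
have -> : F k i j - poly_part K (fun l => Y l i j) k = E k i j.
  rewrite /E mxE; congr (_ + _); rewrite mxE; congr (- _).
  by rewrite /PY summxE; apply: eq_bigr => l _; rewrite mxE mulrC.
apply: le_trans (entry_le_sumnorm _ _ _) _.
have EE : E k = E k *m Q k *m PH k - E k *m (Q k *m PH k - 1%:M).
  by rewrite mulmxBr mulmx1 mulmxA opprB addrC subrK.
have := sumnormD (E k *m Q k *m PH k) (- (E k *m (Q k *m PH k - 1%:M))).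
rewrite -EE sumnormN => h.
have small : sumnorm (Q k *m PH k - 1%:M) <= 1 / 2.
  apply: le_trans h2 _; case: K K0 {HFQ HQ PY PH HPY HPH E b1 b2 b3 H1 H2 H3 h1 h3 EE h} => // K' _.
  apply: (@le_trans _ _ (M2 * cabs (u k))).
    rewrite exprS ler_wpM2l ?(ltW M20) // ler_piMr ?cabs_ge0 //.
    by rewrite exprn_ile1 ?cabs_ge0 // ltW.
  by move: h4; rewrite ltr_pdivlMr ?mulr_gt0 //; lra.
have h6 := sumnormM (E k) (Q k *m PH k - 1%:M).
have h7 := sumnormM (E k *m Q k) (PH k).
rewrite expr0 mulr1 in h3.
have h8 : sumnorm (E k *m Q k) * sumnorm (PH k) <= M1 * cabs (u k) ^+ K * M3.
  by apply: ler_pM => //; exact: sumnorm_ge0.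
have h9 : sumnorm (E k) * sumnorm (Q k *m PH k - 1%:M) <= sumnorm (E k) * (1 / 2).
  by rewrite ler_wpM2l ?sumnorm_ge0.
lra.
Qed.

End MatrixExpansions.
End Expansions.
(** * Partial fractions and residues *)

Section LaurentBasis.
Variables (R : realType) (n : nat).
Local Notation C := (Cx R).
Local Notation sing := (option 'I_n).

Lemma sum_option (V : nmodType) (F : sing -> V) : \sum_nu F nu = F None + \sum_i F (Some i).
Proof.
rewrite (bigD1 None) //=; congr (_ + _).
rewrite (reindex_omap (Some : 'I_n -> sing) id) /=; last by case.
by apply: eq_bigl => i; rewrite eqxx.
Qed.

(* The basis of partial fractions, with the sign convention of [sys_eval]. *)
Definition frac (a : 'I_n -> C) (jj : sing) (m : nat) (z : C) : C :=
  if jj is Some j then (z - a j) ^- m.+1 else - z ^+ m.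

(* Laurent coefficients of [frac a jj m] at [nu], multiplied by the power
   [M nu] (at infinity [(M nu).-1]) of the local parameter. *)
Definition lcoef (a : 'I_n -> C) (M : sing -> nat) (nu jj : sing) (m k : nat) : C :=
  if (k < M nu)%N then
    if (nu == jj) && (k + m == (M nu).-1)%N then (if nu is Some _ then 1 else -1) else 0
  else let s := (k - M nu)%N in
  match nu, jj with
  | Some i, Some j => if j == i then 0 else (-1) ^+ s * 'C(m + s, s)%:R * (a i - a j) ^- (m + s).+1
  | Some i, None => - ('C(m, s)%:R * a i ^+ (m - s))
  | None, Some j => if (m <= s)%N then 'C(s, m)%:R * a j ^+ (s - m) else 0
  | None, None => 0
  end.

(* Derivative of [lcoef] when [a] moves with velocity [v]. *)
Definition dlcoef (a v : 'I_n -> C) (M : sing -> nat) (nu jj : sing) (m k : nat) : C :=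
  if (k < M nu)%N then 0
  else let s := (k - M nu)%N in
  match nu, jj with
  | Some i, Some j => if j == i then 0 else
      (-1) ^+ s * 'C(m + s, s)%:R * (- (m + s).+1%:R * (v i - v j) * (a i - a j) ^- (m + s).+2)
  | Some i, None => - ('C(m, s)%:R * ((m - s)%:R * v i * a i ^+ (m - s).-1))
  | None, Some j => if (m <= s)%N then 'C(s, m)%:R * ((s - m)%:R * v j * a j ^+ (s - m).-1) else 0
  | None, None => 0
  end.

(** Differentiating with respect to the position of a pole raises its order by one; infinity does
    not move. *)
Definition raise (M : sing -> nat) (nu : sing) : nat := if nu is Some _ then (M nu).+1 else M nu.

Lemma lcoef_raise a M i jj m k : (m < M jj)%N ->
  lcoef a (raise M) (Some i) jj m k = if k is k'.+1 then lcoef a M (Some i) jj m k' else 0.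
Proof.
move=> mM; case: k => [|k]; last by rewrite /lcoef /= ltnS subSS; case: (M (Some i)) (jj) => [|?] [?|] //=; rewrite addSn eqSS.
rewrite /lcoef /=; case: eqP => //= E; case: eqP => // E'.
by move: mM; rewrite -E -E' add0n ltnn.
Qed.

Lemma bin_shift m s : (m.+1 * 'C(m.+1 + s, s) = (m + s).+1 * 'C(m + s, s))%N.
Proof. by have := mul_bin_down (m + s).+1 s; rewrite /= addSn => ->; congr (_ * _)%N; lia. Qed.

Lemma natr_eq (p q : nat) : p = q -> p%:R = q%:R :> C. Proof. by move=> ->. Qed.

(** The derivative at fixed [z] is the one at fixed [xi] minus [v i] times [d/dxi], read on Laurent
    coefficients. On the left, [(m+1) v_j (z - a_j)^-(m+2)] is the motion of a basis element; on the
    right, [k - M] is the exponent of [xi]. For the regular coefficients this reduces to identities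
    between binomials. *)
Lemma lcoef_motion a v M i jj m k : (m < M jj)%N -> injective a ->
  (if jj is Some j then m.+1%:R * v j * lcoef a (raise M) (Some i) jj m.+1 k else 0) =
  (if k is k'.+1 then dlcoef a v M (Some i) jj m k' else 0)
    - v i * (k%:R - (M (Some i))%:R) * lcoef a M (Some i) jj m k.
Proof.
move=> mM ainj; have [kM|] := leqP k (M (Some i)).
  have -> : (if k is k'.+1 then dlcoef a v M (Some i) jj m k' else 0) = 0.
    by case: k kM => // k kM; rewrite /dlcoef kM.
  rewrite sub0r; case: jj mM => [j|] mM; last first.
    rewrite /lcoef; case: ltnP => kM'; first by rewrite /= mulr0 oppr0.
    have Ek : k = M (Some i) by lia.
    by rewrite Ek subrr mulr0 mul0r oppr0.
  rewrite /lcoef /= ltnS kM (inj_eq Some_inj).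
  case: eqP => [E|/eqP ij] /=; last first.
    rewrite mulr0; case: ltnP => kM'; first by rewrite mulr0 oppr0.
    have Ek : k = M (Some i) by lia.
    by rewrite Ek subrr mulr0 mul0r oppr0.
  rewrite -{j}E in mM *; rewrite addnS.
  case: ltnP => kM'; last first.
    have Ek : k = M (Some i) by lia.
    rewrite eqxx mulr0 oppr0; case: eqP => E; last by rewrite mulr0.
    by exfalso; lia.
  have -> : (k + m == (M (Some i)).-1)%N = ((k + m).+1 == M (Some i)) by apply/eqP/eqP; lia.
  case: eqP => E; last by rewrite !mulr0 oppr0.
  by rewrite -E !mulr1 -!natr1 natrD; ring.
move=> kM; have [s Es] : exists s, k = (M (Some i) + s).+1 by exists (k - (M (Some i)).+1)%N; lia.
subst k => {kM}.
rewrite /dlcoef /lcoef /=.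
have n1 : (M (Some i) + s < M (Some i))%N = false by lia.
have n2 : ((M (Some i) + s).+1 < M (Some i))%N = false by lia.
have n3 : ((M (Some i) + s).+1 < (M (Some i)).+1)%N = false by lia.
rewrite n1 n2 n3 subSS addKn.
have -> : ((M (Some i) + s).+1 - M (Some i) = s.+1)%N by lia.
have -> : ((M (Some i) + s).+1%:R : C) - (M (Some i))%:R = s.+1%:R.
  by rewrite -addnS natrD; ring.
case: jj mM => [j|] mM.
  case: eqP => [_|/eqP ij]; first by rewrite !mulr0 subr0.
  have b1 := natr_eq (bin_shift m s); have b2 := natr_eq (mul_bin_diag (m + s).+1 s).
  rewrite !natrM /= in b1 b2; rewrite addnS addSn.
  rewrite addSn in b1.
  set b := (a i - a j); set B := b ^- _.
  have -> : m.+1%:R * v j * ((-1) ^+ s * 'C((m + s).+1, s)%:R * B) =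
     (-1) ^+ s * v j * B * (m.+1%:R * 'C((m + s).+1, s)%:R) by ring.
  have -> : v i * s.+1%:R * ((-1) ^+ s.+1 * 'C((m + s).+1, s.+1)%:R * B) =
     - (-1) ^+ s * v i * B * (s.+1%:R * 'C((m + s).+1, s.+1)%:R) by rewrite exprS; ring.
  by rewrite b1 -b2; ring.
have b1 := natr_eq (mul_bin_left m s); rewrite !natrM in b1.
have -> : (m - s.+1 = (m - s).-1)%N by lia.
have -> : v i * s.+1%:R * - ('C(m, s.+1)%:R * a i ^+ (m - s).-1) =
   - (v i * a i ^+ (m - s).-1 * (s.+1%:R * 'C(m, s.+1)%:R)) by ring.
by rewrite b1; ring.
Qed.

(** The coordinate at infinity does not move, so there is no transport term. *)
Lemma lcoef_motion_infty a v M j m k :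
  m.+1%:R * v j * lcoef a (raise M) None (Some j) m.+1 k = dlcoef a v M None (Some j) m k.
Proof.
rewrite /lcoef /dlcoef /=; case: ltnP => kM; first by rewrite mulr0.
set s := (k - M None)%N.
have b1 := natr_eq (mul_bin_left s m); rewrite !natrM in b1.
case: (ltnP m s) => ms; last first.
  rewrite mulr0; case: leqP => // ms'.
  have Es : s = m by lia.
  by rewrite Es subnn !mul0r mulr0.
rewrite (ltnW ms) subnS.
have -> : m.+1%:R * v j * ('C(s, m.+1)%:R * a j ^+ (s - m).-1) =
  v j * a j ^+ (s - m).-1 * (m.+1%:R * 'C(s, m.+1)%:R) by ring.
by rewrite b1; ring.
Qed.

End LaurentBasis.

(** * Expansions of partial fractions *)

Section FracExpansions.
Variables (R : realType) (u : nat -> Cx R).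
Local Notation C := (Cx R).
Hypothesis u_neq0 : forall k, u k != 0.
Hypothesis u_to0 : forall e : R, 0 < e -> exists k0, forall k, (k0 <= k)%N -> cabs (u k) < e.

Lemma eventually_small (y : C) (e : R) : 0 < e ->
  exists k0, forall k, (k0 <= k)%N -> cabs (y * u k) < e.
Proof.
move=> e0; have y1 : 0 < cabs y + 1 by rewrite ltr_wpDl ?cabs_ge0.
have [k0 H] := u_to0 (divr_gt0 e0 y1); exists k0 => k /H.
rewrite ltr_pdivlMr // cabsM => h; apply: le_lt_trans h.
by rewrite mulrC ler_wpM2l ?cabs_ge0 // lerDl.
Qed.

Lemma eventually_unit (y : C) : exists k0, forall k, (k0 <= k)%N ->
  1 / 2 <= cabs (1 - y * u k) /\ 1 - y * u k != 0.
Proof.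
have e0 : (0 : R) < 1 / 2 by rewrite divr_gt0.
have [k0 H] := eventually_small y e0; exists k0 => k /H h.
have h1 : 1 / 2 <= cabs (1 - y * u k).
  have := cabsD (1 - y * u k) (y * u k); rewrite subrK cabs1; lra.
by split => //; rewrite -cabs_gt0; apply: lt_le_trans h1.
Qed.

Lemma expands_geometric K (y : C) : expands u K (fun k => (1 - y * u k)^-1) (fun s => y ^+ s).
Proof.
have [k0 H] := eventually_unit y.
have b0 : bigO u 0 (fun k => (1 - y * u k)^-1).
  exists 2, k0 => k /H[h1 h2]; rewrite expr0 mulr1 cabsV.
  by rewrite -[leRHS]invrK lef_pV2 ?posrE ?invr_gt0 ?cabs_gt0 // -div1r.
have b1 := bigOM (bigO_u u K) b0; rewrite addn0 in b1.
apply: bigO_eq (bigO_scale (y ^+ K) b1).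
exists k0 => k /H[_ h2].
have E1 : poly_part u K (fun s => y ^+ s) k = \sum_(i < K) (y * u k) ^+ i.
  by apply: eq_bigr => i _; rewrite exprMn.
have E2 := subrX1 (y * u k) K.
have -> : poly_part u K (fun s => y ^+ s) k = (1 - (y * u k) ^+ K) * (1 - y * u k)^-1.
  rewrite E1; apply: (mulIf h2); rewrite mulfVK // -[RHS]opprK opprB E2; ring.
by rewrite exprMn; ring.
Qed.

Lemma hockey_stick m s : (\sum_(i < s.+1) 'C(m + i, i) = 'C(m.+1 + s, s))%N.
Proof.
elim: s => [|s IH]; first by rewrite big_ord_recl big_ord0 !bin0.
rewrite big_ord_recr /= IH [in RHS]addnS binS addnC.
by rewrite addnS addSn.
Qed.

(** Each further factor is a geometric series, and the product with it sums binomials along a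
    diagonal: the hockey-stick identity. *)
Lemma expands_negative_binomial K m (y : C) :
  expands u K (fun k => (1 - y * u k) ^- m.+1) (fun s => 'C(m + s, s)%:R * y ^+ s).
Proof.
elim: m => [|m IH].
  apply: expands_ext (expands_geometric K y) => [k|s _]; first by rewrite expr1.
  by rewrite add0n binn mul1r.
apply: expands_ext (expandsM u_to0 IH (expands_geometric K y)) => [k|s _].
  by rewrite -invfM -exprSr.
rewrite /conv -hockey_stick natr_sum mulr_suml; apply: eq_bigr => i _.
by rewrite -mulrA -exprD subnKC // -ltnS.
Qed.

Lemma expands_monomial K e : expands u K (fun k => u k ^+ e) (fun s => (s == e)%:R).
Proof.
apply: (@expands_le _ _ u_to0 _ (e + K)); first by rewrite leq_addl.
apply: expands_ext (expands_shift e (expands_cst u_to0 K 1)) => [k|s _]; first by rewrite mulr1.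
rewrite /shift_seq; case: ltngtP => // es; last by rewrite es subnn.
by rewrite subn_eq0 leqNgt es.
Qed.

Lemma expands_shift_le s K f L : expands u K f L ->
  expands u K (fun k => u k ^+ s * f k) (shift_seq s L).
Proof.
by move=> /(expands_shift s); apply: expands_le u_to0 _ _ _ _ _; rewrite leq_addl.
Qed.

Variable n : nat.
Local Notation sing := (option 'I_n).

Definition near_point (a : 'I_n -> C) (nu : sing) (x : C) : C :=
  if nu is Some i then a i + x else x^-1.

Definition porder (M : sing -> nat) (nu : sing) : nat := if nu is Some _ then M nu else (M nu).-1.

Lemma expands_frac a M nu jj m K : injective a -> (0 < M None)%N -> (m < M jj)%N ->
  expands u K (fun k => u k ^+ porder M nu * frac a jj m (near_point a nu (u k)))
    (lcoef a M nu jj m).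
Proof.
move=> ainj MN mM; case: nu => [i|] /=; case: jj mM => [j|] mM /=.
- have [ij|ij] := eqVneq j i.
    rewrite -ij; apply: expands_ext (expands_monomial K (M (Some j) - m.+1)) => [k|s _].
      rewrite [a j + _]addrC addrK -{2}(subnK mM) exprD mulfK //.
      by rewrite expf_neq0.
    rewrite /lcoef !eqxx /=; case: ltnP => sM.
      have -> : (s + m == (M (Some j)).-1)%N = (s == M (Some j) - m.+1)%N by apply/eqP/eqP; lia.
      by case: eqP.
    by case: eqP => // E; exfalso; lia.
  pose b := a i - a j.
  have b0 : b != 0 by rewrite subr_eq0 (inj_eq ainj) eq_sym.
  (* Here [z - a_j = b + xi = b (1 + xi / b)] with [b = a_i - a_j]. *)
  apply: expands_ext (expands_shift_le (M (Some i))
    (expandsZ (b ^- m.+1) (expands_negative_binomial K m (- b^-1)))) => [k|s _].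
    congr (_ * _); rewrite -invfM -exprMn; congr (_ ^- _).
    by rewrite mulrBr mulr1 mulrA mulrN divff // mulN1r opprK /b; ring.
  rewrite /shift_seq /lcoef (inj_eq Some_inj) eq_sym (negbTE ij) /=.
  case: ltnP => // Ms; set t := (s - _)%N.
  rewrite (exprNn b^-1 t) exprVn -/b -addSn exprD invfM; ring.
- apply: expands_ext (expands_shift_le (M (Some i)) (expandsZ (-1)
    (_ : expands u K (fun k => (a i + u k) ^+ m) (fun s => 'C(m, s)%:R * a i ^+ (m - s))))) => [k|s _|].
  + by rewrite mulN1r.
  + by rewrite /shift_seq /lcoef /=; case: ltnP => // _; rewrite mulN1r.
  apply: (@expands_le _ _ u_to0 _ (m.+1 + K)); first by rewrite leq_addl.
  apply: bigO_eq (bigO_zero u _); exists 0%N => k _.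
  rewrite /poly_part big_split_ord /= [X in _ - (_ + X)]big1 ?addr0 => [|l _].
    rewrite exprDn; apply/esym/eqP; rewrite subr_eq0; apply/eqP; apply: eq_bigr => l _.
    by rewrite -mulr_natl; ring.
  by rewrite bin_small ?mul0r // ltn_addr.
(* At infinity [z - a_j = (1 - a_j xi) / xi]; one of the [m + 1] factors [xi] completes the power
   [(M None).-1] to [M None]. *)
- apply: expands_ext (expands_shift_le (M None + m)
    (expands_negative_binomial K m (a j))) => [k|s _].
    have -> : (u k)^-1 - a j = (1 - a j * u k) / u k by rewrite mulrBl mulfK // mul1r.
    have -> : u k ^+ (M None + m) = u k ^+ (M None).-1 * u k ^+ m.+1.
      by rewrite -exprD; congr (_ ^+ _); lia.
    by rewrite exprMn invfM exprVn invrK; ring.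
  rewrite /shift_seq /lcoef /=; case: (ltnP s (M None)) => sM.
    by rewrite (leq_trans sM (leq_addr _ _)).
  case: ltnP => ms; first by rewrite leqNgt (_ : (_ < m)%N) //; lia.
  have -> : (m <= s - M None)%N by lia.
  have -> : (s - (M None + m) = s - M None - m)%N by lia.
  have ms' : (m <= s - M None)%N by lia.
  by rewrite subnKC // bin_sub.
- apply: expands_ext (expandsZ (-1) (expands_monomial K ((M None).-1 - m))) => [k|s _].
    have -> : u k ^+ (M None).-1 = u k ^+ ((M None).-1 - m) * u k ^+ m.
      by rewrite -exprD subnK //; lia.
    by rewrite mulrN exprVn mulfK ?expf_neq0 // mulN1r.
  rewrite /lcoef eqxx /=; case: ltnP => sM.
    have -> : (s + m == (M None).-1)%N = (s == (M None).-1 - m)%N by apply/eqP/eqP; lia.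
    by case: eqP; rewrite ?mulr1 ?mulr0.
  by case: eqP => E; [exfalso; lia | rewrite mulr0].
Qed.

End FracExpansions.

(** * Rational functions and their residues *)

Section Residues.
Variables (R : realType) (n : nat) (a : 'I_n -> Cx R).
Local Notation C := (Cx R).
Local Notation sing := (option 'I_n).
Hypothesis a_inj : injective a.

(** The linear span of the partial fraction basis, with the values at the poles left free by
    [RatEq]. Closure under products amounts to partial fraction decomposition. *)
Inductive rational_fun : (C -> C) -> Prop :=
| RatFrac jj m : rational_fun (frac a jj m)
| RatAdd f g of rational_fun f & rational_fun g : rational_fun (fun z => f z + g z)
| RatScale c f of rational_fun f : rational_fun (fun z => c * f z)
| RatEq f g of rational_fun f & (forall z, (forall i, z != a i) -> f z = g z) : rational_fun g.

Lemma rat_zero : rational_fun (fun=> 0).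
Proof.
by apply: RatEq (RatScale 0 (RatFrac None 0)) _ => z _; rewrite mul0r.
Qed.

Lemma rat_sum (I : Type) (s : seq I) (P : pred I) (f : I -> C -> C) :
  (forall i, P i -> rational_fun (f i)) -> rational_fun (fun z => \sum_(i <- s | P i) f i z).
Proof.
move=> H; elim: s => [|i s IH]; first by apply: RatEq rat_zero _ => z _; rewrite big_nil.
case Pi: (P i).
  by apply: RatEq (RatAdd (H i Pi) IH) _ => z _; rewrite big_cons Pi.
by apply: RatEq IH _ => z _; rewrite big_cons Pi.
Qed.

Lemma rat_mulX f : rational_fun f -> rational_fun (fun z => z * f z).
Proof.
elim=> {f} [jj m|f g _ If _ Ig|c f _ If|f g _ If fg].
- case: jj => [j|].
    have H1 : rational_fun (fun z => a j * frac a (Some j) m z) by apply: RatScale; exact: RatFrac.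
    case: m H1 => [|m] H1.
      apply: RatEq (RatAdd (RatScale (-1) (RatFrac None 0)) H1) _ => z /(_ j) zj.
      by rewrite /= mulrN mulN1r opprK expr0; field; rewrite subr_eq0.
    apply: RatEq (RatAdd (RatFrac (Some j) m) H1) _ => z /(_ j) zj /=.
    have e : (z - a j) ^- m.+2 = (z - a j)^-1 * (z - a j) ^- m.+1 by rewrite exprS invfM.
    have h : z * (z - a j)^-1 = 1 + a j * (z - a j)^-1 by field; rewrite subr_eq0.
    by rewrite e [z * (_ * _)]mulrA h; ring.
  by apply: RatEq (RatFrac None m.+1) _ => z _ /=; rewrite mulrN -exprS.
- by apply: RatEq (RatAdd If Ig) _ => z _; rewrite mulrDr.
- by apply: RatEq (RatScale c If) _ => z _; rewrite mulrCA.
- by apply: RatEq If _ => z /fg ->.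
Qed.

(** For distinct poles, splitting [1 / ((z - a_i) (z - a_j))] lowers the order at [a_j] by one; for
    powers of [z] the same induction uses [z = (z - a_i) + a_i]. *)
Lemma rat_mulV i f : rational_fun f -> rational_fun (fun z => (z - a i)^-1 * f z).
Proof.
elim=> {f} [jj m|f g _ If _ Ig|c f _ If|f g _ If fg].
- case: jj => [j|].
    have [->|ij] := eqVneq j i.
      by apply: RatEq (RatFrac (Some i) m.+1) _ => z _ /=; rewrite exprS invfM.
    have b0 : a i - a j != 0 by rewrite subr_eq0 (inj_eq a_inj) eq_sym.
    elim: m => [|m IH].
      apply: RatEq (RatScale (a i - a j)^-1
        (RatAdd (RatFrac (Some i) 0) (RatScale (-1) (RatFrac (Some j) 0)))) _ => z zP.
      rewrite /= !expr1; field.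
      by rewrite !subr_eq0 !zP -subr_eq0 b0.
    apply: RatEq (RatScale (a i - a j)^-1 (RatAdd IH (RatScale (-1) (RatFrac (Some j) m.+1)))) _ => z zP.
    have nj : z - a j != 0 by rewrite subr_eq0 zP.
    have ni : z - a i != 0 by rewrite subr_eq0 zP.
    have e : (z - a j) ^- m.+2 = (z - a j)^-1 * (z - a j) ^- m.+1 by rewrite exprS invfM.
    have h : (z - a i)^-1 * (z - a j)^-1 = (a i - a j)^-1 * ((z - a i)^-1 - (z - a j)^-1).
      by field; rewrite ni nj b0.
    by rewrite /= e [(z - a i)^-1 * ((z - a j)^-1 * _)]mulrA h; ring.
  elim: m => [|m IH].
    by apply: RatEq (RatScale (-1) (RatFrac (Some i) 0)) _ => z _ /=; rewrite expr0 expr1 mulrN1 mulN1r.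
  apply: RatEq (RatAdd (RatFrac None m) (RatScale (a i) IH)) _ => z zP /=.
  have ni : z - a i != 0 by rewrite subr_eq0 zP.
  by rewrite exprS; field.
- by apply: RatEq (RatAdd If Ig) _ => z _; rewrite mulrDr.
- by apply: RatEq (RatScale c If) _ => z _; rewrite mulrCA.
- by apply: RatEq If _ => z /fg ->.
Qed.

Lemma rat_mul f g : rational_fun f -> rational_fun g -> rational_fun (fun z => f z * g z).
Proof.
move=> Hf Hg; elim: Hf => {f} [jj m|f f' _ If _ If'|c f _ If|f f' _ If ff'].
- case: jj => [j|]; elim: m => [|m IH].
  + by apply: RatEq (rat_mulV j Hg) _ => z _ /=; rewrite expr1.
  + apply: RatEq (rat_mulV j IH) _ => z _ /=.
    by rewrite mulrA [_ ^+ m.+2]exprS invfM.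
  + by apply: RatEq (RatScale (-1) Hg) _ => z _ /=; rewrite expr0.
  + by apply: RatEq (rat_mulX IH) _ => z _ /=; rewrite mulrA mulrN -exprS.
- by apply: RatEq (RatAdd If If') _ => z _; rewrite mulrDl.
- by apply: RatEq (RatScale c If) _ => z _; rewrite mulrA.
- by apply: RatEq If _ => z /ff' ->.
Qed.

Variable u : sing -> nat -> C.
Hypothesis u_neq0 : forall nu k, u nu k != 0.
Hypothesis u_to0 : forall nu (e : R), 0 < e ->
  exists k0, forall k, (k0 <= k)%N -> cabs (u nu k) < e.

Let z nu k := near_point a nu (u nu k).

Lemma eventually_all (I : finType) (Q : I -> nat -> Prop) :
  (forall i, exists k0, forall k, (k0 <= k)%N -> Q i k) ->
  exists k0, forall k, (k0 <= k)%N -> forall i, Q i k.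
Proof.
move=> /choice[k0 H]; exists (\max_i k0 i) => k hk i; apply: H.
by apply: leq_trans hk; exact: leq_bigmax.
Qed.

Lemma eventually_off_poles nu : exists k0, forall k, (k0 <= k)%N -> forall i, z nu k != a i.
Proof.
apply: (eventually_all (Q := fun i k => z nu k != a i)) => j; rewrite /z; case: nu => [i|] /=.
  have [->|ij] := eqVneq i j.
    by exists 0%N => k _; rewrite -subr_eq0 [_ + u _ _]addrC addrK.
  have b0 : 0 < cabs (a j - a i).
    by rewrite cabs_gt0 subr_eq0 (inj_eq a_inj) eq_sym.
  have [k0 H] := u_to0 (Some i) b0; exists k0 => k /H h; apply/negP => /eqP E.
  by move: h; rewrite -E [_ + u _ _]addrC addrK ltxx.
have [k0 H] := eventually_unit (u_to0 None) (a j); exists k0 => k /H[_ h].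
apply/negP => /eqP E; move: h; rewrite -E mulVf ?subrr ?eqxx //.
Qed.

(** Residues as expansion coefficients along the sequences [u], after clearing poles by some power.
    The last clause already contains the residue theorem: the coefficient of [1 / z] at infinity is
    the sum of the finite residues. It holds on the partial fraction basis and is preserved by
    linear combinations. *)
Definition has_residues (f : C -> C) (b : 'I_n -> C) : Prop :=
  (forall i, exists K L, expands (u (Some i)) K.+1
     (fun k => u (Some i) k ^+ K.+1 * f (z (Some i) k)) L /\ L K = b i) /\
  (exists K L, expands (u None) K.+2
     (fun k => u None k ^+ K * f (z None k)) L /\ L K.+1 = \sum_i b i).

Lemma rational_has_residues f : rational_fun f -> exists b, has_residues f b.
Proof.
elim=> {f} [jj m|f g _ [b [Fb Ib]] _ [b' [Fb' Ib']]|c f _ [b [Fb Ib]]|f g _ [b [Fb Ib]] fg].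
- exists (fun i => ((Some i == jj) && (m == 0%N))%:R); split=> [i|].
    exists m, (lcoef a (fun=> m.+1) (Some i) jj m); split.
      exact: (expands_frac (u_neq0 _) (u_to0 _) (Some i) m.+1 a_inj (M := fun=> m.+1)).
    rewrite /lcoef ltnSn /=; have -> : (m + m == m)%N = (m == 0)%N by apply/eqP/eqP; lia.
    by case: ifP.
  exists m, (lcoef a (fun=> m.+1) None jj m); split.
    exact: (expands_frac (u_neq0 _) (u_to0 _) None m.+2 a_inj (M := fun=> m.+1)).
  rewrite /lcoef ltnn subnn; case: jj => [j|].
    rewrite (bigD1 j) //= eqxx big1 ?addr0 => [|i ij].
      by case: m => //=; rewrite bin0 mul1r expr0.
    by rewrite (inj_eq Some_inj) (negbTE ij).
  by rewrite big1.
- exists (fun i => b i + b' i); split=> [i|].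
    have [K [L [E e]]] := Fb i; have [K' [L' [E' e']]] := Fb' i.
    exists (K' + K)%N, (fun j => shift_seq K' L j + shift_seq K L' j); split.
      have E1 := expands_shift K' E; have E2 := expands_shift K E'.
      have e1 : (K' + K.+1 = (K' + K).+1)%N by lia.
      have e2 : (K + K'.+1 = (K' + K).+1)%N by lia.
      rewrite e1 in E1; rewrite e2 in E2.
      apply: (expands_ext _ _ (expandsD E1 E2)) => [k|//].
      by rewrite /= !mulrA -!exprD mulrDr e1 e2.
    rewrite /shift_seq ltnNge leq_addr /= addKn e.
    by rewrite ltnNge leq_addl /= addnK e'.
  have [K [L [E e]]] := Ib; have [K' [L' [E' e']]] := Ib'.
  exists (K' + K)%N, (fun j => shift_seq K' L j + shift_seq K L' j); split.
    have E1 := expands_shift K' E; have E2 := expands_shift K E'.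
    have e1 : (K' + K.+2 = (K' + K).+2)%N by lia.
    have e2 : (K + K'.+2 = (K' + K).+2)%N by lia.
    rewrite e1 in E1; rewrite e2 in E2.
    apply: (expands_ext _ _ (expandsD E1 E2)) => [k|//].
    by rewrite /= !mulrA -!exprD mulrDr [(K + K')%N]addnC.
  rewrite /shift_seq big_split /= -e -e'.
  by rewrite !ifF; [congr (L _ + L' _); lia | lia | lia].
- exists (fun i => c * b i); split=> [i|].
    have [K [L [E e]]] := Fb i; exists K, (fun j => c * L j); split; last by rewrite e.
    by apply: (expands_ext _ _ (expandsZ c E)) => [k|//]; rewrite mulrCA.
  have [K [L [E e]]] := Ib; exists K, (fun j => c * L j); split; last by rewrite e mulr_sumr.
  by apply: (expands_ext _ _ (expandsZ c E)) => [k|//]; rewrite mulrCA.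
- exists b; split=> [i|].
    have [K [L [E e]]] := Fb i; exists K, L; split=> //.
    apply: expands_eq E => //; have [k0 H] := eventually_off_poles (Some i).
    by exists k0 => k /H/fg ->.
  have [K [L [E e]]] := Ib; exists K, L; split=> //.
  apply: expands_eq E => //; have [k0 H] := eventually_off_poles None.
  by exists k0 => k /H/fg ->.
Qed.

(** The clearing powers [s] are prescribed, whereas [has_residues] provides its own. Multiplying
    each expansion by the power of the other makes them comparable, and uniqueness of expansions
    identifies the coefficients. *)
Theorem residue_theorem f (s : sing -> nat) (L : sing -> nat -> C) : rational_fun f ->
  (forall i, (0 < s (Some i))%N) ->
  (forall nu, expands (u nu) (s nu).+2 (fun k => u nu k ^+ s nu * f (z nu k)) (L nu)) ->
  \sum_i L (Some i) (s (Some i)).-1 - L None (s None).+1 = 0.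
Proof.
move=> /rational_has_residues[b [Fb [K [L0 [E0 e0]]]]] s0 H.
have -> : L None (s None).+1 = \sum_i b i.
  rewrite -e0.
  have H1 := expands_shift K (H None); have H2 := expands_shift (s None) E0.
  have e1 : (s None + K.+2 = K + (s None).+2)%N by lia.
  rewrite e1 in H2.
  have H2' : expands (u None) (K + (s None).+2)
     (fun k => u None k ^+ K * (u None k ^+ s None * f (z None k))) (shift_seq (s None) L0).
    by apply: expands_ext H2 => // k; rewrite mulrCA.
  have := expands_uniq (u_neq0 None) (u_to0 None) H1 H2' (j := (K + (s None).+1)%N).
  have jlt : (K + (s None).+1 < K + (s None).+2)%N by lia.
  move=> /(_ jlt); rewrite /shift_seq !ifF; [|lia|lia].
  have -> : (K + (s None).+1 - K = (s None).+1)%N by lia.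
  by have -> : (K + (s None).+1 - s None = K.+1)%N by lia.
apply/eqP; rewrite subr_eq0; apply/eqP; apply: eq_bigr => i _.
have [K' [L' [E' <-]]] := Fb i.
have H1 := expands_shift K'.+1 (expandsS (u_to0 _) (expandsS (u_to0 _) (H (Some i)))).
have H2 := expands_shift (s (Some i)) E'.
have e1 : (s (Some i) + K'.+1 = K'.+1 + s (Some i))%N by lia.
rewrite e1 in H2.
have H2' : expands (u (Some i)) (K'.+1 + s (Some i))
    (fun k => u (Some i) k ^+ K'.+1 * (u (Some i) k ^+ s (Some i) * f (z (Some i) k)))
    (shift_seq (s (Some i)) L').
  by apply: expands_ext H2 => // k; rewrite mulrCA.
have := expands_uniq (u_neq0 (Some i)) (u_to0 (Some i)) H1 H2' (j := (K' + s (Some i))%N).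
have s1 := s0 i.
have n1 : (K' + s (Some i) < K'.+1)%N = false by apply/negbTE; rewrite -leqNgt -addn1 leq_add2l.
have n2 : (K' + s (Some i) < s (Some i))%N = false by apply/negbTE; rewrite -leqNgt leq_addl.
rewrite /shift_seq n1 n2.
have -> : (K' + s (Some i) - K'.+1 = (s (Some i)).-1)%N by lia.
by rewrite addnK => -> //; lia.
Qed.

End Residues.

(** * Laurent expansions of the system and of its derivatives *)

Section SystemExpansions.
Variables (R : realType) (N n : nat) (r : option 'I_n -> nat).
Local Notation C := (Cx R).
Local Notation sing := (option 'I_n).
Implicit Types (t v : times R N r) (c : sing -> nat -> 'M[C]_N).

Definition poles t (i : 'I_n) : C := Defs.center t (Some i).

Lemma sys_evalE t c z : sys_eval t c z =
  \sum_jj \sum_(m < ncoef r jj) frac (poles t) jj m z *: c jj m.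
Proof.
rewrite sum_option addrC /sys_eval; congr (_ + _).
by rewrite -sumrN; apply: eq_bigr => k _; rewrite scaleNr.
Qed.

(** The cases of [sys_laurent] united in one sum over the partial fraction basis: the times enter
    through [lcoef] only, and the coefficients of the system enter linearly. *)
Lemma sys_laurentE t c nu k : (0 < r None)%N -> sys_laurent t c nu k =
  \sum_jj \sum_(m < ncoef r jj) lcoef (poles t) (ncoef r) nu jj m k *: c jj m.
Proof.
move=> r0; rewrite /sys_laurent; have [kM|kM] := ltnP k (ncoef r nu).
  have mB : ((ncoef r nu).-1 - k < ncoef r nu)%N by lia.
  rewrite (bigD1 nu) //= (bigD1 (Ordinal mB)) //= big1 => [|m /eqP mn]; last first.
    rewrite /lcoef kM eqxx /=; case: eqP => E; last by rewrite scale0r.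
    by case: mn; apply/val_inj => /=; lia.
  rewrite big1 => [|jj jn]; last first.
    rewrite big1 // => m _; rewrite /lcoef kM eq_sym (negbTE jn) /= scale0r //.
  rewrite !addr0 /lcoef kM eqxx /=.
  have -> : (k + ((ncoef r nu).-1 - k) == (ncoef r nu).-1)%N by apply/eqP; lia.
  by case: nu {kM mB}.
have lE jj m : lcoef (poles t) (ncoef r) nu jj m k = let s := (k - ncoef r nu)%N in
  match nu, jj with
  | Some i, Some j => if j == i then 0 else
      (-1) ^+ s * 'C(m + s, s)%:R * (poles t i - poles t j) ^- (m + s).+1
  | Some i, None => - ('C(m, s)%:R * poles t i ^+ (m - s))
  | None, Some j => if (m <= s)%N then 'C(s, m)%:R * poles t j ^+ (s - m) else 0
  | None, None => 0
  end by rewrite /lcoef ltnNge kM.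
rewrite sum_option; case: nu kM lE => [i|] kM lE.
  rewrite addrC; congr (_ + _); last first.
    rewrite -sumrN big_mkcond; apply: eq_bigr => m _; rewrite lE /= scaleNr.
    by case: leqP => // sm; rewrite bin_small // mul0r scale0r oppr0.
  rewrite [RHS](bigD1 i) //= [X in _ = X + _]big1 ?add0r => [|m _]; last by rewrite lE /= eqxx scale0r.
  apply: eq_bigr => j ji; apply: eq_bigr => m _.
  by rewrite lE /= (negbTE ji).
rewrite [X in _ = X + _]big1 ?add0r => [|m _]; last by rewrite lE scale0r.
apply: eq_bigr => j _; rewrite big_mkcond; apply: eq_bigr => m _.
by rewrite lE /=; case: ifP => //; rewrite scale0r.
Qed.

(* The derivative at fixed [z] of [sys_eval] when the times move with velocity
   [v] and the coefficients with velocity [c2]. *)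
Definition sys_der t v c c2 (z : C) : 'M[C]_N := \sum_jj \sum_(m < ncoef r jj)
  (frac (poles t) jj m z *: c2 jj m +
   (if jj is Some j then m.+1%:R * poles v j * frac (poles t) (Some j) m.+1 z else 0) *: c jj m).

Definition sys_laurent_der t v c c2 nu (k : nat) : 'M[C]_N := \sum_jj \sum_(m < ncoef r jj)
  (dlcoef (poles t) (poles v) (ncoef r) nu jj m k *: c jj m
   + lcoef (poles t) (ncoef r) nu jj m k *: c2 jj m).

Lemma rational_sys_der t v c c2 i j : rational_fun (poles t) (fun z => sys_der t v c c2 z i j).
Proof.
have H : rational_fun (poles t) (fun z => \sum_jj \sum_(m < ncoef r jj)
    (c2 jj m i j * frac (poles t) jj m z +
     (if jj is Some l then m.+1%:R * poles v l * c jj m i j else 0) *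
       frac (poles t) jj m.+1 z)).
  apply: rat_sum => jj _; apply: rat_sum => m _.
  by apply: RatAdd; apply: RatScale; exact: RatFrac.
apply: RatEq H _ => z _; rewrite /sys_der summxE; apply: eq_bigr => jj _.
rewrite summxE; apply: eq_bigr => m _; rewrite !mxE; case: jj m => [l|] m; ring.
Qed.

Lemma rational_at_entry t (f : C -> 'M[C]_N) i j : rational_at t f ->
  rational_fun (poles t) (fun z => f z i j).
Proof.
move=> [K [B [B' fE]]].
have H : rational_fun (poles t) (fun z => \sum_l \sum_(k < K) B l k i j * frac (poles t) (Some l) k z
   + \sum_(k < K) (- B' k i j) * frac (poles t) None k z).
  apply: RatAdd.
    by apply: rat_sum => l _; apply: rat_sum => k _; apply: RatScale; exact: RatFrac.
  by apply: rat_sum => k _; apply: RatScale; exact: RatFrac.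
apply: RatEq H _ => z /fE ->; rewrite mxE !summxE; congr (_ + _).
  apply: eq_bigr => l _; rewrite summxE; apply: eq_bigr => k _.
  by rewrite mxE mulrC.
by apply: eq_bigr => k _; rewrite mxE mulrNN mulrC.
Qed.

Variable u : nat -> C.
Hypothesis u_neq0 : forall k, u k != 0.
Hypothesis u_to0 : forall e : R, 0 < e -> exists k0, forall k, (k0 <= k)%N -> cabs (u k) < e.
Hypothesis r0 : (0 < r None)%N.

Lemma mexpands_sys t c nu K : injective (poles t) ->
  mexpands u K (fun k => u k ^+ pole_order r nu *: sys_eval t c (near_point (poles t) nu (u k)))
    (sys_laurent t c nu).
Proof.
move=> tinj.
have H := mexpands_sum (index_enum sing) (P := xpredT) (fun jj _ =>
  mexpands_sum (index_enum 'I_(ncoef r jj)) (P := xpredT) (fun m _ =>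
    mexpands_scalar (c jj m) (expands_frac u_neq0 u_to0 nu K tinj (M := ncoef r) r0 (ltn_ord m)))).
apply: mexpands_eq H; last by move=> k _; rewrite sys_laurentE.
exists 0%N => k _; rewrite sys_evalE scaler_sumr; apply: eq_bigr => jj _.
rewrite scaler_sumr; apply: eq_bigr => m _; rewrite scalerA.
by case: (nu).
Qed.

Let sys_der_expands t v c c2 nu K : injective (poles t) ->
  mexpands u K (fun k => u k ^+ porder (raise (ncoef r)) nu *:
      sys_der t v c c2 (near_point (poles t) nu (u k)))
    (fun k => \sum_jj \sum_(m < ncoef r jj)
       (lcoef (poles t) (raise (ncoef r)) nu jj m k *: c2 jj m +
        (if jj is Some j then m.+1%:R * poles v j *
           lcoef (poles t) (raise (ncoef r)) nu (Some j) m.+1 k else 0) *: c jj m)).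
Proof.
move=> tinj.
have H1 jj (m : 'I_(ncoef r jj)) : expands u K (fun k => u k ^+ porder (raise (ncoef r)) nu *
    frac (poles t) jj m (near_point (poles t) nu (u k)))
    (lcoef (poles t) (raise (ncoef r)) nu jj m).
  apply: expands_frac => //; case: jj m => [j|] m; have := ltn_ord m => //=; exact: ltnW.
have H2 jj (m : 'I_(ncoef r jj)) : expands u K (fun k =>
    if jj is Some j then m.+1%:R * poles v j * (u k ^+ porder (raise (ncoef r)) nu *
    frac (poles t) (Some j) m.+1 (near_point (poles t) nu (u k))) else 0)
    (fun k => if jj is Some j then m.+1%:R * poles v j *
      lcoef (poles t) (raise (ncoef r)) nu (Some j) m.+1 k else 0).
  case: jj m => [j|] m; last by apply: bigO_expands; exact: bigO_zero.
  by apply: expandsZ; apply: expands_frac => //=; rewrite ltnS; exact: ltn_ord.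
have H := mexpands_sum (index_enum sing) (P := xpredT) (fun jj _ =>
  mexpands_sum (index_enum 'I_(ncoef r jj)) (P := xpredT) (fun m _ =>
    mexpandsD (mexpands_scalar (c2 jj m) (H1 jj m)) (mexpands_scalar (c jj m) (H2 jj m)))).
apply: mexpands_eq H => //.
exists 0%N => k _; rewrite scaler_sumr; apply: eq_bigr => jj _.
rewrite scaler_sumr; apply: eq_bigr => m _; rewrite scalerDr !scalerA; congr (_ + _ *: _).
by case: jj m => [j|] m; rewrite ?mulr0 // mulrCA.
Qed.

Local Notation xi := (series_var C N).
Local Notation cst := (@series_const C N).

(** This is the shape in which the derivative of the system at fixed [z] enters [local_curvature];
    [lcoef_motion] produces it for each basis element. *)
Lemma mexpands_sys_der t v c c2 i K : injective (poles t) ->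
  let a := sys_laurent t c (Some i) : series_ring C N in
  let a2 := sys_laurent_der t v c c2 (Some i) : series_ring C N in
  mexpands u K (fun k => u k ^+ (r (Some i)).+2 *:
      sys_der t v c c2 (near_point (poles t) (Some i) (u k)))
    (xi * a2 - cst (Defs.center v (Some i)) * (eul a - cst (r (Some i)).+1%:R * a)).
Proof.
move=> tinj a a2; apply: mexpands_eq (sys_der_expands v c c2 (Some i) K tinj) => [|k _].
  by exists 0%N.
rewrite series_addE series_oppE series_constM series_addE series_oppE series_constM.
rewrite -scalerBl scalerA series_varM -[a k]/(sys_laurent t c (Some i) k) sys_laurentE //.
rewrite scaler_sumr.
have -> : (if k is k'.+1 then a2 k' else 0) = \sum_jj \sum_(m < ncoef r jj)
  (if k is k'.+1 then dlcoef (poles t) (poles v) (ncoef r) (Some i) jj m k' *: c jj m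
   + lcoef (poles t) (ncoef r) (Some i) jj m k' *: c2 jj m else 0).
  by case: k => // ; rewrite big1 // => jj _; rewrite big1.
rewrite -sumrB; apply: eq_bigr => jj _; rewrite scaler_sumr -sumrB; apply: eq_bigr => m _.
rewrite (lcoef_raise _ _ _ (ltn_ord m)).
have D := lcoef_motion (poles v) i k (ltn_ord m) tinj.
have -> : (if jj is Some j then m.+1%:R * poles v j *
    lcoef (poles t) (raise (ncoef r)) (Some i) (Some j) m.+1 k else 0) =
    (if jj is Some j then m.+1%:R * poles v j *
    lcoef (poles t) (raise (ncoef r)) (Some i) jj m.+1 k else 0) by case: jj m {D}.
rewrite D.
have alg0 (x y z : C) (M M2 : 'M[C]_N) :
    0 *: M2 + (0 - x * y * z) *: M = 0 - (x * y) *: (z *: M).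
  by rewrite scale0r add0r !sub0r scaleNr scalerA.
have alg (w e x y z : C) (M M2 : 'M[C]_N) :
    w *: M2 + (e - x * y * z) *: M = e *: M + w *: M2 - (x * y) *: (z *: M).
  by rewrite scalerBl scalerA addrA [e *: M + _]addrC.
by case: k {D} => [|k]; [exact: alg0 | exact: alg].
Qed.

Lemma mexpands_sys_der_infty t v c c2 K : injective (poles t) ->
  mexpands u K (fun k => u k ^+ (r None).-1 *:
      sys_der t v c c2 (near_point (poles t) None (u k)))
    (sys_laurent_der t v c c2 None).
Proof.
move=> tinj; apply: mexpands_eq (sys_der_expands v c c2 None K tinj) => [|k _].
  by exists 0%N.
apply: eq_bigr => jj _; apply: eq_bigr => m _; rewrite addrC; congr (_ *: _ + _ *: _).
case: jj m => [j|] m; first exact: lcoef_motion_infty.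
by rewrite /dlcoef; case: ifP.
Qed.

End SystemExpansions.
(** * Families of formal series *)

Section SeriesInverse.
Variables (K : numFieldType) (N : nat).
Local Notation A := (series_ring K N).

Definition series_mx (M : 'M[K]_N) : A := fun k => if k == 0%N then M else 0.

Lemma series_mxM M (f : A) k : (series_mx M * f) k = M *m f k.
Proof.
rewrite series_mulE big_ord_recl big1 => [|i _]; first by rewrite subn0 addr0.
by rewrite /series_mx /= mul0mx.
Qed.

Lemma series_Mmx M (f : A) k : (f * series_mx M) k = f k *m M.
Proof.
rewrite series_mulE big_ord_recr big1 /= => [|i _]; first by rewrite /series_mx subnn add0r.
by rewrite /series_mx subn_eq0 leqNgt ltn_ord /= mulmx0.
Qed.

Lemma series_mx1 : series_mx 1%:M = 1. Proof. by []. Qed.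

Lemma series_mx_mul M M' : series_mx M * series_mx M' = series_mx (M *m M').
Proof.
apply/funext => k; rewrite series_mxM /series_mx; case: ifP => // _; exact: mulmx0.
Qed.

Lemma series_sumE (I : Type) (s : seq I) (P : pred I) (F : I -> A) k :
  (\sum_(i <- s | P i) F i) k = \sum_(i <- s | P i) F i k.
Proof. by elim/big_rec2: _ => [//|i y x _ <-]. Qed.

Lemma seriesX_low (e : A) i k : e 0%N = 0 -> (k < i)%N -> (e ^+ i) k = 0.
Proof.
move=> e0; elim: i k => // i IH k ki; rewrite exprS series_mulE big1 // => j _.
have [->|j0] := eqVneq (j : nat) 0%N; first by rewrite e0 mul0mx.
rewrite IH ?mulmx0 //; have := ltn_ord j; lia.
Qed.

Lemma series_mul_low (f g h : A) k : (forall j, (j <= k)%N -> g j = h j) -> (f * g) k = (f * h) k.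
Proof.
by move=> gh; rewrite !series_mulE; apply: eq_bigr => i _; rewrite gh // leq_subr.
Qed.

Lemma series_mulr_low (f g h : A) k : (forall j, (j <= k)%N -> g j = h j) -> (g * f) k = (h * f) k.
Proof.
by move=> gh; rewrite !series_mulE; apply: eq_bigr => i _; rewrite gh // -ltnS.
Qed.

Section Inverse.
Variable f : A.
Hypothesis f0 : f 0%N \in unitmx.
Let e : A := fun i => if i == 0%N then 0 else - (invmx (f 0%N) *m f i).
(** The geometric series of [e]. As [e] has no constant term, [e^i] begins in degree [i], and the
    coefficient of degree [k] is already that of the partial sum up to [e^k]. *)
Let S : A := fun k => (\sum_(i < k.+1) e ^+ i) k.

Let fE : f = series_mx (f 0%N) * (1 - e).
Proof.
apply/funext => k; rewrite series_mxM series_addE series_oppE series_oneE /e.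
case: eqP => [->|_]; first by rewrite subr0 mulmx1.
by rewrite sub0r opprK mulmxA mulmxV // mul1mx.
Qed.

Let SE j k : (j <= k)%N -> S j = (\sum_(i < k.+1) e ^+ i) j.
Proof.
move=> jk; rewrite /S !series_sumE -(subnKC jk) -addSn big_split_ord /= [X in _ = _ + X]big1 ?addr0 //.
by move=> i _; apply: seriesX_low => //; rewrite ltnS leq_addr.
Qed.

Let geom k : (1 - e) * \sum_(i < k.+1) e ^+ i = 1 - e ^+ k.+1.
Proof.
elim: k => [|k IH]; first by rewrite big_ord_recl big_ord0 addr0 expr0 mulr1 expr1.
rewrite big_ord_recr mulrDr IH mulrBl mul1r -exprS; series_abel.
Qed.

Let geomr k : (\sum_(i < k.+1) e ^+ i) * (1 - e) = 1 - e ^+ k.+1.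
Proof.
elim: k => [|k IH]; first by rewrite big_ord_recl big_ord0 addr0 expr0 mul1r expr1.
rewrite big_ord_recr mulrDl IH mulrBr mulr1 -exprSr; series_abel.
Qed.

Let eS : (1 - e) * S = 1.
Proof.
apply/funext => k; rewrite (@series_mul_low (1 - e) S (\sum_(i < k.+1) e ^+ i) k); last by move=> j /SE.
by rewrite geom series_addE series_oppE seriesX_low // subr0.
Qed.

Let Se : S * (1 - e) = 1.
Proof.
apply/funext => k; rewrite (@series_mulr_low (1 - e) S (\sum_(i < k.+1) e ^+ i) k); last by move=> j /SE.
by rewrite geomr series_addE series_oppE seriesX_low // subr0.
Qed.

Let invE : (ps_inv f : A) = S * series_mx (invmx (f 0%N)).
Proof.
apply/funext => k; rewrite series_Mmx /ps_inv /S series_sumE; congr (_ *m _).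
apply: eq_bigr => i _.
have -> : forall m, iter m (ps_mul e) (@ps_one K N) = e ^+ m.
  by elim=> //= m ->; rewrite exprS.
by [].
Qed.

Lemma series_invr : f * (ps_inv f : A) = 1.
Proof.
rewrite invE [X in X * _]fE -mulrA (mulrA (1 - e)) eS mul1r series_mx_mul.
by rewrite mulmxV.
Qed.

Lemma series_invl : (ps_inv f : A) * f = 1.
Proof.
rewrite invE [X in _ * X]fE -mulrA (mulrA (series_mx _)) series_mx_mul.
by rewrite mulVmx // series_mx1 mul1r Se.
Qed.

End Inverse.
End SeriesInverse.

Section SeriesHolomorphic.
Variables (R : realType) (E : normedModType (Cx R)) (X : topologicalType) (p : X -> E).
Local Notation C := (Cx R).
Variables (V T : set E) (P : normedModType (Cx R)) (D : set (X * P)) (N : nat).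
Hypotheses (Vsub : submodule V) (TV : open_in V T) (cov : covering_map T p) (oD : open D).
Local Notation A := (series_ring C N).
Local Notation mholo := (mholo p V D).
Implicit Types f g : X * P -> A.

Definition sholo f := forall k, mholo (fun q => f q k).

Definition sdir f (w : E * P) (q : X * P) : A := fun k => mdir p (fun q => f q k) w q.

Lemma sdirE f w q k : sdir f w q k = mdir p (fun q => f q k) w q. Proof. by []. Qed.

Lemma sholo_cst (a : A) : sholo (fun=> a).
Proof. by move=> k; exact: (mholo_cst Vsub TV cov oD). Qed.

Lemma sholo_eq f g : sholo f -> (forall q, D q -> f q = g q) -> sholo g.
Proof. by move=> hf fg k; apply: (mholo_eq Vsub TV cov oD (hf k)) => q /fg ->. Qed.

Lemma sholoD f g : sholo f -> sholo g -> sholo (fun q => f q + g q).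
Proof. by move=> hf hg k; exact: (mholoD Vsub TV cov oD (hf k) (hg k)). Qed.

Lemma sholoN f : sholo f -> sholo (fun q => - f q).
Proof. by move=> hf k; exact: (mholoN Vsub TV cov oD (hf k)). Qed.

Lemma sholoB f g : sholo f -> sholo g -> sholo (fun q => f q - g q).
Proof. by move=> hf hg; apply: sholoD => //; exact: sholoN. Qed.

Lemma sholoM f g : sholo f -> sholo g -> sholo (fun q => f q * g q).
Proof.
move=> hf hg k; apply: (mholo_sum Vsub TV cov oD) => i _.
exact: (mholoM Vsub TV cov oD (hf i) (hg (k - i)%N)).
Qed.

Lemma sholoX f m : sholo f -> sholo (fun q => f q ^+ m).
Proof.
move=> hf; elim: m => [|m IH]; first exact: sholo_cst.
by apply: sholo_eq (sholoM hf IH) _ => q _; rewrite exprS.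
Qed.

Lemma sholo_pder f : sholo f -> sholo (fun q => pder (f q)).
Proof.
move=> hf k; apply: (mholoZ Vsub TV cov oD) (hf k.+1); exact: (holo_cst Vsub TV cov oD).
Qed.

Lemma sholo_eul f : sholo f -> sholo (fun q => eul (f q)).
Proof.
by move=> hf; apply: sholo_eq (sholoM (sholo_cst (series_var C N)) (sholo_pder hf)) _ => q _; rewrite -eulE.
Qed.

Lemma sholo_inv f : sholo f -> (forall q, D q -> f q 0%N \in unitmx) ->
  sholo (fun q => ps_inv (f q) : A).
Proof.
move=> hf fu.
pose e q : A := fun i => if i == 0%N then 0 else - (invmx (f q 0%N) *m f q i).
have hi : mholo (fun q => invmx (f q 0%N)) by exact: (mholo_inv Vsub TV cov oD (hf 0%N)).
have he : sholo e.
  move=> [|k]; first exact: (mholo_cst Vsub TV cov oD).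
  exact: (mholoN Vsub TV cov oD (mholoM Vsub TV cov oD hi (hf k.+1))).
move=> k; apply: (mholoM Vsub TV cov oD) hi.
apply: (mholo_sum Vsub TV cov oD) => i _.
apply: (mholo_eq Vsub TV cov oD (sholoX i he k)) => q _.
have -> : forall m, iter m (ps_mul (e q)) (@ps_one C N) = e q ^+ m.
  by elim=> //= m ->; rewrite exprS.
by [].
Qed.

Lemma sdir_eq f g w q : sholo f -> (forall q, D q -> f q = g q) -> V w.1 -> D q ->
  sdir g w q = sdir f w q.
Proof.
move=> hf fg Vw Dq; apply/funext => k.
apply: (mdir_eq Vsub TV cov oD (g := fun q => g q k) (hf k) _ Vw Dq) => q' Dq'.
by rewrite fg.
Qed.

Lemma sdirD f g w q : sholo f -> sholo g -> V w.1 -> D q ->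
  sdir (fun q => f q + g q) w q = sdir f w q + sdir g w q.
Proof. by move=> hf hg Vw Dq; apply/funext => k; exact: (mdirD (hf k) (hg k) Vw Dq). Qed.

Lemma sdirN f w q : sholo f -> V w.1 -> D q -> sdir (fun q => - f q) w q = - sdir f w q.
Proof.
by move=> hf Vw Dq; apply/funext => k; exact: (mdirN Vsub TV cov oD (hf k) Vw Dq).
Qed.

Lemma sdirB f g w q : sholo f -> sholo g -> V w.1 -> D q ->
  sdir (fun q => f q - g q) w q = sdir f w q - sdir g w q.
Proof. by move=> hf hg Vw Dq; rewrite (sdirD hf (sholoN hg) Vw Dq) (sdirN hg Vw Dq). Qed.

Lemma sdirM f g w q : sholo f -> sholo g -> V w.1 -> D q ->
  sdir (fun q => f q * g q) w q = sdir f w q * g q + f q * sdir g w q.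
Proof.
move=> hf hg Vw Dq; apply/funext => k; rewrite series_addE !series_mulE -big_split.
rewrite /sdir (mdir_sum Vsub TV cov oD _ _ Vw Dq) /=; last first.
  by move=> i _; exact: (mholoM Vsub TV cov oD (hf i) (hg (k - i)%N)).
by apply: eq_bigr => i _; exact: (mdirM Vsub TV cov oD (hf i) (hg (k - i)%N) Vw Dq).
Qed.

Lemma sdir_cst (a : A) w q : sdir (fun=> a) w q = 0.
Proof. by apply/funext => k; exact: mdir_cst. Qed.

Lemma sdir_pder f w q : sholo f -> V w.1 -> D q ->
  sdir (fun q => pder (f q)) w q = pder (sdir f w q).
Proof.
move=> hf Vw Dq; apply/funext => k; rewrite /sdir /pder.
rewrite (mdirZ Vsub TV cov oD (holo_cst Vsub TV cov oD k.+1%:R) (hf k.+1) Vw Dq).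
by rewrite dirder_cst scale0r add0r.
Qed.

Lemma sdir_eul f w q : sholo f -> V w.1 -> D q ->
  sdir (fun q => eul (f q)) w q = eul (sdir f w q).
Proof.
move=> hf Vw Dq; apply/funext => k; rewrite /sdir /eul.
rewrite (mdirZ Vsub TV cov oD (holo_cst Vsub TV cov oD k%:R) (hf k) Vw Dq).
by rewrite dirder_cst scale0r add0r.
Qed.

Lemma sholo_sdir f w : sholo f -> V w.1 -> sholo (sdir f w).
Proof. by move=> hf Vw k; exact: (mholo_mdir Vsub TV cov oD (hf k) Vw). Qed.

Lemma sdir_comm f w1 w2 q : sholo f -> V w1.1 -> V w2.1 -> D q ->
  sdir (sdir f w1) w2 q = sdir (sdir f w2) w1 q.
Proof.
move=> hf V1 V2 Dq; apply/funext => k.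
exact: (mdir_comm Vsub TV cov oD (hf k) V1 V2 Dq).
Qed.

Lemma dirder_tau f k w q : sholo f -> V w.1 -> D q ->
  dirder p (fun q => tau k (f q)) w q = tau k (sdir f w q).
Proof. by move=> hf Vw Dq; exact: (dirder_trace Vsub TV cov oD (hf k) Vw Dq). Qed.

Lemma holo_tau f k : sholo f -> holo p V D (fun q => tau k (f q)).
Proof. by move=> hf; exact: (holo_trace Vsub TV cov oD (hf k)). Qed.

Lemma sdir_inv f g w q : sholo f -> sholo g -> (forall q, D q -> f q * g q = 1) ->
  (forall q, D q -> g q * f q = 1) -> V w.1 -> D q ->
  sdir g w q = - (g q * sdir f w q * g q).
Proof.
move=> hf hg fg gf Vw Dq.
have H : sdir (fun q => f q * g q) w q = 0.
  by rewrite (sdir_eq (g := fun q => f q * g q) (sholo_cst 1) _ Vw Dq) ?sdir_cst // => q' /fg ->.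
rewrite (sdirM hf hg Vw Dq) in H.
have {}H : f q * sdir g w q = - (sdir f w q * g q) by apply/eqP; rewrite -addr_eq0 addrC H.
by rewrite -[LHS]mul1r -(gf q Dq) -mulrA H mulrN mulrA.
Qed.

End SeriesHolomorphic.
(** * The curvature of omega *)

Section TimeSpace.
Variables (R : realType) (N n : nat) (r : option 'I_n -> nat).
Local Notation C := (Cx R).
Local Notation times := (times R N r).
Local Notation V := (@trace_free R N n r).
Local Notation T := (@time_space R N n r).

Lemma entry_le_norm m l (M : 'M[C]_(m, l)) i j : `|M i j| <= `|M|.
Proof.
rewrite [leRHS]/Num.Def.normr /= mx_normE.
rewrite -[leLHS]nngE num_le.
exact: (le_bigmax _ (fun k : 'I_m * 'I_l => `|M k.1 k.2|%:nng) (i, j)).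
Qed.

Lemma time_thetaD (t v : times) nu (k : 'I_(r nu)) (a : C) :
  time_theta (a *: t + v) k = a *: time_theta t k + time_theta v k.
Proof. by apply/matrixP => i l; rewrite !mxE. Qed.

Lemma trace_free_submodule : submodule V.
Proof.
split=> [nu k|a u v Vu Vv nu k].
  by rewrite big1 // => l _; rewrite !mxE.
rewrite time_thetaD (eq_bigr (fun l => a * time_theta u k 0 l + time_theta v k 0 l)).
  by rewrite big_split /= -mulr_sumr Vu Vv mulr0 addr0.
by move=> l _; rewrite !mxE.
Qed.

Lemma coord_cvg (t : times) e : (fun y : times => y 0 e) @ nbhs t --> t 0 e.
Proof. exact: coord_continuous. Qed.

Lemma near_distinct (I : finType) (f : I -> 'I_#|time_index N r|) (t : times) :
  injective (fun i => t 0 (f i)) -> \forall y \near nbhs t, injective (fun i => (y : times) 0 (f i)).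
Proof.
move=> tinj.
have H ij : \forall y \near nbhs t, (y : times) 0 (f ij.1) = y 0 (f ij.2) -> ij.1 = ij.2 :> I.
  case: ij => i j /=; have [->|ij] := eqVneq i j; first by near=> y.
  have d0 : 0 < cabs (t 0 (f i) - t 0 (f j)) / 2.
    by rewrite divr_gt0 // cabs_gt0 subr_eq0; apply: contraNneq ij => /tinj ->.
  have /cvg_cabs/(_ _ d0) h1 := @coord_cvg t (f i).
  have /cvg_cabs/(_ _ d0) h2 := @coord_cvg t (f j).
  apply: filterS2 h1 h2 => y h1 h2 E1; exfalso.
  have := cabs_dist (t 0 (f i)) (y 0 (f i)) (t 0 (f j)).
  by rewrite (cabsBC (t 0 (f i)) (y 0 (f i))) {2}E1; lra.
have HH := filter_forall (nbhs_filter t) H; apply: filterS HH => y yP i j; exact: (yP (i, j)).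
Unshelve. all: by end_near. Qed.

Lemma time_space_open : open_in V T.
Proof.
split=> [t [_ _]//|t [tc tth tV]].
have h1 : \forall y \near nbhs t, injective (poles y).
  exact: (@near_distinct 'I_n (fun i => enum_rank (inl i : time_index N r))).
have h2 : \forall y \near nbhs t, forall nu (k : 'I_(r nu)), k.+1 = r nu ->
    injective (time_theta (y : times) k 0).
  suff H : forall nu, \forall y \near nbhs t, forall k : 'I_(r nu), k.+1 = r nu ->
      injective (time_theta (y : times) k 0).
    by have HH := filter_forall (nbhs_filter t) H; apply: filterS HH => y yP nu k; exact: yP.
  move=> nu; suff H : forall k : 'I_(r nu), \forall y \near nbhs t, k.+1 = r nu ->
      injective (time_theta (y : times) k 0).
    by have HH := filter_forall (nbhs_filter t) H; apply: filterS HH => y yP k; exact: yP.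
  move=> k; have [Ek|nk] := eqVneq k.+1 (r nu); last first.
    by near=> y => /eqP; rewrite (negbTE nk).
  have := @near_distinct 'I_N (fun l => enum_rank
    (inr (existT (fun nu => ('I_(r nu) * 'I_N)%type) nu (k, l)) : time_index N r)) t.
  have e1 (y : times) : time_theta y k 0 = (fun l => y 0 (enum_rank
    (inr (existT (fun nu => ('I_(r nu) * 'I_N)%type) nu (k, l)) : time_index N r))).
    by apply/funext => l; rewrite mxE.
  rewrite -e1 => /(_ (tth nu k Ek)); apply: filterS => y + _.
  by rewrite e1.
have [d d0 dP] := (near_rnorm t _).1 (filterI h1 h2).
by exists d => // y Vy /dP[? ?]; split.
Unshelve. all: by end_near. Qed.

End TimeSpace.

Section Coordinates.
Variables (R : realType) (N n : nat) (r : option 'I_n -> nat).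
Local Notation C := (Cx R).
Local Notation times := (times R N r).
Local Notation V := (@trace_free R N n r).
Local Notation T := (@time_space R N n r).
Variables (X : topologicalType) (p : X -> times) (P : normedModType C) (D : set (X * P)).
Hypotheses (cov : covering_map T p) (oD : open D).
Let Vsub := @trace_free_submodule R N n r.
Let TV := @time_space_open R N n r.
Local Notation holo := (holo p V D).

Lemma lift_position q (w : times * P) : D q -> V w.1 ->
  \forall j \near nbhs (0 : C), p (Defs.lift p q.1 w.1 j) = p q.1 + j *: w.1.
Proof.
move=> Dq Vw; have [Q [e pl]] := plane Vsub TV cov oD Dq Vw Vw.
have e0 := plane_gt0 pl; have z0 : cabs (0 : C) < e by rewrite cabs0.
have := plane_move1 pl z0 z0; rewrite (plane_center pl).
have n2 : \forall j \near nbhs (0 : C), cabs j < e by apply/near_disc; exists e => // j; rewrite subr0.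
apply: filterS2 n2 => j jr E1.
have := congr1 (fun q => p q.1) E1; rewrite /= => ->.
by rewrite add0r (plane_fst pl jr z0) scale0r addr0.
Qed.

Lemma holo_coord e : holo (fun q => p q.1 0 e).
Proof.
exists [set g | exists a b, g = fun q => a * p q.1 0 e + b].
  by exists 1, 0; apply/funext => q; rewrite mul1r addr0.
move=> g [a [b ->]]; split=> [q Dq|w Vw].
  have c1 : (fun q : X * P => p q.1 0 e) @ nbhs q --> p q.1 0 e.
    apply: (@cvg_comp _ _ _ (fun q : X * P => p q.1) (fun y : times => y 0 e) _ (nbhs (p q.1))).
      apply: (@cvg_comp _ _ _ fst p _ (nbhs q.1)); first exact: cvg_fst.
      by case: cov => cp _ _; exact: cp.
    exact: coord_cvg.
  exact: (cvgD (F := nbhs q) (cvgM (F := nbhs q) (cvg_cst a) c1) (cvg_cst b)).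
exists (fun=> a * w.1 0 e); first by exists 0, (a * w.1 0 e); apply/funext => q; rewrite mul0r add0r.
move=> q Dq; have := is_derive_affine (0 : C) (a * p q.1 0 e + b) (a * w.1 0 e).
apply: near_eq_derive0; have := lift_position Dq Vw; apply: filterS => j E1.
by rewrite /along E1 !mxE; ring.
Qed.

Lemma dirder_coord e (w : times * P) q : D q -> V w.1 ->
  dirder p (fun q => p q.1 0 e) w q = w.1 0 e.
Proof.
move=> Dq Vw; apply: dirderE.
have := is_derive_affine (0 : C) (p q.1 0 e) (w.1 0 e).
apply: near_eq_derive0; have := lift_position Dq Vw; apply: filterS => j E1.
by rewrite /along E1 !mxE; ring.
Qed.

Lemma holo_poles i : holo (fun q => poles (p q.1) i). Proof. exact: holo_coord. Qed.

Lemma dirder_poles i (w : times * P) q : D q -> V w.1 ->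
  dirder p (fun q => poles (p q.1) i) w q = poles w.1 i.
Proof. exact: dirder_coord. Qed.

Lemma dirderX f m w q : holo f -> V w.1 -> D q ->
  dirder p (fun q => f q ^+ m) w q = m%:R * dirder p f w q * f q ^+ m.-1.
Proof.
move=> hf Vw Dq; elim: m => [|m IH].
  by rewrite !mul0r; exact: dirder_cst.
have -> : (fun q => f q ^+ m.+1) = (fun q => f q * f q ^+ m) by apply/funext => x; rewrite exprS.
rewrite (dirderM Vsub TV cov oD hf (holoX Vsub TV cov oD m hf) Vw Dq) IH.
case: m {IH} => [|m]; first by rewrite /= expr0; ring.
by rewrite /= exprS -!natr1; ring.
Qed.

Lemma dirder_negX f m w q : holo f -> (forall q, D q -> f q != 0) -> V w.1 -> D q ->
  dirder p (fun q => f q ^- m.+1) w q = - m.+1%:R * dirder p f w q * f q ^- m.+2.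
Proof.
move=> hf f0 Vw Dq; have fq := f0 _ Dq.
rewrite (dirderV Vsub TV cov oD (holoX Vsub TV cov oD m.+1 hf) _ Vw Dq) ?expf_neq0 //.
rewrite (dirderX _ hf Vw Dq) /= [_ ^+ m.+2]exprS invfM exprS invfM.
have -> : - ((f q)^-1 * f q ^- m) * (m.+1%:R * dirder p f w q * f q ^+ m) * ((f q)^-1 * f q ^- m) =
   - m.+1%:R * dirder p f w q * ((f q)^-1 * ((f q)^-1 * f q ^- m)) * (f q ^- m * f q ^+ m) by ring.
by rewrite mulVf ?expf_neq0 // mulr1.
Qed.

Lemma poles_inj q : injective (poles (p q)).
Proof. by have [] : T (p q) by exact: covered cov q. Qed.

Lemma holo_lcoef M nu jj m k : holo (fun q => lcoef (poles (p q.1)) M nu jj m k) /\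
  forall w q, V w.1 -> D q ->
  dirder p (fun q => lcoef (poles (p q.1)) M nu jj m k) w q =
  dlcoef (poles (p q.1)) (poles w.1) M nu jj m k.
Proof.
have cstP (a : C) : holo (fun _ : X * P => a) /\
    forall (w : times * P) (q : X * P), V w.1 -> D q -> dirder p (fun _ : X * P => a) w q = 0.
  exact: (conj (holo_cst Vsub TV cov oD a) (fun w q _ _ => dirder_cst p a w q)).
rewrite /lcoef /dlcoef; case: (ltnP k (M nu)) => _; first exact: cstP.
set s := (k - M nu)%N.
have scaleP (a : C) f df : holo f /\ (forall w q, V w.1 -> D q -> dirder p f w q = df w q) ->
    holo (fun q => a * f q) /\ (forall w q, V w.1 -> D q -> dirder p (fun q => a * f q) w q = a * df w q).
  move=> [hf dfE]; split; first exact: (holoM Vsub TV cov oD (holo_cst Vsub TV cov oD a) hf).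
  by move=> w q Vw Dq; rewrite (dirderZ Vsub TV cov oD a hf Vw Dq) dfE.
have powP i l : holo (fun q => poles (p q.1) i ^+ l) /\ (forall w q, V w.1 -> D q ->
    dirder p (fun q => poles (p q.1) i ^+ l) w q = l%:R * poles w.1 i * poles (p q.1) i ^+ l.-1).
  split; first exact: (holoX Vsub TV cov oD l (holo_poles i)).
  by move=> w q Vw Dq; rewrite (dirderX _ (holo_poles i) Vw Dq) dirder_poles.
case: nu s => [i|] s; case: jj => [j|]; last exact: cstP.
- case: eqP => [_|/eqP ij]; first exact: cstP.
  apply: scaleP.
  have hd : holo (fun q => poles (p q.1) i - poles (p q.1) j).
    exact: (holoB Vsub TV cov oD (holo_poles i) (holo_poles j)).
  have d0 q : D q -> poles (p q.1) i - poles (p q.1) j != 0.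
    by move=> _; rewrite subr_eq0 (inj_eq (@poles_inj q.1)) eq_sym.
  split.
    apply: (holoV Vsub TV cov oD); first exact: (holoX Vsub TV cov oD _ hd).
    by move=> q /d0 H; rewrite expf_neq0.
  move=> w q Vw Dq; rewrite (dirder_negX _ hd d0 Vw Dq).
  by rewrite (dirderB Vsub TV cov oD (holo_poles i) (holo_poles j) Vw Dq) !dirder_poles.
- have [h1 h2] := scaleP 'C(m, s)%:R _ _ (powP i (m - s)%N); split.
    exact: (holoN Vsub TV cov oD h1).
  by move=> w q Vw Dq; rewrite (dirderN Vsub TV cov oD h1 Vw Dq) h2.
- case: (leqP m s) => _; last exact: cstP.
  exact: (scaleP _ _ _ (powP j (s - m)%N)).
Qed.

End Coordinates.
Section Restriction.
Variables (R : realType) (E : normedModType (Cx R)) (X : topologicalType) (p : X -> E).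
Variables (V : set E) (P : normedModType (Cx R)) (D W : set (X * P)).

Lemma holomorphic_on_sub (F : normedModType (Cx R)) (f : X * P -> F) : W `<=` D ->
  holomorphic_on p V D f -> holomorphic_on p V W f.
Proof.
move=> WD [S Sf good]; exists S => // g Sg; split; first by move=> q /WD; exact: (good g Sg).1.
by move=> w /(good g Sg).2[g' Sg' dg]; exists g' => // q /WD; exact: dg.
Qed.

End Restriction.

(** * The time components of d omega as sums of residues *)

Section Curvature.
Variables (R : realType) (N n : nat) (r : option 'I_n -> nat).
Local Notation C := (Cx R).
Local Notation sing := (option 'I_n).
Local Notation times := (times R N r).
Local Notation V := (@trace_free R N n r).
Local Notation T := (@time_space R N n r).
Local Notation A := (series_ring C N).
Local Notation xi := (series_var C N).
Local Notation cst := (@series_const C N).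
Hypothesis r0 : (0 < r None)%N.

(* With this sign, multiplication by [xi^pole_order] turns [d/dz] into [xi^r (xi d/dxi)] also at infinity. *)
Definition orientation (nu : sing) : C := if nu is Some _ then 1 else -1.

Lemma orientationM nu : orientation nu * orientation nu = 1.
Proof. by case: nu => [i|] /=; rewrite ?mulr1 ?mulrNN ?mulr1. Qed.

Lemma shift_ps_dz nu (f : A) k :
  orientation nu *: ps_shift (pole_order r nu) (ps_dz nu f) k = (xi ^+ r nu * eul f) k.
Proof.
case: nu => [i|].
  by rewrite scale1r eulE mulrA -exprSr series_varX.
have -> : xi ^+ r None * eul f = xi ^+ (r None).-1 * (xi * eul f).
  by rewrite mulrA -exprSr prednK.
have dzE l : ps_dz (None : sing) f l = - (xi * eul f) l.
  by case: l => [|l]; rewrite series_varM /= ?oppr0.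
rewrite series_varX /ps_shift [pole_order r None]/=; case: ifP => _; first by rewrite scaler0.
by rewrite dzE scaleN1r opprK.
Qed.

Definition theta_series (t : times) (th0 : sing -> 'rV[C]_N) (nu : sing) : A :=
  fun k => if (k <= r nu)%N then diag_mx (theta t th0 nu (r nu - k)%N) else 0.

Definition laurent_series (t : times) (c : sing -> nat -> 'M[C]_N) (nu : sing) : A :=
  fun k => orientation nu *: sys_laurent t c nu k.

Lemma formal_equation t c th0 (G : sing -> nat -> 'M[C]_N) nu : formal_solution t c th0 G ->
  laurent_series t c nu * (G nu : A) =
  xi ^+ r nu * eul (G nu) + (G nu : A) * theta_series t th0 nu.
Proof.
move=> fs; apply/funext => k; rewrite series_addE -shift_ps_dz.
have := congr1 (fun M => orientation nu *: M) (fs_eq fs nu k); rewrite scalerDr => H.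
have e1 : (laurent_series t c nu * (G nu : A)) k =
    orientation nu *: ps_mul (sys_laurent t c nu) (G nu) k.
  rewrite series_mulE /ps_mul scaler_sumr; apply: eq_bigr => i _.
  by rewrite scalemxAl.
rewrite e1 -H; congr (_ + _); rewrite series_mulE /ps_mul scaler_sumr.
apply: eq_bigr => i _; rewrite scalemxAr; congr (_ *m _).
rewrite /theta_dz /theta_series; case: ifP => _; last by rewrite scaler0.
by rewrite scalerA -[if nu is Some _ then 1 else -1]/(orientation nu) orientationM scale1r.
Qed.

Lemma diag_series_comm (f g : A) :
  (forall k, exists u, f k = diag_mx u) -> (forall k, exists u, g k = diag_mx u) ->
  f * g = g * f.
Proof.
move=> df dg; apply/funext => k; rewrite !series_mulE (reindex_inj rev_ord_inj) /=.
apply: eq_bigr => i _; rewrite subSS subKn; last by rewrite -ltnS.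
have [u ->] := df (k - i)%N; have [v ->] := dg i.
by rewrite diag_mxC.
Qed.

Variables (X : topologicalType) (p : X -> times) (d : nat).
Local Notation par := 'rV[C]_d.
Variables (D : set (X * par)) (c G : X * par -> sing -> nat -> 'M[C]_N).
Hypotheses (cov : covering_map T p) (oD : open D).
Let Vsub := @trace_free_submodule R N n r.
Let TV := @time_space_open R N n r.
Hypothesis hc : forall nu k, (k < ncoef r nu)%N -> holomorphic_on p V D (fun q => c q nu k).
Hypothesis hG : forall nu k, holomorphic_on p V D (fun q => G q nu k).
(** The exponents [th0] may vary with the monodromy coordinates but not with the times: this is what
    isomonodromy, a local condition, says about the formal solutions. *)
Hypothesis hform : forall q, D q -> exists (W : set (X * par)) (th0 : par -> sing -> 'rV[C]_N),
  [/\ open W, W q, W `<=` D & forall q', W q' ->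
      formal_solution (p q'.1) (c q') (th0 q'.2) (G q')].

Definition sG nu (q : X * par) : A := G q nu.
Definition sH nu (q : X * par) : A := ps_inv (G q nu).
Definition sA nu (q : X * par) : A := laurent_series (p q.1) (c q) nu.
(** By [sTh_eq] this is the diagonal series of the formal solution. Recovering it from the system
    and from [G] shows that it is holomorphic, including the exponents of formal monodromy. *)
Definition sTh nu (q : X * par) : A := sH nu q * (sA nu q * sG nu q - xi ^+ r nu * eul (sG nu q)).

Lemma G_unit q nu : D q -> G q nu 0%N \in unitmx.
Proof. by move=> /hform[W [th0 [_ Wq _ /(_ q Wq) fs]]]; exact: fs_unit fs nu. Qed.

Lemma sHG q nu : D q -> sH nu q * sG nu q = 1.
Proof. by move=> Dq; exact: series_invl (G_unit nu Dq). Qed.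
Lemma sGH q nu : D q -> sG nu q * sH nu q = 1.
Proof. by move=> Dq; exact: series_invr (G_unit nu Dq). Qed.

Local Notation sholo := (sholo p V D).
Local Notation sdir := (sdir p).

Lemma sholo_sG nu : sholo (sG nu).
Proof. by move=> k; exact: holomorphic_on_mholo (hG nu k). Qed.

Lemma sholo_sH nu : sholo (sH nu).
Proof.
apply: (sholo_inv Vsub TV cov oD (sholo_sG nu)) => q Dq; exact: G_unit.
Qed.

Let mholo_c jj (m : 'I_(ncoef r jj)) : mholo p V D (fun q => c q jj m).
Proof. exact: holomorphic_on_mholo (hc (ltn_ord m)). Qed.

Let sA_eq nu k : (fun q => sA nu q k) = (fun q => orientation nu *:
  \sum_jj \sum_(m < ncoef r jj) lcoef (poles (p q.1)) (ncoef r) nu jj m k *: c q jj m).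
Proof. by apply/funext => q; rewrite /sA /laurent_series sys_laurentE. Qed.

Let sA_term nu k jj (m : 'I_(ncoef r jj)) :
  mholo p V D (fun q => lcoef (poles (p q.1)) (ncoef r) nu jj m k *: c q jj m).
Proof.
apply: (mholoZ Vsub TV cov oD); last exact: mholo_c.
exact: (holo_lcoef cov oD (ncoef r) nu jj m k).1.
Qed.

Lemma sholo_sA nu : sholo (sA nu).
Proof.
move=> k; rewrite sA_eq; apply: (mholoZ Vsub TV cov oD).
  exact: (holo_cst Vsub TV cov oD).
apply: (mholo_sum Vsub TV cov oD) => jj _; apply: (mholo_sum Vsub TV cov oD) => m _.
exact: sA_term.
Qed.

Definition coef_dir (w : times * par) (q : X * par) (jj : sing) (m : nat) : 'M[C]_N :=
  mdir p (fun q => c q jj m) w q.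

Lemma sdir_sA nu w q : V w.1 -> D q -> sdir (sA nu) w q =
  (fun k => orientation nu *: sys_laurent_der (p q.1) w.1 (c q) (coef_dir w q) nu k) :> A.
Proof.
move=> Vw Dq; apply/funext => k; rewrite [LHS]sdirE sA_eq.
have h1 : mholo p V D (fun q => \sum_jj \sum_(m < ncoef r jj)
    lcoef (poles (p q.1)) (ncoef r) nu jj m k *: c q jj m).
  apply: (mholo_sum Vsub TV cov oD) => jj _; apply: (mholo_sum Vsub TV cov oD) => m _.
  exact: sA_term.
rewrite (mdirZ Vsub TV cov oD (holo_cst Vsub TV cov oD (orientation nu)) h1 Vw Dq).
rewrite dirder_cst scale0r add0r; congr (_ *: _).
rewrite (mdir_sum Vsub TV cov oD _ _ Vw Dq); last first.
  by move=> jj _; apply: (mholo_sum Vsub TV cov oD) => m _; exact: sA_term.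
apply: eq_bigr => jj _; rewrite (mdir_sum Vsub TV cov oD _ _ Vw Dq); last first.
  by move=> m _; exact: sA_term.
apply: eq_bigr => m _.
have [h2 h3] := holo_lcoef cov oD (ncoef r) nu jj m k.
by rewrite (mdirZ Vsub TV cov oD h2 (mholo_c m) Vw Dq) (h3 _ _ Vw Dq).
Qed.

Lemma sholo_sTh nu : sholo (sTh nu).
Proof.
apply: (sholoM Vsub TV cov oD); first exact: sholo_sH.
apply: (sholoB Vsub TV cov oD).
  by apply: (sholoM Vsub TV cov oD); [exact: sholo_sA | exact: sholo_sG].
apply: (sholoM Vsub TV cov oD); first exact: (sholo_cst Vsub TV cov oD).
by apply: (sholo_eul Vsub TV cov oD); exact: sholo_sG.
Qed.

Lemma sAG q nu : D q -> sA nu q * sG nu q = xi ^+ r nu * eul (sG nu q) + sG nu q * sTh nu q.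
Proof.
move=> Dq; rewrite /sTh mulrA sGH // mul1r; series_abel.
Qed.

Lemma sTh_eq q nu th0 : D q -> formal_solution (p q.1) (c q) th0 (G q) ->
  sTh nu q = theta_series (p q.1) th0 nu.
Proof.
move=> Dq fs; rewrite /sTh /sA (formal_equation nu fs) addrAC subrr add0r mulrA.
by rewrite sHG // mul1r.
Qed.

Lemma sTh_high q nu k : D q -> (r nu < k)%N -> sTh nu q k = 0.
Proof.
move=> Dq rk; have [W [th0 [_ Wq _ /(_ q Wq) fs]]] := hform Dq.
by rewrite (sTh_eq nu Dq fs) /theta_series leqNgt rk.
Qed.

Lemma sTh_diag q nu k : D q -> exists u, sTh nu q k = diag_mx u.
Proof.
move=> Dq; have [W [th0 [_ Wq _ /(_ q Wq) fs]]] := hform Dq.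
rewrite (sTh_eq nu Dq fs) /theta_series; case: ifP => _; first by eexists.
by exists 0; rewrite raddf0.
Qed.

Lemma sdir_sTh_high w q nu k : V w.1 -> D q -> (r nu < k)%N -> sdir (sTh nu) w q k = 0.
Proof.
move=> Vw Dq rk; rewrite -(mdir_cst p (0 : 'M[C]_N) w q).
have E1 q' : D q' -> 0 = sTh nu q' k by move=> Dq'; rewrite sTh_high.
apply: (mdir_eq Vsub TV cov oD (g := fun q => sTh nu q k) _ E1 Vw Dq).
exact: (mholo_cst Vsub TV cov oD).
Qed.

Lemma theta_time (t : times) th0 nu k (kr : (k < r nu)%N) : theta t th0 nu k.+1 = time_theta t (Ordinal kr).
Proof.
rewrite /theta; case: insubP => [j _ Ej|]; last by rewrite kr.
by congr (time_theta t _); apply/val_inj.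
Qed.

(** Below degree [r nu] the coefficients are coordinates of the time [p q.1], so their derivatives
    are the same coordinates of the direction. *)
Lemma sdir_sTh_low w q nu k : V w.1 -> D q -> (k < r nu)%N ->
  sdir (sTh nu) w q k = diag_mx (theta w.1 (fun=> 0) nu (r nu - k)).
Proof.
move=> Vw Dq kr; have [W [th0 [oW Wq WD fs]]] := hform Dq.
have kr' : ((r nu - k).-1 < r nu)%N by lia.
have Ek : (r nu - k = (r nu - k).-1.+1)%N by lia.
have thE (t : times) th1 : theta t th1 nu (r nu - k) = time_theta t (Ordinal kr').
  exact: etrans (congr1 (theta t th1 nu) Ek) (theta_time t th1 kr').
have E1 q' : W q' -> diag_mx (time_theta (p q'.1) (Ordinal kr')) = sTh nu q' k.
  by move=> Wq'; rewrite (sTh_eq nu (WD _ Wq') (fs _ Wq')) /theta_series (ltnW kr) thE.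
rewrite thE.
have hm : mholo p V W (fun q => diag_mx (time_theta (p q.1) (Ordinal kr'))).
  move=> a b.
  have h := holoM Vsub TV cov oW (holo_cst Vsub TV cov oW (a == b)%:R) (holo_coord cov oW (enum_rank
    (inr (existT (fun nu => ('I_(r nu) * 'I_N)%type) nu (Ordinal kr', a)) : time_index N r))).
  by apply: (holo_eq Vsub TV cov oW h) => q' _; rewrite !mxE mulr_natl.
rewrite [LHS](mdir_eq Vsub TV cov oW (g := fun q => sTh nu q k) hm E1 Vw Wq).
apply/matrixP => a b; rewrite [LHS]mdirE.
have -> : (fun q0 : X * par => (diag_mx (time_theta (p q0.1) (Ordinal kr'))) a b) =
  (fun q0 : X * par => (a == b)%:R * p q0.1 0 (enum_rank
    (inr (existT (fun nu => ('I_(r nu) * 'I_N)%type) nu (Ordinal kr', a)) : time_index N r))).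
  by apply/funext => q'; rewrite !mxE mulr_natl.
rewrite (dirderZ Vsub TV cov oW _ (holo_coord cov oW _) Vw Wq) (dirder_coord cov oW _ Wq Vw).
by rewrite !mxE mulr_natl.
Qed.

(** The coefficient of degree [r nu] is the formal monodromy exponent, which is constant along the
    lift of a pure time direction. *)
Lemma sdir_sTh_exponent v q nu : V v -> D q -> sdir (sTh nu) (v, 0) q (r nu) = 0.
Proof.
move=> Vw Dq; have [W [th0 [oW Wq WD fs]]] := hform Dq.
apply/matrixP => a b; rewrite [LHS]mdirE mxE; apply: dirderE.
have := is_derive_cst (sTh nu q (r nu) a b) (0 : C) 1.
apply: near_eq_derive0.
have := move_near Vsub TV cov oW Wq (w := (v, 0)) Vw; apply: filterS => j Wj.
rewrite /cst /along (sTh_eq nu Dq (fs _ Wq)) -[(_, _)]/(move p (v, 0) q j).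
rewrite (sTh_eq nu (WD _ Wj) (fs _ Wj)) /theta_series leqnn subnn /=.
by rewrite scaler0 addr0.
Qed.

(* The formal solution prescribes the time derivative [- Theta_{nu,-k} / k * xi^-k] of the exponent;
   this is [xi^r] times it. *)
Definition sS nu (v : times) : A := fun k => if (k < r nu)%N then
  - (r nu - k)%:R^-1 *: diag_mx (theta v (fun=> 0) nu (r nu - k)) else 0.

Lemma sS_spec v q nu : V v -> D q ->
  sdir (sTh nu) (v, 0) q = eul (sS nu v) - cst (r nu)%:R * sS nu v.
Proof.
move=> Vv Dq; apply/funext => k; rewrite series_addE series_oppE series_constM /eul /sS.
case: ltnP => kr; last first.
  rewrite !scaler0 subr0; have [->|nk] := eqVneq k (r nu); first exact: sdir_sTh_exponent.
  by apply: sdir_sTh_high => //; lia.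
rewrite (sdir_sTh_low (w := (v, 0)) Vv Dq kr) !scalerA -scalerBl -mulrBl -opprB.
have nz : (r nu - k)%:R != 0 :> C by rewrite pnatr_eq0; lia.
by rewrite -natrB ?(ltnW kr) // mulrN mulNr opprK mulfV // scale1r.
Qed.

Lemma sTh_sS_comm v q nu : D q -> sTh nu q * sS nu v = sS nu v * sTh nu q.
Proof.
move=> Dq; apply: diag_series_comm => k; first exact: sTh_diag.
rewrite /sS; case: ifP => _; last by exists 0; rewrite raddf0.
by eexists; rewrite -linearZ.
Qed.

Lemma series_mul_high (f g : A) a b k : (forall j, (a < j)%N -> f j = 0) ->
  (forall j, (b < j)%N -> g j = 0) -> (a + b < k)%N -> (f * g) k = 0.
Proof.
move=> fa gb abk; rewrite series_mulE big1 // => i _; case: (leqP i a) => ia.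
  by rewrite gb ?mulmx0 //; lia.
by rewrite fa ?mul0mx.
Qed.

(** The two factors have degrees at most [r + 1] and [r], in all one short of the coefficient. The
    second bound holds because [sS] has no term of degree [r]: the formal monodromy does not move
    with the times. *)
Lemma sTh_tau0 v w nu q : V w.1 -> D q ->
  tau ((r nu).+1 + (r nu).+1) ((xi * sdir (sTh nu) w q - cst (Defs.center w.1 nu) *
      (xi * pder (sTh nu q) - cst (r nu).+1%:R * sTh nu q)) *
    (xi * sS nu v - cst (Defs.center v nu) * sTh nu q)) = 0.
Proof.
move=> Vw Dq; rewrite /tau (@series_mul_high _ _ (r nu).+1 (r nu)) ?mxtrace0 //; last by lia.
- move=> [//|j] jr; rewrite series_addE series_oppE !series_constM series_addE series_oppE.
  rewrite !series_varM series_constM /pder sdir_sTh_high // sTh_high //; last by lia.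
  by rewrite !scaler0 subrr scaler0 subr0.
- move=> [|j] jr; rewrite series_addE series_oppE series_constM series_varM sTh_high //=.
  by rewrite /sS ltnNge -ltnS jr /= scaler0 subr0.
Qed.

Definition form nu w q : A :=
  sTh nu q * (sH nu q * (sdir (sG nu) w q - cst (Defs.center w.1 nu) * pder (sG nu q))).

(** The Euler operator kills constant terms, so the inhomogeneous gauge term [xi^s (eul g) h] starts
    in degree [s + 1]; only [th] contributes to the coefficient of degree [s]. *)
Lemma tau_gauge s (f g h th e : A) : h * g = 1 -> g * h = 1 ->
  f * g = xi ^+ s * eul g + g * th -> tau s (f * e * h) = tau s (th * (h * e)).
Proof.
move=> hg gh fg.
have -> : f = xi ^+ s * (eul g * h) + g * th * h.
  by rewrite (mulrA (xi ^+ s)) -(mulrDl _ _ h) -fg -mulrA gh mulr1.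
rewrite 2!mulrDl tauD.
have -> : xi ^+ s * (eul g * h) * e * h = xi ^+ s * (eul g * h * e * h) by rewrite !mulrA.
rewrite -[X in tau X _ + _]addn0 tau_varX.
have -> : tau 0 (eul g * h * e * h) = 0.
  by rewrite -!mulrA /tau series_mulE big_ord1 /eul scale0r mul0mx mxtrace0.
rewrite add0r -(tau_conj s (th * (h * e)) hg); congr (tau _ _).
by rewrite !mulrA.
Qed.

Lemma residueE nu (f : nat -> C) : residue nu (pole_order r nu) f = orientation nu * f (r nu).
Proof.
by case: nu => [i|] /=; rewrite ?mul1r ?mulN1r ?prednK.
Qed.

Lemma dG_series w q nu : V w.1 -> D q ->
  (dG p G q w nu : A) = sdir (sG nu) w q - cst (Defs.center w.1 nu) * pder (sG nu q).
Proof.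
move=> Vw Dq; apply/funext => k; rewrite series_addE series_oppE series_constM /dG.
rewrite (holomorphic_on_dirder (hG nu k) Vw Dq).
by case: nu => [i|] //=; rewrite !scale0r.
Qed.

Lemma omega_formula w q : V w.1 -> D q ->
  omega p c G q w = \sum_nu tau (r nu) (form nu w q).
Proof.
move=> Vw Dq; apply: eq_bigr => nu _; rewrite residueE.
have -> : orientation nu * \tr (ps_mul (ps_mul (sys_laurent (p q.1) (c q) nu) (dG p G q w nu))
    (ps_inv (G q nu)) (r nu)) = tau (r nu) (sA nu q * dG p G q w nu * sH nu q).
  rewrite /tau -mxtraceZ; congr (\tr _); rewrite series_mulE /ps_mul scaler_sumr.
  apply: eq_bigr => i _; rewrite scalemxAl; congr (_ *m _).
  rewrite series_mulE scaler_sumr; apply: eq_bigr => j _.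
  by rewrite scalemxAl.
rewrite (dG_series nu Vw Dq); exact: tau_gauge (sHG nu Dq) (sGH nu Dq) (sAG nu Dq).
Qed.

Lemma sholo_move nu w : V w.1 ->
  sholo (fun q => sdir (sG nu) w q - cst (Defs.center w.1 nu) * pder (sG nu q)).
Proof.
move=> Vw; apply: (sholoB Vsub TV cov oD); first exact: (sholo_sdir Vsub TV cov oD (sholo_sG nu)).
apply: (sholoM Vsub TV cov oD); first exact: (sholo_cst Vsub TV cov oD).
exact: (sholo_pder Vsub TV cov oD (sholo_sG nu)).
Qed.

Lemma sholo_form nu w : V w.1 -> sholo (form nu w).
Proof.
move=> Vw; apply: (sholoM Vsub TV cov oD (sholo_sTh nu)).
exact: (sholoM Vsub TV cov oD (sholo_sH nu) (sholo_move nu Vw)).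
Qed.

Lemma holo_omega w : V w.1 -> holo p V D (fun q => omega p c G q w).
Proof.
move=> Vw; have H : holo p V D (fun q => \sum_nu tau (r nu) (form nu w q)).
  apply: (holo_sum Vsub TV cov oD) => nu _.
  exact: (holo_tau Vsub TV cov oD _ (sholo_form nu Vw)).
by apply: (holo_eq Vsub TV cov oD H) => q Dq; rewrite omega_formula.
Qed.

Lemma dirder_omega w w' q : V w.1 -> V w'.1 -> D q ->
  dirder p (fun q => omega p c G q w) w' q =
  \sum_nu tau (r nu) (sdir (sTh nu) w' q * (sH nu q *
      (sdir (sG nu) w q - cst (Defs.center w.1 nu) * pder (sG nu q))) +
    sTh nu q * (- (sH nu q * sdir (sG nu) w' q * sH nu q) *
      (sdir (sG nu) w q - cst (Defs.center w.1 nu) * pder (sG nu q)) +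
      sH nu q * (sdir (sdir (sG nu) w) w' q - cst (Defs.center w.1 nu) * pder (sdir (sG nu) w' q)))).
Proof.
move=> Vw Vw' Dq.
have H nu (_ : xpredT nu) : holo p V D (fun q => tau (r nu) (form nu w q)).
  exact: (holo_tau Vsub TV cov oD _ (sholo_form nu Vw)).
have E1 q' : D q' -> \sum_nu tau (r nu) (form nu w q') = omega p c G q' w.
  by move=> Dq'; rewrite omega_formula.
rewrite (dirder_eq Vsub TV cov oD (f := fun q => \sum_nu tau (r nu) (form nu w q))
  (g := fun q => omega p c G q w) (holo_sum Vsub TV cov oD _ H) E1 Vw' Dq).
rewrite (dirder_sum Vsub TV cov oD _ H Vw' Dq); apply: eq_bigr => nu _.
rewrite (dirder_tau Vsub TV cov oD _ (sholo_form nu Vw) Vw' Dq); congr (tau _ _).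
rewrite (sdirM Vsub TV cov oD (sholo_sTh nu)
  (sholoM Vsub TV cov oD (sholo_sH nu) (sholo_move nu Vw)) Vw' Dq); congr (_ + _ * _).
rewrite (sdirM Vsub TV cov oD (sholo_sH nu) (sholo_move nu Vw) Vw' Dq); congr (_ * _ + _ * _).
  exact: (sdir_inv Vsub TV cov oD (sholo_sG nu) (sholo_sH nu) (fun q => @sGH q nu)
    (fun q => @sHG q nu) Vw' Dq).
have h1 : sholo (fun q => cst (Defs.center w.1 nu) * pder (sG nu q)).
  apply: (sholoM Vsub TV cov oD); first exact: (sholo_cst Vsub TV cov oD).
  exact: (sholo_pder Vsub TV cov oD (sholo_sG nu)).
rewrite (sdirB Vsub TV cov oD (sholo_sdir Vsub TV cov oD (sholo_sG nu) Vw) h1 Vw' Dq).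
rewrite (sdirM Vsub TV cov oD (sholo_cst Vsub TV cov oD _)
  (sholo_pder Vsub TV cov oD (sholo_sG nu)) Vw' Dq) sdir_cst mul0r add0r.
by rewrite (sdir_pder Vsub TV cov oD (sholo_sG nu) Vw' Dq).
Qed.

Lemma sdir_sAG w q nu : V w.1 -> D q ->
  sdir (sA nu) w q * sG nu q + sA nu q * sdir (sG nu) w q =
  xi ^+ r nu * eul (sdir (sG nu) w q) + sdir (sG nu) w q * sTh nu q
    + sG nu q * sdir (sTh nu) w q.
Proof.
move=> Vw Dq.
rewrite -(sdirM Vsub TV cov oD (sholo_sA nu) (sholo_sG nu) Vw Dq).
have h1 : sholo (fun q => xi ^+ r nu * eul (sG nu q)).
  apply: (sholoM Vsub TV cov oD); first exact: (sholo_cst Vsub TV cov oD).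
  exact: (sholo_eul Vsub TV cov oD (sholo_sG nu)).
have h2 := sholoM Vsub TV cov oD (sholo_sG nu) (sholo_sTh nu).
have E1 q' : D q' -> xi ^+ r nu * eul (sG nu q') + sG nu q' * sTh nu q' = sA nu q' * sG nu q'.
  by move=> Dq'; rewrite sAG.
rewrite (sdir_eq Vsub TV cov oD (g := fun q => sA nu q * sG nu q)
  (sholoD Vsub TV cov oD h1 h2) E1 Vw Dq).
rewrite (sdirD h1 h2 Vw Dq) (sdirM Vsub TV cov oD (sholo_cst Vsub TV cov oD _)
  (sholo_eul Vsub TV cov oD (sholo_sG nu)) Vw Dq) sdir_cst mul0r add0r.
rewrite (sdir_eul Vsub TV cov oD (sholo_sG nu) Vw Dq) -addrA; congr (_ + _).
exact: (sdirM Vsub TV cov oD (sholo_sG nu) (sholo_sTh nu) Vw Dq).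
Qed.

(** The right-hand side is minus the sum of the residues of [Tr (d_w A U_v)], with [U_v] replaced by
    the expansion [dG G^-1 + G dTheta G^-1] at fixed [z] that the formal solution predicts. As the
    mixed derivatives of [G] are symmetric, the identity holds at each singular point separately. *)
Theorem curvature v w q : V v -> V w.1 -> D q ->
  ext_d p (omega p c G) q (v, 0) w = - \sum_nu tau ((r nu).+1 + (r nu).+1)
    ((xi * sdir (sA nu) w q
        - cst (Defs.center w.1 nu) * (eul (sA nu q) - cst (r nu).+1%:R * sA nu q)) *
     (xi * (xi ^+ r nu * sdir (sG nu) (v, 0) q * sH nu q + sG nu q * sS nu v * sH nu q)
        - cst (Defs.center v nu) * sA nu q)).
Proof.
move=> Vv Vw Dq.
apply: (etrans (congr2 (fun a b : C => a - b) (dirder_omega (w' := (v, 0)) Vw Vv Dq)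
  (dirder_omega (w := (v, 0)) Vv Vw Dq))).
rewrite -sumrB -sumrN; apply: eq_bigr => nu _.
rewrite (sdir_comm Vsub TV cov oD (w1 := (v, 0)) (sholo_sG nu) Vv Vw Dq).
exact: (local_curvature (sdir (sG nu) (v, 0) q) (sdir (sdir (sG nu) w) (v, 0) q) (sHG nu Dq) (sGH nu Dq) (sAG nu Dq)
  (sdir_sAG nu Vw Dq) (sTh_sS_comm v nu Dq) (sS_spec nu Vv Dq) (sTh_tau0 v nu Vw Dq)).
Qed.

End Curvature.
(** * Asymptotics of the canonical solutions *)

Section ComplexExponential.
Variable R : realType.
Local Notation C := (Cx R).

Lemma cexpD (z w : C) : cexp (z + w) = cexp z * cexp w.
Proof.
case: z w => [x y] [x' y']; rewrite /cexp /= expRD cosD sinD.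
by apply/eqP; rewrite eq_complex /=; apply/andP; split; apply/eqP; ring.
Qed.

Lemma cexp0 : cexp (0 : C) = 1.
Proof. by rewrite /cexp /= expR0 cos0 sin0 mulr1 mulr0. Qed.

Lemma cexpN (z : C) : cexp z * cexp (- z) = 1.
Proof. by rewrite -cexpD subrr cexp0. Qed.

Lemma cexp_neq0 (z : C) : cexp z != 0.
Proof. by apply: contra_eqN (cexpN z) => /eqP ->; rewrite mul0r eq_sym oner_eq0. Qed.

Lemma cexpV (z : C) : cexp (- z) = (cexp z)^-1.
Proof. by apply: (mulfI (cexp_neq0 z)); rewrite cexpN mulfV // cexp_neq0. Qed.

Lemma cabs_cexp (z : C) : cabs (cexp z) = expR (complex.Re z).
Proof.
rewrite /cabs normc_def /= !exprMn -mulrDr cos2Dsin2 mulr1.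
by rewrite sqrtr_sqr ger0_norm // expR_ge0.
Qed.

Lemma real_first_order (f : R -> R) (l : R) : is_derive (0 : R) 1 f l ->
  forall e : R, 0 < e -> exists2 r : R, 0 < r &
    forall h, `|h| < r -> `|f h - f 0 - l * h| <= e * `|h|.
Proof.
move=> [df dl] e e0.
have : (fun h => h^-1 *: ((f \o shift 0) (h *: 1) - f 0)) @ 0^' --> l by rewrite -dl; exact: df.
move=> /cvgrPdist_le/(_ _ e0); rewrite near_withinE => /nbhs_ballP[r /= r0 rP].
exists r => // h hr; have [->|h0] := eqVneq h 0; first by rewrite subrr mulr0 subr0 normr0 mulr0.
have := rP h; rewrite /ball /= sub0r normrN => /(_ hr h0).
rewrite -ler_pdivrMr ?normr_gt0 // -normfV -normrM mulrBl mulfK // addr0 distrC.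
by rewrite [h *: 1]mulr1 [_ *: _]mulrC.
Qed.

Lemma cexp_derive0 : is_derive (0 : C) 1 (@cexp R) 1.
Proof.
(* With [d <= e / 16] as precision for the three real functions and [c = |h| < e / 16], the real and
   imaginary parts of the error are at most [4 d c] and [(3 d + 2 c) c], in all less than [e c]. *)
apply/is_deriveP => e e0; have e8 : 0 < Num.min (e / 16%:R) 1 by rewrite lt_min ltr01 andbT divr_gt0 ?ltr0n.
have [r1 r10 H1] := real_first_order (is_derive_expR 0) e8.
have [r2 r20 H2] := real_first_order (is_derive_sin 0) e8.
have [r3 r30 H3] := real_first_order (is_derive_cos 0) e8.
exists (Num.min (Num.min r1 r2) (Num.min r3 (Num.min 1 (e / 16%:R)))); first by rewrite !lt_min r10 r20 r30 ltr01 divr_gt0 ?ltr0n.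
move=> h; rewrite !lt_min => /andP[/andP[hr1 hr2] /andP[hr3 /andP[h1 he]]].
have xh := Re_le_cabs h; have yh := Im_le_cabs h.
rewrite add0r cexp0 mul1r.
have := H1 _ (le_lt_trans xh hr1); have := H2 _ (le_lt_trans yh hr2).
have := H3 _ (le_lt_trans yh hr3).
rewrite expR0 sin0 cos0 oppr0 mul0r addr0 !subr0 !mul1r.
move: (Num.min (e / 16%:R) 1) e8 (ge_min (e / 16%:R) (e / 16%:R) 1) (ge_min 1 (e / 16%:R) 1) => d d0.
rewrite !lexx orbT /= => de d1 cy sy ex.
apply: le_trans (cabs_le _) _.
case: h xh yh h1 he cy sy ex {hr1 hr2 hr3} => x y /=; set c := cabs _ => xh yh c1 ce cy sy ex.
have c0 : 0 <= c by apply: cabs_ge0.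
have x0 := normr_ge0 x; have y0 := normr_ge0 y.
have exB : `|expR x - 1| <= 2 * c.
  have -> : expR x - 1 = (expR x - 1 - x) + x by rewrite subrK.
  apply: le_trans (ler_normD _ _) _; nra.
have eB : `|expR x| <= 3%:R.
  have -> : expR x = (expR x - 1) + 1 by rewrite subrK.
  by apply: le_trans (ler_normD _ _) _; rewrite normr1; lra.
have a1 : `|expR x * cos y - 1 - x| <= 4%:R * d * c.
  have -> : expR x * cos y - 1 - x = expR x * (cos y - 1) + (expR x - 1 - x) by ring.
  apply: le_trans (ler_normD _ _) _; rewrite normrM.
  have h1 := normr_ge0 (expR x); have h2 := normr_ge0 (cos y - 1).
  have k0 : d * `|y| <= d * c by rewrite ler_wpM2l // ltW.
  have k1 : `|expR x| * `|cos y - 1| <= 3%:R * (d * c) by apply: ler_pM => //; exact: le_trans k0.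
  have k2 : d * `|x| <= d * c by rewrite ler_wpM2l // ltW.
  by lra.
have a2 : `|expR x * sin y - 0 - y| <= (3%:R * d + 2 * c) * c.
  have -> : expR x * sin y - 0 - y = expR x * (sin y - y) + (expR x - 1) * y by ring.
  apply: le_trans (ler_normD _ _) _; rewrite !normrM.
  have h1 := normr_ge0 (expR x); have h2 := normr_ge0 (sin y - y); have h3 := normr_ge0 (expR x - 1).
  have k0 : d * `|y| <= d * c by rewrite ler_wpM2l // ltW.
  have k1 : `|expR x| * `|sin y - y| <= 3%:R * (d * c) by apply: ler_pM => //; exact: le_trans k0.
  have k2 : `|expR x - 1| * `|y| <= 2 * c * c by apply: ler_pM.
  by lra.
apply: le_trans (lerD a1 a2) _.
have : (7%:R * d + 2 * c) * c <= e * c by apply: ler_wpM2r => //; lra.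
by lra.
Qed.

Lemma is_derive_cexp (a b x : C) :
  is_derive x 1 (fun h => cexp (a + b * h)) (b * cexp (a + b * x)).
Proof.
have d1 : is_derive (b * 0 : C) 1 (@cexp R) 1 by rewrite mulr0; exact: cexp_derive0.
have d2 := is_derive_mul (is_derive_cst (cexp (a + b * x)) (0 : C) 1) (is_derive_scale d1).
rewrite mul0r add0r mulr1 /cst [_ * b]mulrC in d2.
apply: is_derive_unshift; apply: near_eq_derive0 d2; apply: nearW => h.
by rewrite -cexpD mulrDr addrA.
Qed.

End ComplexExponential.

Section Differentiability.
Variable R : realType.
Local Notation C := (Cx R).

(** Holomorphic functions have derivatives of every order; [cdiff] retains a finite number of them
    on a disc, three being used in Cauchy's estimate. *)
Fixpoint cdiff (k : nat) (r : R) (f : C -> C) : Prop := if k is k'.+1 then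
  exists2 f', (forall h, cabs h < r -> is_derive h 1 f (f' h)) & cdiff k' r f' else True.

Lemma cdiffS k r f : cdiff k.+1 r f -> cdiff k r f.
Proof. by elim: k f => // k IH f [f' df /IH cf']; exists f'. Qed.

Lemma cdiff_cst k r a : cdiff k r (fun=> a).
Proof.
by elim: k a => // k IH a; exists (fun=> 0) => // h _; exact: (is_derive_cst a h 1).
Qed.

Lemma cdiffD k r f g : cdiff k r f -> cdiff k r g -> cdiff k r (fun h => f h + g h).
Proof.
elim: k f g => // k IH f g [f' df cf] [g' dg cg]; exists (fun h => f' h + g' h); last exact: IH.
by move=> h hr; exact: is_derive_add (df h hr) (dg h hr).
Qed.

Lemma cdiffM k r f g : cdiff k r f -> cdiff k r g -> cdiff k r (fun h => f h * g h).
Proof.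
elim: k f g => // k IH f g cf cg; have := (cdiffS cf, cdiffS cg) => -[cf1 cg1].
case: cf cg => [f' df cf] [g' dg cg]; exists (fun h => f' h * g h + f h * g' h).
  by move=> h hr; exact: is_derive_mul (df h hr) (dg h hr).
by apply: cdiffD; exact: IH.
Qed.

Lemma cdiffB k r f g : cdiff k r f -> cdiff k r g -> cdiff k r (fun h => f h - g h).
Proof.
move=> cf cg; have := cdiffD cf (cdiffM (cdiff_cst k r (-1)) cg).
by congr cdiff; apply/funext => h; rewrite mulN1r.
Qed.

Lemma cdiff_sum k r (I : Type) (s : seq I) (P : pred I) (f : I -> C -> C) :
  (forall i, cdiff k r (f i)) -> cdiff k r (fun h => \sum_(i <- s | P i) f i h).
Proof.
move=> cf; elim: s => [|i s IH].
  have -> : (fun h => \sum_(i <- [::] | P i) f i h) = fun=> 0 by apply/funext => h; rewrite big_nil.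
  exact: cdiff_cst.
have -> : (fun h => \sum_(j <- i :: s | P j) f j h) =
    (fun h => (if P i then f i h else 0) + \sum_(j <- s | P j) f j h).
  by apply/funext => h; rewrite big_cons; case: ifP; rewrite ?add0r.
by apply: cdiffD => //; case: (P i) => //; exact: cdiff_cst.
Qed.

Lemma cdiff_cexp k r a b : cdiff k r (fun h => cexp (a + b * h)).
Proof.
suff H c : cdiff k r (fun h => c * cexp (a + b * h)).
  by have := H 1; congr cdiff; apply/funext => h; rewrite mul1r.
elim: k c => // k IH c; exists (fun h => c * b * cexp (a + b * h)) => // h _.
have := is_derive_mul (is_derive_cst c h 1) (is_derive_cexp a b h).
by rewrite mul0r add0r mulrA.
Qed.

Lemma cdiff_continuous r f h : cdiff 1 r f -> cabs h < r -> {for h, continuous f}.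
Proof. by move=> [f' df _] hr; exact: is_derive_cvg (df h hr). Qed.

Lemma cdiff_cauchy r f (h1 l : C) (rho M : R) : cdiff 3 r f -> 0 < rho ->
  (forall h, cabs (h - h1) < rho -> cabs h < r /\ cabs (f h) <= M) ->
  is_derive h1 1 f l -> cabs l <= 8%:R * M / rho.
Proof.
move=> [f1 d1 [f2 d2 [f3 d3 _]]] rho0 H dl.
have Hs h : cabs h < rho -> cabs (h1 + h) < r /\ cabs (f (h1 + h)) <= M.
  by move=> hr; apply: H; rewrite [h1 + h]addrC addrK.
have h1r : cabs h1 < r by apply: (H h1 _).1; rewrite subrr cabs0.
have -> : l = f1 (h1 + 0) by rewrite addr0; exact: is_derive_uniq dl (d1 _ h1r).
apply: (cauchy_estimate (f := fun h => f (h1 + h)) (f1 := fun h => f1 (h1 + h))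
  (f2 := fun h => f2 (h1 + h)) (f3 := fun h => f3 (h1 + h))) => // h /Hs[hr Mh] //.
- by apply: is_derive_shift0; exact: d1.
- by apply: is_derive_shift0; exact: d2.
- by apply: is_derive_shift0; exact: d3.
Qed.

End Differentiability.

(** * Canonical asymptotics along a ray *)

Section Approach.
Variables (R : realType) (N n : nat) (r : option 'I_n -> nat).
Local Notation C := (Cx R).
Local Notation sing := (option 'I_n).
Local Notation times := (times R N r).
Variables (dir : sing -> R) (rho : R).

(* On the bisector of the first Stokes sector. *)
Definition ray_point (nu : sing) (k : nat) : C :=
  ((- (orient R nu * (rho + 1 + k%:R))) +i* (dir nu + pi / (r nu)%:R / 2))%C.

Definition ray_param (nu : sing) (k : nat) : C := local_param nu (ray_point nu k).

Lemma ray_point_Re nu k : orient R nu * complex.Re (ray_point nu k) = - (rho + 1 + k%:R).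
Proof. by rewrite /= mulrN mulrA; case: nu => [i|] /=; rewrite ?mulrNN !mulr1 mul1r. Qed.

Lemma ray_point_near nu k : near_sing rho nu (ray_point nu k).
Proof. by rewrite /near_sing ray_point_Re ltrN2 -addrA ltrDl ltr_pwDl. Qed.

Lemma ray_point_near_all nu (rho' : R) : exists k0, forall k, (k0 <= k)%N ->
  near_sing rho' nu (ray_point nu k).
Proof.
exists (Num.bound (`|rho' - rho|)) => k hk; rewrite /near_sing ray_point_Re ltrN2.
have h1 : `|rho' - rho| < k%:R.
  by apply: lt_le_trans (archi_boundP _) _; rewrite ?ler_nat.
have := ler_norm (rho' - rho); lra.
Qed.

Lemma ray_point_sector nu del k : 0 < del -> (0 < r nu)%N ->
  in_sector r (dir nu) del nu 0 (ray_point nu k).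
Proof.
move=> del0 r0; rewrite /in_sector /= !mul0r addr0 mul1r.
have h : 0 < pi / (r nu)%:R :> R by rewrite divr_gt0 ?pi_gt0 // ltr0n.
by apply/andP; split; lra.
Qed.

Lemma cabs_ray_param nu k : cabs (ray_param nu k) = expR (- (rho + 1)) / expR k%:R.
Proof.
rewrite -expRN -expRD -opprD -(ray_point_Re nu).
by case: nu => [i|]; rewrite /ray_param /= cabs_cexp /= ?mul1r ?mulN1r.
Qed.

Lemma ray_param_neq0 nu k : ray_param nu k != 0.
Proof. by rewrite -cabs_gt0 cabs_ray_param divr_gt0 ?expR_gt0. Qed.

Lemma ray_param_to0 nu (e : R) : 0 < e ->
  exists k0, forall k, (k0 <= k)%N -> cabs (ray_param nu k) < e.
Proof.
move=> e0; have h0 := expR_gt0 (- (rho + 1)).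
exists (Num.bound (expR (- (rho + 1)) / e)) => k hk; rewrite cabs_ray_param.
rewrite ltr_pdivrMr ?expR_gt0 // -ltr_pdivrMl // mulrC.
apply: lt_le_trans (archi_boundP _) _; first by rewrite ltW // divr_gt0.
by apply: (@le_trans _ _ k%:R); rewrite ?ler_nat //; have := expR_ge1Dx (k%:R : R); lra.
Qed.

Lemma ray_param_half nu k : (0 < k)%N -> cabs (ray_param nu k) / cabs (ray_param nu 0) <= 1 / 2.
Proof.
move=> k0; rewrite !cabs_ray_param expR0 divr1 mulrAC mulfV ?gt_eqF ?expR_gt0 // mul1r.
rewrite div1r lef_pV2 ?posrE ?expR_gt0 //.
have := expR_ge1Dx (k%:R : R); have : 1 <= k%:R :> R by rewrite ler1n.
lra.
Qed.

Lemma log_point_near (t : times) nu zeta :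
  log_point t nu zeta = near_point (poles t) nu (local_param nu zeta).
Proof. by case: nu => [i|] //=; rewrite /log_point /= add0r cexpV invrK. Qed.

Lemma eventually_bounded (g : nat -> R) :
  (exists M k0, forall k, (k0 <= k)%N -> g k <= M) -> exists M, forall k, g k <= M.
Proof.
move=> [M [k0 H]]; exists (`|M| + \sum_(i < k0) `|g i|) => k; case: (leqP k0 k) => hk.
  apply: le_trans (H k hk) _; apply: le_trans (ler_norm _) _.
  by rewrite lerDl sumr_ge0.
rewrite (bigD1 (Ordinal hk)) //= addrA [`|M| + _]addrC -addrA.
by apply: le_trans (ler_norm _) _; rewrite lerDl addr_ge0 // sumr_ge0.
Qed.

Lemma geometric_tail (x : R) (K m : nat) : 0 <= x <= 1 / 2 ->
  \sum_(K <= j < K + m) x ^+ j <= 2 * x ^+ K.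
Proof.
move=> /andP[x0 x1].
suff : \sum_(K <= j < K + m) x ^+ j <= 2 * (x ^+ K - x ^+ (K + m)).
  by move/le_trans; apply; have := exprn_ge0 (K + m) x0; lra.
elim: m => [|m IH]; first by rewrite addn0 big_geq // subrr mulr0.
rewrite addnS big_nat_recr ?leq_addr //= exprS.
have : x * x ^+ (K + m) <= 1 / 2 * x ^+ (K + m) by rewrite ler_wpM2r // exprn_ge0.
lra.
Qed.

(** At a Fuchsian point the series is only known to converge at each single point. Its terms at the
    first point are bounded by some [B]; the later points have at most half the modulus, so the tail
    from [K] on is dominated by a geometric sum, at most [2 B (|u k| / |u 0|)^K]. *)
Lemma convergent_tail (a : nat -> C) (u : nat -> C) (S : nat -> C) (K : nat) : (forall k, u k != 0) ->
  (forall k, (0 < k)%N -> cabs (u k) / cabs (u 0%N) <= 1 / 2) ->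
  (forall k, (fun m => \sum_(j < m) u k ^+ j * a j) @ \oo --> S k) ->
  bigO u K (fun k => S k - \sum_(j < K) u k ^+ j * a j).
Proof.
move=> u0 uh cS.
have [B HB] : exists B : R, forall j, cabs (u 0%N ^+ j * a j) <= B.
  apply: eventually_bounded; exists 2.
  have /cvg_cabs/(_ 1 ltr01)[k0 _ H] := cS 0%N; exists k0 => j hj.
  have h1 := H j hj; have h2 := H j.+1 (leqW hj).
  have -> : u 0%N ^+ j * a j = (\sum_(i < j.+1) u 0%N ^+ i * a i - S 0%N)
     - (\sum_(i < j) u 0%N ^+ i * a i - S 0%N).
    by rewrite big_ord_recr /= opprB addrA subrK addrAC subrr add0r.
  by apply: le_trans (cabsB _ _) _; move: h1 h2 => /=; lra.
exists (2 * B / cabs (u 0%N) ^+ K + 1), 1%N => k k0.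
have c0 : 0 < cabs (u 0%N) by rewrite cabs_gt0.
have ck : 0 < cabs (u k) by rewrite cabs_gt0.
have B0 : 0 <= B by apply: le_trans (HB 0%N); exact: cabs_ge0.
pose x := cabs (u k) / cabs (u 0%N).
have x0 : 0 <= x <= 1 / 2 by rewrite uh // divr_ge0 ?ltW.
have T m : cabs (\sum_(j < K + m) u k ^+ j * a j - \sum_(j < K) u k ^+ j * a j) <= 2 * B * x ^+ K.
  have -> : \sum_(j < K + m) u k ^+ j * a j - \sum_(j < K) u k ^+ j * a j =
      \sum_(K <= j < K + m) u k ^+ j * a j.
    rewrite -(big_mkord xpredT (fun j => u k ^+ j * a j)).
    rewrite (big_cat_nat _ (n := K)) ?leq_addr //= big_mkord.
    by rewrite addrAC subrr add0r.
  apply: le_trans (cabs_sum _ _ _) _.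
  have := geometric_tail K m x0; rewrite -(ler_pM2l (x := B + 1)); last by lra.
  have xK : 0 <= x ^+ K by rewrite exprn_ge0 //; case/andP: x0.
  move=> H; apply: (@le_trans _ _ (B * \sum_(K <= j < K + m) x ^+ j)).
    rewrite mulr_sumr; apply: ler_sum => j _.
    have -> : u k ^+ j * a j = (u k / u 0%N) ^+ j * (u 0%N ^+ j * a j).
      by rewrite mulrA -exprMn divfK.
    rewrite cabsM cabsX [cabs (u k / _)]cabsM cabsV -/x [x ^+ j * _]mulrC; apply: ler_wpM2r; last exact: HB.
    by rewrite exprn_ge0 //; case/andP: x0.
  rewrite [2 * B]mulrC -mulrA; apply: ler_wpM2l => //; exact: geometric_tail.
(* A long partial sum is within [|u k|^K] of the limit; this error is the summand 1 in the
   constant. *)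
have eK : 0 < cabs (u k) ^+ K by rewrite exprn_gt0.
have /cvg_cabs/(_ _ eK)[k1 _ H] := cS k.
have := H (K + k1)%N (leq_addl _ _) => /= h1; have := T k1 => h2.
rewrite -(subrK (\sum_(j < K + k1) u k ^+ j * a j) (S k)) -addrA.
apply: le_trans (cabsD _ _) _; rewrite mulrDl mul1r [leRHS]addrC.
apply: lerD; first by rewrite cabsBC; exact: ltW.
by apply: le_trans h2 _; rewrite /x expr_div_n mulrA mulrAC.
Qed.

(** A diagonal entry of [- Theta_nu]: multiplication by its exponential strips a canonical solution
    of its exponential factor. *)
Definition exponent (t : times) (th0 : sing -> 'rV[C]_N) nu (zeta : C) (l : 'I_N) : C :=
  - (- \sum_(k < r nu) theta t th0 nu k.+1 0 l / k.+1%:R * local_param nu zeta ^- k.+1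
     + th0 nu 0 l * (if nu is Some _ then zeta else - zeta)).

Lemma mul_exp_opp_Theta t th0 nu zeta (M : 'M[C]_N) i l :
  (M *m exp_opp_Theta t th0 nu zeta) i l = M i l * cexp (exponent t th0 nu zeta l).
Proof. by rewrite mul_mx_diag !mxE. Qed.

Lemma partial_sum_entry (g : sing -> nat -> 'M[C]_N) nu zeta K i l :
  partial_sum g nu zeta K i l = \sum_(j < K) local_param nu zeta ^+ j * g nu j i l.
Proof. by rewrite /partial_sum summxE; apply: eq_bigr => j _; rewrite mxE. Qed.

Lemma cvg_entry (F : nat -> 'M[C]_N) (L : 'M[C]_N) i l : F @ \oo --> L ->
  (fun m => F m i l) @ \oo --> L i l.
Proof.
move=> /cvgrPdist_lt H; apply/cvg_cabs => e e0; have e0' : 0 < rc e by rewrite rc_lt.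
apply: filterS (H _ e0') => m h; rewrite -rc_lt -normE distrC.
by apply: le_lt_trans h; have := entry_le_norm (L - F m) i l; rewrite !mxE.
Qed.

(** Unites the Fuchsian and the irregular case: along the ray, convergence at each point yields the
    same remainder estimate, through [convergent_tail], as the asymptotics in the sector. *)
Lemma canonical_bigO t th0 (g : sing -> nat -> 'M[C]_N) nu (Phi : C -> 'M[C]_N) K i l :
  is_canonical t th0 g (dir nu) nu 0 rho Phi -> bigO (ray_param nu) K (fun k =>
    Phi (ray_point nu k) i l * cexp (exponent t th0 nu (ray_point nu k) l)
      - \sum_(j < K) ray_param nu k ^+ j * g nu j i l).
Proof.
rewrite /is_canonical; case: eqP => [r0 H|/eqP r0 [del del0 /(_ K)[M [rho' H]]]].
  apply: (@convergent_tail (fun j => g nu j i l) (ray_param nu) (fun k =>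
    Phi (ray_point nu k) i l * cexp (exponent t th0 nu (ray_point nu k) l)) K).
  - exact: ray_param_neq0.
  - exact: ray_param_half.
  move=> k; have := cvg_entry (i := i) (l := l) (H _ (ray_point_near nu k)); rewrite mul_exp_opp_Theta.
  by under [X in X @ _]funext do rewrite partial_sum_entry.
have [k0 H0] := ray_point_near_all nu rho'.
(* The constant [M] is complex; an inequality in [Cx R] includes the one between real parts, so its
   real part serves as the bound. *)
exists (complex.Re M), k0 => k /H0 near'.
have := H _ (ray_point_near nu k) near'; rewrite -lt0n in r0.
move=> /(_ (ray_point_sector k del0 r0)).
move=> h; have := le_trans (entry_le_norm _ i l) h.
rewrite !normE -rcX lecE => /andP[_].
have -> : complex.Re (M * rc (cabs (ray_param nu k) ^+ K)) = complex.Re M * cabs (ray_param nu k) ^+ K.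
  by case: (M) => x y; rewrite /= mulr0 subr0.
by rewrite mx_addE mx_oppE mul_exp_opp_Theta partial_sum_entry.
Qed.

End Approach.
(** * Deformation equations and sums of residues *)

Section DeformationExpansion.
Variables (R : realType) (N : nat).
Local Notation C := (Cx R).
Local Notation A := (series_ring C N).
Local Notation xi := (series_var C N).
Local Notation cst := (@series_const C N).
Variable u : nat -> C.
Hypothesis u_neq0 : forall k, u k != 0.
Hypothesis u_to0 : forall e : R, 0 < e -> exists k0, forall k, (k0 <= k)%N -> cabs (u k) < e.

Lemma mexpands_varX s K (F : nat -> 'M[C]_N) (L : A) : mexpands u K F L ->
  mexpands u K (fun k => u k ^+ s *: F k) (xi ^+ s * L).
Proof.
move=> /(mexpands_shift s) /(mexpands_le u_to0 (leq_addl s K)).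
apply: mexpands_eq; first by exists 0%N.
by move=> j _; rewrite series_varX.
Qed.

Lemma mexpands_series_const a K (F : nat -> 'M[C]_N) (L : A) : mexpands u K F L ->
  mexpands u K (fun k => a *: F k) (cst a * L).
Proof.
move=> /(mexpandsZ a); apply: mexpands_eq; first by exists 0%N.
by move=> j _; rewrite series_constM.
Qed.

Lemma mexpands_deformation (r K : nat) (c : C) (G H G1 S a : A)
    (U M Q Q1 B : nat -> 'M[C]_N) : (0 < K)%N -> G * H = 1 -> H * G = 1 ->
  mexpands u K Q G -> mexpands u K Q1 G1 ->
  (forall k, (U k + c *: M k) *m Q k = Q1 k - Q k *m B k) ->
  (forall k, - (u k ^+ r *: B k) = \sum_(j < K) u k ^+ j *: S j) ->
  mexpands u K (fun k => c *: (u k ^+ r.+1 *: M k)) (cst c * a) ->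
  mexpands u K (fun k => u k ^+ r.+1 *: U k)
    (xi * (xi ^+ r * G1 * H + G * S * H) - cst c * a).
Proof.
move=> K0 GH HG eQ eQ1 UQ BS eM; set Y := _ * H + _ * H.
have eS : mexpands u K (fun k => - (u k ^+ r *: B k)) S.
  by apply: mexpands_eq (mexpands_poly u K S) => //; exists 0%N => k _; rewrite BS.
have eF : mexpands u K (fun k => u k ^+ r *: (U k + c *: M k)) Y.
  apply: (mexpands_cancel u_to0 K0 (Q := Q) (G := G) (H := H)) => //.
  have YG : Y * G = xi ^+ r * G1 + G * S.
    by rewrite /Y mulrDl -!mulrA HG !mulr1.
  rewrite YG; have := mexpandsD (mexpands_varX r eQ1) (mexpandsM u_to0 eQ eS).
  apply: mexpands_eq => //; exists 0%N => k _.
  by rewrite -scalemxAl UQ scalerBr mulmxN -scalemxAr.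
have eF1 := mexpands_varX 1 eF; rewrite expr1 in eF1.
have := mexpandsD eF1 (mexpandsN eM).
apply: mexpands_eq => //; exists 0%N => k _.
rewrite scalerA -exprS scalerDr [u k ^+ r.+1 *: (c *: _)]scalerA mulrC -scalerA.
by rewrite addrK.
Qed.

End DeformationExpansion.

(** * Vanishing of the sum of residues *)

Section Residues.
Variables (R : realType) (N n : nat) (r : option 'I_n -> nat).
Local Notation C := (Cx R).
Local Notation sing := (option 'I_n).
Local Notation times := (times R N r).
Local Notation A := (series_ring C N).
Local Notation xi := (series_var C N).
Local Notation cst := (@series_const C N).
Hypothesis r0 : (0 < r None)%N.
Variable u : sing -> nat -> C.
Hypothesis u_neq0 : forall nu k, u nu k != 0.
Hypothesis u_to0 : forall nu (e : R), 0 < e ->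
  exists k0, forall k, (k0 <= k)%N -> cabs (u nu k) < e.

(** The total power of the local parameter that clears the poles of [d_w A] and of [U]: [r + 2] and
    [r + 1] at a finite point, [r - 1] and [r + 1] at infinity. *)
Definition res_order (nu : sing) : nat := if nu is Some _ then (r nu).*2 + 3 else (r nu).*2.

Lemma residue_sum (t v : times) (c c2 : sing -> nat -> 'M[C]_N) (U : C -> 'M[C]_N)
    (W1 : sing -> A) (K : nat) : injective (poles t) -> rational_at t U ->
  (forall nu, (res_order nu).+2 <= K)%N ->
  (forall nu, mexpands (u nu) K (fun k => u nu k ^+ (r nu).+1 *:
      U (near_point (poles t) nu (u nu k))) (W1 nu)) ->
  \sum_nu tau ((r nu).+1 + (r nu).+1)
    ((xi * (fun k => orientation R nu *: sys_laurent_der t v c c2 nu k)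
       - cst (Defs.center v nu) * (eul (laurent_series t c nu)
           - cst (r nu).+1%:R * laurent_series t c nu)) * W1 nu) = 0.
Proof.
move=> inj rU hK eW.
pose f z := \tr (sys_der t v c c2 z *m U z).
have rf : rational_fun (poles t) f.
  have H : rational_fun (poles t) (fun z => \sum_i \sum_j
      sys_der t v c c2 z i j * U z j i).
    apply: rat_sum => i _; apply: rat_sum => j _; apply: rat_mul => //.
      exact: rational_sys_der.
    exact: rational_at_entry.
  by apply: RatEq H _ => z _; apply: eq_bigr => i _; rewrite mxE.
pose B nu : A := if nu is Some i then
    xi * (sys_laurent_der t v c c2 (Some i) : A) - cst (Defs.center v (Some i)) *
     (eul (sys_laurent t c (Some i) : A) - cst (r (Some i)).+1%:R * (sys_laurent t c (Some i) : A))
  else sys_laurent_der t v c c2 None.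
have eB nu : mexpands (u nu) K (fun k => u nu k ^+ (res_order nu - (r nu).+1) *:
    sys_der t v c c2 (near_point (poles t) nu (u nu k))) (B nu).
  case: nu => [i|] /=.
    have -> : ((r (Some i)).*2 + 3 - (r (Some i)).+1 = (r (Some i)).+2)%N by lia.
    exact: (mexpands_sys_der (u_neq0 _) (u_to0 _) r0 v c c2 i K inj).
  have -> : ((r None).*2 - (r None).+1 = (r None).-1)%N by lia.
  exact: (mexpands_sys_der_infty (u_neq0 _) (u_to0 _) r0 v c c2 K inj).
have hs nu : ((r nu).+1 <= res_order nu)%N by case: nu => [i|] /=; lia.
have ef nu : expands (u nu) (res_order nu).+2 (fun k => u nu k ^+ res_order nu *
    f (near_point (poles t) nu (u nu k))) (fun k => tau k (B nu * W1 nu)).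
  have := expands_trace (mexpandsM (u_to0 nu) (eB nu) (eW nu)).
  move=> /(expands_le (u_to0 nu) (hK nu)).
  apply: expands_ext => // k; rewrite -scalemxAl -scalemxAr scalerA -exprD subnK //.
  by rewrite mxtraceZ.
have s0 i : (0 < res_order (Some i))%N by rewrite /=; lia.
have H := residue_theorem (s := res_order) (L := fun nu k => tau k (B nu * W1 nu)) inj u_neq0 u_to0 rf s0 ef.
pose F nu : C := tau ((r nu).+1 + (r nu).+1)
    ((xi * (fun k => orientation R nu *: sys_laurent_der t v c c2 nu k)
       - cst (Defs.center v nu) * (eul (laurent_series t c nu)
           - cst (r nu).+1%:R * laurent_series t c nu)) * W1 nu).
have e1 i : F (Some i) = tau (res_order (Some i)).-1 (B (Some i) * W1 (Some i)).
  have la : laurent_series t c (Some i) = sys_laurent t c (Some i).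
    by apply/funext => k; rewrite /laurent_series scale1r.
  have ld : (fun k => orientation R (Some i) *: sys_laurent_der t v c c2 (Some i) k) =
      sys_laurent_der t v c c2 (Some i).
    by apply/funext => k; rewrite scale1r.
  have lr : ((r (Some i)).+1 + (r (Some i)).+1 = (res_order (Some i)).-1)%N by rewrite /=; lia.
  by rewrite /F la ld lr.
(* At infinity the coefficient of [1 / z] has index [2 r + 1]. The extra factor [xi] shifts it to
   the common index [2 r + 2], the orientation supplies the sign, and the term in [center] is
   zero. *)
have e2 : F None = - tau (res_order None).+1 (B None * W1 None).
  have ld : (fun k => orientation R (None : sing) *: sys_laurent_der t v c c2 None k) =
      - (sys_laurent_der t v c c2 None : A).
    by apply/funext => k; rewrite series_oppE scaleN1r.
  have lr : ((r None).+1 + (r None).+1 = (res_order None).+2)%N by rewrite /=; lia.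
  have c0 (z : A) : cst (Defs.center v None) * z = 0.
    by apply/funext => j; rewrite series_constM scale0r.
  have tx (g h w : A) k : w = 0 -> tau k.+1 ((xi * - g - w) * h) = - tau k (g * h).
    by move=> ->; rewrite subr0 mulrN mulNr tauN -mulrA tau_var.
  by rewrite /F ld lr; exact: (tx _ _ _ _ (c0 _)).
rewrite -[LHS]/(\sum_nu F nu).
by rewrite sum_option e2 addrC (eq_bigr _ (fun i _ => e1 i)).
Qed.

End Residues.

(** * Flatness along isomonodromic deformations *)

Section Isomonodromy.
Variables (R : realType) (N n : nat) (r : option 'I_n -> nat).
Local Notation C := (Cx R).
Local Notation sing := (option 'I_n).
Local Notation times := (times R N r).
Local Notation V := (@trace_free R N n r).
Local Notation T := (@time_space R N n r).
Local Notation A := (series_ring C N).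
Local Notation xi := (series_var C N).
Local Notation cst := (@series_const C N).

Definition exponent_speed (v : times) nu (zeta : C) (l : 'I_N) : C :=
  \sum_(k < r nu) theta v (fun=> 0) nu k.+1 0 l / k.+1%:R * local_param nu zeta ^- k.+1.

(** At fixed [zeta] the exponent is affine in the times, so along a line the exponential factor has
    the form [cexp (a + b h)]. *)
Lemma exponent_motion (t v : times) th0 nu zeta l (h : C) :
  exponent (t + h *: v) th0 nu zeta l = exponent t th0 nu zeta l + exponent_speed v nu zeta l * h.
Proof.
rewrite /exponent /exponent_speed.
have -> : \sum_(k < r nu) theta (t + h *: v) th0 nu k.+1 0 l / k.+1%:R * local_param nu zeta ^- k.+1
  = \sum_(k < r nu) theta t th0 nu k.+1 0 l / k.+1%:R * local_param nu zeta ^- k.+1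
  + (\sum_(k < r nu) theta v (fun=> 0) nu k.+1 0 l / k.+1%:R * local_param nu zeta ^- k.+1) * h.
  rewrite mulr_suml -big_split; apply: eq_bigr => k _.
  by rewrite !(theta_time _ _ (ltn_ord k)) !mxE /=; ring.
ring.
Qed.

(** Times [xi^r], the derivative of [Theta] is a polynomial of degree less than [r]; hence
    truncation at any [K >= r] is exact, with no remainder to estimate. *)
Lemma speed_series v nu zeta K : local_param nu zeta != 0 -> (r nu <= K)%N ->
  - (local_param nu zeta ^+ r nu *: diag_mx (\row_l exponent_speed v nu zeta l)) =
  \sum_(j < K) local_param nu zeta ^+ j *: sS nu v j.
Proof.
move=> u0 rK; set u := local_param nu zeta.
have -> : \sum_(j < K) u ^+ j *: sS nu v j = \sum_(j < r nu) u ^+ j *: sS nu v j.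
  rewrite (big_ord_widen_cond _ xpredT (fun j => u ^+ j *: sS nu v j) rK) [RHS]big_mkcond /=.
  by apply: eq_bigr => j _; rewrite /sS; case: ifP; rewrite ?scaler0.
rewrite (reindex_inj rev_ord_inj) /=; apply/matrixP => a b.
rewrite summxE !mxE /exponent_speed; have [->|ab] := eqVneq a b; last first.
  rewrite mulr0n mulr0 oppr0 big1 // => k _; rewrite /sS.
  by case: ifP => _; rewrite !mxE ?(negPf ab) ?mulr0n ?mulr0.
rewrite mulr1n mulr_sumr -sumrN; apply: eq_bigr => k _.
have kr : (r nu - k.+1 < r nu)%N by have := ltn_ord k; lia.
rewrite /sS kr subKn // !mxE eqxx mulr1n -/u.
have -> : u ^+ r nu = u ^+ (r nu - k.+1) * u ^+ k.+1 by rewrite -exprD subnK.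
have uk : u ^+ k.+1 != 0 by rewrite expf_neq0.
by field; rewrite uk andbT nat1r pnatr_eq0.
Qed.

Lemma bounded_finite (I : finType) (g : I -> nat -> R) :
  (forall i, exists M, forall k, g i k <= M) -> exists M, forall i k, g i k <= M.
Proof.
move=> /choice[M HM]; exists (\sum_i `|M i|) => i k; apply: le_trans (HM i k) _.
by rewrite (bigD1 i) //=; apply: le_trans (ler_norm _) _; rewrite lerDl sumr_ge0.
Qed.

Hypothesis r0 : (0 < r None)%N.
Variables (X : topologicalType) (p : X -> times) (d : nat).
Local Notation par := 'rV[C]_d.
Variables (W : set (X * par)) (c G : X * par -> sing -> nat -> 'M[C]_N).
Hypotheses (cov : covering_map T p) (oW : open W).
Hypothesis hc : forall nu k, (k < ncoef r nu)%N -> holomorphic_on p V W (fun q => c q nu k).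
Hypothesis hG : forall nu k, holomorphic_on p V W (fun q => G q nu k).
Let Vsub := @trace_free_submodule R N n r.
Let TV := @time_space_open R N n r.

Section Plane.
Variables (q0 : X * par) (v : times) (w0 : times * par) (Q : C -> C -> X * par) (rad : R).
Hypothesis pl : plane_at p W q0 (v, 0) w0 Q rad.
Hypothesis Vv : V v.

Let q h := Q h 0.
Let c00 : cabs (0 : C) < rad. Proof. by rewrite cabs0; exact: plane_gt0 pl. Qed.

Lemma plane_line_in h : cabs h < rad -> W (q h).
Proof. by move=> hr; exact: (plane_in pl). Qed.

Lemma plane_line_fst h : cabs h < rad -> p (q h).1 = p q0.1 + h *: v.
Proof. by move=> hr; rewrite (plane_fst pl) // scale0r addr0. Qed.

Lemma plane_line_derive m l (f : X * par -> 'M[C]_(m, l)) h L i j : cabs h < rad ->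
  is_derive (0 : C) 1 (along p f (v, 0) (q h)) L ->
  is_derive h 1 (fun h => f (q h) i j) (L i j).
Proof.
move=> hr /(is_derive_entry i j) df; apply: is_derive_unshift; apply: near_eq_derive0 df.
have := plane_move1 pl hr c00; apply: filterS => a E1.
by rewrite /along -[(_, _)]/(move p (v, 0) (q h) a) E1.
Qed.

Lemma plane_line_cdiff k (f : X * par -> C) : holo p V W f -> cdiff k rad (fun h => f (q h)).
Proof.
elim: k f => // k IH f hf; exists (fun h => dirder p f (v, 0) (q h)).
  by move=> h hr; exact: (plane_derive1 pl hf Vv hr c00).
by apply: IH; exact: (holo_dirder Vsub TV cov oW (w := (v, 0)) hf Vv).
Qed.

(** The solutions are holomorphic jointly in the point and in [zeta]; a direction with zero
    component in [zeta] keeps [zeta] fixed at every differentiation. *)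
Lemma plane_solution_cdiff rho (nu : sing) (Phi : X * par -> C -> 'M[C]_N) zeta k i l :
  holomorphic_on p V [set y : X * (par * C) | W (y.1, y.2.1) /\ near_sing rho nu y.2.2]
    (fun y : X * (par * C) => Phi (y.1, y.2.1) y.2.2) ->
  near_sing rho nu zeta -> cdiff k rad (fun h => Phi (q h) zeta i l).
Proof.
move=> [S SPhi good] nz.
suff H g : S g -> cdiff k rad (fun h => g ((q h).1, ((q h).2, zeta)) i l).
  have := H _ SPhi; congr cdiff; apply/funext => h /=.
  by rewrite -surjective_pairing.
elim: k g => // k IH g Sg; have [g' Sg' dg] := (good g Sg).2 (v, 0) Vv.
exists (fun h => g' ((q h).1, ((q h).2, zeta)) i l); last exact: IH.
move=> h hr; have Wy : W ((q h).1, (q h).2) by rewrite -surjective_pairing; exact: plane_line_in.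
have /(is_derive_entry i l) := dg ((q h).1, ((q h).2, zeta)) (conj Wy nz).
move=> dg'; apply: is_derive_unshift; apply: near_eq_derive0 dg'.
have := plane_move1 pl hr c00; apply: filterS => a E1.
rewrite /along /= -[q (h + a)]E1 /move /=.
by congr (g (_, (_, _)) i l); rewrite /= ?scaler0 ?addr0.
Qed.

Variables (dir : sing -> R) (rho : R) (th0 : sing -> 'rV[C]_N).
Variables (Phi : sing -> X * par -> C -> 'M[C]_N) (DPhi : sing -> C -> C -> 'M[C]_N).
Hypothesis hPhi : forall nu, holomorphic_on p V
  [set y : X * (par * C) | W (y.1, y.2.1) /\ near_sing rho nu y.2.2]
  (fun y : X * (par * C) => Phi nu (y.1, y.2.1) y.2.2).
Hypothesis canonical : forall h nu, cabs h < rad ->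
  is_canonical (p (q h).1) th0 (G (q h)) (dir nu) nu 0 rho (Phi nu (q h)).
Hypothesis dPhi : forall h nu zeta, cabs h < rad -> near_sing rho nu zeta ->
  is_derive (0 : C) 1 (along p (fun q' => Phi nu q' zeta) (v, 0) (q h)) (DPhi nu h zeta).

Local Notation z := (ray_point r dir rho).
Local Notation u := (ray_param r dir rho).

Definition solution_speed h1 nu k : 'M[C]_N := \matrix_(i, l)
  ((DPhi nu h1 (z nu k) i l + Phi nu (q h1) (z nu k) i l * exponent_speed v nu (z nu k) l)
   * cexp (exponent (p (q h1).1) th0 nu (z nu k) l)).

(* By Baire's theorem the remainders of the canonical asymptotics are uniformly bounded on some
   small disc of deformation parameters; Cauchy's estimate then allows to differentiate them. *)
Lemma differentiated_asymptotics rad' K : 0 < rad' <= rad -> exists h1, cabs h1 < rad' /\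
  forall nu, mexpands (u nu) K (solution_speed h1 nu) (sdir p (sG G nu) (v, 0) (q h1)).
Proof.
move=> /andP[rad0 rad1]; have inr h : cabs h < rad' -> cabs h < rad by move/lt_le_trans; apply.
pose E nu k l h := cexp (exponent (p q0.1) th0 nu (z nu k) l + exponent_speed v nu (z nu k) l * h).
have EE h nu k l : cabs h < rad ->
    cexp (exponent (p (q h).1) th0 nu (z nu k) l) = E nu k l h.
  by move=> hr; rewrite (plane_line_fst hr) exponent_motion.
(* After division by [u^K] the asymptotics at a given [h] says that these numbers are bounded in
   [k]. All singular points and entries are collected in one family, so that a single disc of
   parameters serves them simultaneously. *)
pose f nu i l k h := (Phi nu (q h) (z nu k) i l * E nu k l h
  - \sum_(j < K) u nu k ^+ j * G (q h) nu j i l) / u nu k ^+ K.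
pose I := ((sing * 'I_N * 'I_N) * nat)%type.
pose F (x : I) h := f x.1.1.1 x.1.1.2 x.1.2 x.2 h.
have hGe nu j i l : holo p V W (fun q => G q nu j i l) by exact: holomorphic_on_mholo (hG nu j) i l.
have cF x : cdiff 3 rad (F x).
  apply: cdiffM; last exact: cdiff_cst.
  apply: cdiffB.
    apply: cdiffM; last exact: cdiff_cexp.
    by apply: (plane_solution_cdiff _ _ _ (hPhi _)); exact: ray_point_near.
  apply: cdiff_sum => j; apply: cdiffM; first exact: cdiff_cst.
  exact: (plane_line_cdiff 3 (hGe _ _ _ _)).
have bF h : cabs h < rad' -> exists M, forall x, cabs (F x h) <= M.
  move=> /inr hr.
  have [M HM] : exists M, forall (y : sing * 'I_N * 'I_N) k, cabs (F (y, k) h) <= M.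
    apply: bounded_finite => -[[nu i] l]; apply: eventually_bounded.
    have [M [k0 H]] := canonical_bigO K i l (canonical nu hr).
    exists M, k0 => k /H; rewrite EE // /F /f /= cabsM cabsV cabsX.
    by rewrite ler_pdivrMr // exprn_gt0 // cabs_gt0 ray_param_neq0.
  by exists M => -[y k].
have [|h1 [rh [M [rh0 HM]]]] := osgood rad0 (f := F) _ bF.
  by move=> x h /inr hr; apply: cdiff_continuous hr; do 2 apply: cdiffS; exact: cF.
have h1r : cabs h1 < rad' by apply: (HM h1 _).1; rewrite subrr cabs0.
(* Cauchy's estimate on the disc of radius [rh]: the constant is the same for all [k], which is what
   an expansion of the derivative requires. *)
exists h1; split => // nu i l; exists (8%:R * M / rh), 0%N => k _.
pose L := solution_speed h1 nu k i l - \sum_(j < K) u nu k ^+ j * sdir p (sG G nu) (v, 0) (q h1) j i l.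
have dF : is_derive h1 1 (F (nu, i, l, k)) (L / u nu k ^+ K).
  have d1 := plane_line_derive i l (inr _ h1r) (dPhi (inr _ h1r) (ray_point_near r dir rho nu k)).
  have d2 := is_derive_mul d1 (is_derive_cexp (exponent (p q0.1) th0 nu (z nu k) l)
    (exponent_speed v nu (z nu k) l) h1).
  have d3 : is_derive h1 1 (fun h => \sum_(j < K) u nu k ^+ j * G (q h) nu j i l)
      (\sum_(j < K) u nu k ^+ j * sdir p (sG G nu) (v, 0) (q h1) j i l).
    have h4 (j : 'I_K) (_ : true) : holo p V W (fun q => u nu k ^+ j * G q nu j i l).
      by apply: (holoM Vsub TV cov oW) => //; exact: (holo_cst Vsub TV cov oW).
    have := plane_derive1 pl (holo_sum Vsub TV cov oW (index_enum 'I_K) h4) Vv (inr _ h1r) c00.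
    rewrite (dirder_sum (w := (v, 0)) Vsub TV cov oW _ h4 Vv (plane_line_in (inr _ h1r))).
    congr is_derive; apply: eq_bigr => j _.
    rewrite (dirderZ (w := (v, 0)) Vsub TV cov oW _ (hGe _ _ _ _) Vv (plane_line_in (inr _ h1r))).
    by congr (_ * _); rewrite [RHS]mdirE.
  have d4 := is_derive_lincomb 1 d2 d3.
  have d5 := is_derive_mul d4 (is_derive_cst (u nu k ^- K) h1 1).
  have -> : F (nu, i, l, k) = (fun h => (Phi nu (q h) (z nu k) i l * E nu k l h
    - 1 * \sum_(j < K) u nu k ^+ j * G (q h) nu j i l) * u nu k ^- K).
    by apply/funext => h; rewrite mul1r.
  apply: is_derive_eq d5 _; rewrite mulr0 addr0 mul1r; congr ((_ - _) * _).
  by rewrite /solution_speed mxE EE ?inr // /E; ring.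
have := cdiff_cauchy (cF (nu, i, l, k)) rh0 (fun h hr => conj (inr _ (HM h hr).1) ((HM h hr).2 _)) dF.
rewrite cabsM cabsV cabsX ler_pdivrMr; last by rewrite exprn_gt0 // cabs_gt0 ray_param_neq0.
rewrite /L /poly_part; congr (cabs (_ - _) <= _).
by apply: eq_bigr => j _; rewrite mulrC.
Qed.

End Plane.

Section Flatness.
Variables (mk : marking R n X) (rho : R) (mon : par -> mon_data R N n)
  (Phi : sing -> nat -> X * par -> C -> 'M[C]_N) (U : X * par -> times -> C -> 'M[C]_N).
Hypothesis hPhi : forall nu j, (j <= (r nu).*2)%N -> holomorphic_on p V
  [set y : X * (par * C) | W (y.1, y.2.1) /\ near_sing rho nu y.2.2]
  (fun y : X * (par * C) => Phi nu j (y.1, y.2.1) y.2.2).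
Hypothesis hmon : forall q, W q ->
  has_monodromy p mk rho q.1 (c q) (G q) (fun nu j => Phi nu j q) (mon q.2).
Hypothesis hdef : forall q v, W q -> V v ->
  rational_at (p q.1) (U q v) /\ deformation p c Phi rho q v (U q v).

Let hform q : W q -> exists (W' : set (X * par)) (th0 : par -> sing -> 'rV[C]_N),
  [/\ open W', W' q, W' `<=` W & forall q', W' q' ->
      formal_solution (p q'.1) (c q') (th0 q'.2) (G q')].
Proof.
move=> Wq; exists W, (fun u => md_exponent (mon u)); split => // q' Wq'.
exact: hm_formal (hmon Wq').
Qed.

Lemma flat_nearby q0 v w w0 Q rad rad' : plane_at p W q0 (v, 0) w0 Q rad -> V v -> V w.1 ->
  0 < rad' <= rad ->
  exists h1, cabs h1 < rad' /\ ext_d p (omega p c G) (Q h1 0) (v, 0) w = 0.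
Proof.
move=> pl Vv Vw hrad; have [rad0 rad1] := andP hrad.
(* Large enough to reach, at every singular point, the coefficient that carries the residue. *)
pose K := (\max_nu (res_order r nu).+2)%N.
have hK nu : ((res_order r nu).+2 <= K)%N by exact: leq_bigmax.
pose dir := mk_dir mk; pose th0 := md_exponent (mon q0.2).
pose DPhi nu h zeta := let q := Q h 0 in let z := log_point (p q.1) nu zeta in
  U q v z *m Phi nu 0%N q zeta + Defs.center v nu *: (sys_eval (p q.1) (c q) z *m Phi nu 0%N q zeta).
have c00 : cabs (0 : C) < rad by rewrite cabs0; exact: plane_gt0 pl.
have Qin h : cabs h < rad -> W (Q h 0) by move=> hr; exact: (plane_in pl).
have Qsnd h : (Q h 0).2 = q0.2 by rewrite (plane_snd pl) !scale0r scaler0 !addr0.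
have canonical h nu : cabs h < rad -> is_canonical (p (Q h 0).1) th0 (G (Q h 0)) (dir nu) nu 0 rho
    (Phi nu 0%N (Q h 0)).
  by move=> hr; have := hm_canonical (hmon (Qin h hr)) (leq0n _) (nu := nu); rewrite Qsnd.
have dPhi h nu zeta : cabs h < rad -> near_sing rho nu zeta ->
    is_derive (0 : C) 1 (along p (fun q' => Phi nu 0%N q' zeta) (v, 0) (Q h 0)) (DPhi nu h zeta).
  by move=> hr nz; exact: ((hdef (Qin h hr) Vv).2 nu 0%N zeta (leq0n _) nz).
have [h1 [h1r H]] := differentiated_asymptotics (Phi := fun nu => Phi nu 0%N) pl Vv
  (fun nu => hPhi (leq0n _)) canonical dPhi K hrad.
exists h1; split => //; set q := Q h1 0 in H *.
have h1r' : cabs h1 < rad by exact: lt_le_trans rad1.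
have Wq : W q by exact: Qin.
rewrite (curvature r0 cov oW hc hG hform Vv Vw Wq); apply/eqP; rewrite oppr_eq0; apply/eqP.
have inj : injective (poles (p q.1)) by exact: (poles_inj cov).
pose u := ray_param r dir rho.
have u0 nu : forall k, u nu k != 0 by exact: ray_param_neq0.
have u1 nu := @ray_param_to0 R n r dir rho nu.
pose z nu k := log_point (p q.1) nu (ray_point r dir rho nu k).
have zE nu k : z nu k = near_point (poles (p q.1)) nu (u nu k) by exact: log_point_near.
pose W1 nu : A := xi * (xi ^+ r nu * sdir p (sG G nu) (v, 0) q * sH G nu q
   + sG G nu q * sS nu v * sH G nu q) - cst (Defs.center v nu) * sA p c nu q.
have eW nu : mexpands (u nu) K (fun k => u nu k ^+ (r nu).+1 *:
    U q v (near_point (poles (p q.1)) nu (u nu k))) (W1 nu).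
  pose E k := exp_opp_Theta (p q.1) th0 nu (ray_point r dir rho nu k).
  pose B k : 'M[C]_N := diag_mx (\row_l exponent_speed v nu (ray_point r dir rho nu k) l).
  apply: (mexpands_eq (F := fun k => u nu k ^+ (r nu).+1 *: U q v (z nu k)) (L := W1 nu)) => //.
    by exists 0%N => k _; rewrite zE.
  apply: (mexpands_deformation (u := u nu) (@u1 nu) (r := r nu) (K := K) (c := Defs.center v nu)
    (G := sG G nu q) (H := sH G nu q) (G1 := sdir p (sG G nu) (v, 0) q) (S := sS nu v)
    (a := sA p c nu q) (U := fun k => U q v (z nu k)) (M := fun k => sys_eval (p q.1) (c q) (z nu k))
    (Q := fun k => Phi nu 0%N q (ray_point r dir rho nu k) *m E k)
    (Q1 := solution_speed v Q dir rho th0 (fun nu => Phi nu 0%N) DPhi h1 nu) (B := B)).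
  - by apply: leq_trans (hK None).
  - exact: (sGH hform nu Wq).
  - exact: (sHG hform nu Wq).
  - move=> i l; have := canonical_bigO K i l (canonical _ nu h1r').
    apply: bigO_eq; exists 0%N => k _; rewrite mul_exp_opp_Theta; congr (_ - _).
    by apply: eq_bigr => j _; rewrite mulrC.
  - exact: H.
  - move=> k; apply/matrixP => i l.
    rewrite mulmxA mulmxDl -scalemxAl mul_exp_opp_Theta [RHS]mx_addE mx_oppE.
    have -> : (Phi nu 0%N q (ray_point r dir rho nu k) *m E k *m B k) i l =
        Phi nu 0%N q (ray_point r dir rho nu k) i l *
        cexp (exponent (p q.1) th0 nu (ray_point r dir rho nu k) l) *
        exponent_speed v nu (ray_point r dir rho nu k) l.
      by rewrite mul_mx_diag mxE mul_exp_opp_Theta mxE.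
    by rewrite [X in _ = X - _]mxE /DPhi -/q /z; ring.
  - move=> k; apply: speed_series; first exact: u0.
    by apply: leq_trans (hK nu); case: (nu) => [i|] /=; lia.
  case: (nu) => [i|].
    apply: mexpands_series_const.
    have := mexpands_sys (u0 (Some i)) (@u1 (Some i)) r0 (c q) (Some i) K inj.
    apply: mexpands_eq; first by exists 0%N => k _; rewrite zE.
    by move=> j _; rewrite /sA /laurent_series scale1r.
  (* The velocity of the centre at infinity is zero, so both sides vanish identically. *)
  have := mexpandsZ 0 (mexpands_poly (u None) K (sA p c None q)).
  apply: mexpands_eq; first by exists 0%N => k _; rewrite !scale0r.
  by move=> j _; rewrite series_constM.
have := residue_sum r0 u0 u1 w.1 (c q) (coef_dir p c w q) inj (hdef Wq Vv).1 hK eW.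
under eq_bigr do rewrite -(sdir_sA r0 cov oW hc _ Vw Wq).
by [].
Qed.

End Flatness.

Lemma holo_ext_d w1 w2 : (forall q, W q -> exists (W' : set (X * par)) (th0 : par -> sing -> 'rV[C]_N),
    [/\ open W', W' q, W' `<=` W & forall q', W' q' ->
      formal_solution (p q'.1) (c q') (th0 q'.2) (G q')]) -> V w1.1 -> V w2.1 ->
  holo p V W (fun q => ext_d p (omega p c G) q w1 w2).
Proof.
move=> hform V1 V2; apply: (holoB Vsub TV cov oW).
  exact: (holo_dirder Vsub TV cov oW (holo_omega r0 cov oW hc hG hform V2) V1).
exact: (holo_dirder Vsub TV cov oW (holo_omega r0 cov oW hc hG hform V1) V2).
Qed.

Theorem isomonodromic_flat q0 v w : isomonodromic_on p W c G -> W q0 -> V v -> V w.1 ->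
  ext_d p (omega p c G) q0 (v, 0) w = 0.
Proof.
move=> [mk [rho [mon [Phi [U [_ hPhi hmon hdef]]]]]] Wq Vv Vw.
have hE : holo p V W (fun q => ext_d p (omega p c G) q (v, 0) w).
  apply: holo_ext_d => // q W'q; exists W, (fun u => md_exponent (mon u)); split => // q' Wq'.
  exact: hm_formal (hmon _ Wq').
have [Q [rad pl]] := plane Vsub TV cov oW (w1 := (v, 0)) (w2 := (0, 0)) Wq Vv Vsub.1.
have [//|ne] := eqVneq (ext_d p (omega p c G) q0 (v, 0) w) 0.
have e0 : 0 < cabs (ext_d p (omega p c G) q0 (v, 0) w) / 2.
  by rewrite divr_gt0 // cabs_gt0.
have [s s0 sP] := plane_holo_continuous pl hE e0.
have hr : 0 < Num.min s rad <= rad by rewrite lt_min s0 (plane_gt0 pl) ge_min lexx orbT.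
have [h1 [h1r E1]] := flat_nearby hPhi hmon hdef pl Vv Vw hr.
move: h1r; rewrite lt_min => /andP[h1s _].
have := sP h1 0 h1s; rewrite cabs0 => /(_ s0).
rewrite E1 (plane_center pl) sub0r cabsN; move: e0; move: (cabs _) => a a0 le_a; exfalso; lra.
Qed.

End Isomonodromy.
(** * Descent to the space of monodromy data *)

Section Descent.
Variables (R : realType) (E : normedModType (Cx R)) (X : topologicalType) (p : X -> E).
Local Notation C := (Cx R).
Variables (V T : set E) (P : normedModType (Cx R)) (D : set (X * P)).
Hypotheses (Vsub : submodule V) (TV : open_in V T) (cov : covering_map T p) (oD : open D).
Local Notation holo := (holo p V D).

Let V0 : V 0. Proof. exact: Vsub.1. Qed.
Let Vp x : V (p x). Proof. by apply: TV.1; exact: (covered cov). Qed.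

Lemma nearby_slice x u : D (x, u) -> \forall y \near x, D (y, u).
Proof.
move=> Dxu; have [[B1 B2] /= [nB1 nB2] B12] : nbhs (x, u) D by exact: open_nbhs_nbhs.
by apply: filterS nB1 => y B1y; apply: (B12 (y, u)); split => //=; exact: nbhs_singleton.
Qed.

Lemma nearby_vertical (B : set (X * P)) (x : X) (u : P) : nbhs (x, u) B -> \forall u' \near u, B (x, u').
Proof.
move=> [[B1 B2] /= [nB1 nB2] B12].
by apply: filterS nB2 => y B1y; apply: (B12 (x, y)); split => //=; exact: nbhs_singleton.
Qed.

(** In a chart, [x] and a nearby [y] are joined by the lift of a straight segment, along which [F]
    is differentiated in a pure time direction. *)
Lemma locally_constant F x u : holo F ->
  (forall q v, D q -> V v -> dirder p F (v, 0) q = 0) -> D (x, u) ->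
  \forall y \near x, F (y, u) = F (x, u).
Proof.
move=> hF F0 Dxu; have [s [del ch]] := covering_chart Vsub TV cov x.
have h0 : rnorm (p x - p x) < del by rewrite subrr rnorm0 (chart_gt0 ch).
have := nearby_slice Dxu; rewrite -{1}(chart_center ch).
move=> /(chart_continuous ch (Vp x) h0)[e e0 eP].
have ed : 0 < Num.min e del by rewrite lt_min e0 (chart_gt0 ch).
have [cp _ _] := cov.
have py : \forall y \near x, rnorm (p y - p x) < Num.min e del.
  have := cp x; move=> /(_ [set z | rnorm (z - p x) < Num.min e del]); apply.
  by apply/near_rnorm; exists (Num.min e del).
have := chart_onto ch; apply: filterS2 py => y; rewrite lt_min => /andP[ye yd] [sy _].
pose v := p y - p x; have Vv : V v by apply: (submoduleB Vsub).
have rv h : cabs h <= 1 -> rnorm (p x + h *: v - p x) <= rnorm (p y - p x).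
  move=> h1; rewrite addrC addKr rnormZ.
  by rewrite -[leRHS]mul1r ler_wpM2r // rnorm_ge0.
have Vh h : V (p x + h *: v) by apply: (submoduleD Vsub) => //; exact: (submoduleZ Vsub).
pose phi h := F (s (p x + h *: v), u).
have dphi h : cabs h <= 1 -> is_derive h 1 phi 0.
  move=> h1; have Dh : D (s (p x + h *: v), u) by apply: eP => //; exact: le_lt_trans (rv h h1) ye.
  rewrite -(F0 _ _ Dh Vv); apply: is_derive_unshift.
  apply: near_eq_derive0 (dirder_is_derive hF (w := (v, 0)) Vv Dh).
  have := chart_lift ch (Vh h) (le_lt_trans (rv h h1) yd) Vv; apply: filterS => j.
  by rewrite /along /phi /= => ->; rewrite scaler0 addr0 scalerDl addrA.
have : cabs (phi 1 - phi 0) <= 0 * cabs (1 - 0 : C).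
  apply: (mean_value_bound (f' := fun=> 0)) => t /andP[t0 t1]; rewrite cabs0; split=> //.
  by apply: dphi; rewrite subr0 mulr1 add0r cabs_rc ger0_norm.
rewrite mul0r => H; have : cabs (phi 1 - phi 0) == 0 by rewrite eq_le H cabs_ge0.
rewrite cabs_eq0 subr_eq0 => /eqP; rewrite /phi scale1r scale0r addr0 (chart_center ch).
by rewrite /v addrCA subrr addr0 sy.
Qed.

Definition descends (F : X * P -> C) (g : P -> C) :=
  holo F /\ forall x u, D (x, u) -> g u = F (x, u).

(** The lift in the direction [(0, e)] stays in [D], and [g] ignores its time component; hence the
    difference quotients of [g] are those of [F] along this lift. *)
Lemma descends_derive F g x u e : descends F g -> D (x, u) ->
  is_derive u e g (dirder p F (0, e) (x, u)).
Proof.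
move=> [hF gF] Dxu; pose phi (h : C) := g (u + h *: e).
have : is_derive (0 : C) 1 phi (dirder p F (0, e) (x, u)).
  apply: near_eq_derive0 (dirder_is_derive hF (w := (0, e)) V0 Dxu).
  have := move_near Vsub TV cov oD (w := (0, e)) Dxu V0; apply: filterS => h Dh.
  exact: esym (gF _ _ Dh).
move=> [df dl].
have E1 : (fun h : C => h^-1 *: ((phi \o shift 0) (h *: 1) - phi 0)) =
    (fun h : C => h^-1 *: ((g \o shift u) (h *: e) - g u)).
  apply/funext => h; rewrite /phi /= scale0r !addr0 [u + _]addrC.
  by congr (_ *: (g (_ *: _ + _) - _)); exact: mulr1.
move: df dl; rewrite /derivable /derive E1 => df dl.
exact: (DeriveDef df dl).
Qed.

(** The family of all functions that descend is closed under differentiation, which is what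
    [holomorphic] asks for. *)
Lemma descends_holomorphic F g : descends F g -> holomorphic [set u | exists x, D (x, u)] g.
Proof.
move=> Fg; exists [set g | exists F, descends F g]; first by exists F.
move=> {F Fg} g0 [F [hF gF]]; split=> [u [x Dxu]|e].
  apply/cvg_cabs => e e0.
  have /cvg_cabs/(_ _ e0) := holo_continuous hF Dxu.
  move=> /nearby_vertical; apply: filterS2 (nearby_vertical (open_nbhs_nbhs (conj oD Dxu))) => u' Du'.
  by rewrite -(gF _ _ Dxu) -(gF _ _ Du').
exists (fun u => 'D_e g0 u).
  exists (dirder p F (0, e)); split; first exact: (holo_dirder Vsub TV cov oD (w := (0, e)) hF V0).
  by move=> x u Dxu; have [_ <-] := descends_derive e (conj hF gF) Dxu.
move=> u [x Dxu]; have [df _] := descends_derive e (conj hF gF) Dxu.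
exact: (DeriveDef df erefl).
Qed.

Hypothesis conn : forall u, connected [set x | D (x, u)].

(** The points of the slice where [F] has the same value as at [x], and those where it has another
    value, form two open sets; the slice is connected. *)
Lemma slice_constant F x y u : holo F ->
  (forall q v, D q -> V v -> dirder p F (v, 0) q = 0) -> D (x, u) -> D (y, u) ->
  F (y, u) = F (x, u).
Proof.
move=> hF F0 Dx Dy; pose S (Pr : C -> Prop) := [set z | D (z, u) /\ Pr (F (z, u))].
have oS Pr : open (S Pr).
  rewrite openE => z [Dz Pz]; have := locally_constant hF F0 Dz.
  by apply: filterS2 (nearby_slice Dz) => z' Dz' Fz'; split => //; rewrite Fz'.
have H : S (fun a => a = F (x, u)) = [set x | D (x, u)].
  apply: (conn (u := u)); first by exists x.
    exists (S (fun a => a = F (x, u))) => //; apply/seteqP; split=> z /=; first by case.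
    by move=> [].
  exists (~` S (fun a => a <> F (x, u))); first by rewrite closedC.
  apply/seteqP; split=> z /=; first by move=> [Dz Fz]; split => // -[].
  by move=> [Dz nz]; split => //; apply: contra_notP nz.
by have : [set x | D (x, u)] y by []; rewrite -H => -[].
Qed.

Variable om : X * P -> E * P -> C.
Hypothesis hom : forall w, V w.1 -> holo (om ^~ w).
Hypothesis omL : forall q w1 w2 a, D q -> V w1.1 -> V w2.1 ->
  om q (a *: w1.1 + w2.1, a *: w1.2 + w2.2) = a * om q w1 + om q w2.
Hypothesis flat : forall q v w, D q -> V v -> V w.1 -> ext_d p om q (v, 0) w = 0.

Local Notation curv := (ext_d p om).

Lemma curv_antisym q w1 w2 : curv q w1 w2 = - curv q w2 w1.
Proof. by rewrite /ext_d opprB. Qed.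

Lemma holo_curv w1 w2 : V w1.1 -> V w2.1 -> holo (fun q => curv q w1 w2).
Proof.
move=> V1 V2; apply: (holoB Vsub TV cov oD).
  exact: (holo_dirder Vsub TV cov oD (hom V2) V1).
exact: (holo_dirder Vsub TV cov oD (hom V1) V2).
Qed.

Lemma curv_linear q w w1 w2 a : D q -> V w.1 -> V w1.1 -> V w2.1 ->
  curv q w (a *: w1.1 + w2.1, a *: w1.2 + w2.2) = a * curv q w w1 + curv q w w2.
Proof.
move=> Dq Vw V1 V2.
have ha : holo (fun q => a * om q w1).
  exact: (holoM Vsub TV cov oD (holo_cst Vsub TV cov oD a) (hom V1)).
have E1 q' : D q' -> a * om q' w1 + om q' w2 = om q' (a *: w1.1 + w2.1, a *: w1.2 + w2.2).
  by move=> Dq'; rewrite omL.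
have e1 : dirder p (om ^~ (a *: w1.1 + w2.1, a *: w1.2 + w2.2)) w q =
    a * dirder p (om ^~ w1) w q + dirder p (om ^~ w2) w q.
  rewrite (dirder_eq Vsub TV cov oD (holoD Vsub TV cov oD ha (hom V2)) E1 Vw Dq).
  by rewrite (dirderD ha (hom V2) Vw Dq) (dirderZ Vsub TV cov oD a (hom V1) Vw Dq).
have e2 := dirder_linear Vsub TV cov oD a (hom Vw) V1 V2 Dq.
apply: etrans (congr2 (fun b c : C => b - c) e1 e2) _.
rewrite /ext_d; move: (dirder p (om ^~ w1) w q) (dirder p (om ^~ w2) w q) => x y.
by rewrite mulrBr opprD addrACA.
Qed.

(** By linearity each argument splits into a time part and a vertical part, and [flat] kills the
    former. *)
Lemma curv_vertical q w1 w2 : D q -> V w1.1 -> V w2.1 ->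
  curv q w1 w2 = curv q (0, w1.2) (0, w2.2).
Proof.
have key q' w w' : D q' -> V w.1 -> V w'.1 -> curv q' w w' = curv q' w (0, w'.2).
  move=> Dq' Vw Vw'.
  have := curv_linear (w1 := (w'.1, 0)) (w2 := (0, w'.2)) 1 Dq' Vw Vw' V0.
  rewrite /= !scale1r addr0 add0r mul1r -surjective_pairing => ->.
  by rewrite curv_antisym (flat (w := w) Dq' Vw' Vw) oppr0 add0r.
move=> Dq V1 V2; rewrite (key _ _ _ Dq V1 V2) curv_antisym.
by rewrite (key q (0, w2.2) w1 Dq V0 V1) -curv_antisym.
Qed.

(** The identity [d (d om) = 0] on commuting constant fields: six second derivatives cancel in pairs
    by Schwarz's theorem. *)
Lemma curv_closed q w1 w2 w3 : D q -> V w1.1 -> V w2.1 -> V w3.1 ->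
  dirder p (fun q => curv q w2 w3) w1 q - dirder p (fun q => curv q w1 w3) w2 q
  + dirder p (fun q => curv q w1 w2) w3 q = 0.
Proof.
move=> Dq V1 V2 V3.
have dE a b c : V a.1 -> V b.1 -> V c.1 -> dirder p (fun q => curv q b c) a q =
    dirder p (dirder p (om ^~ c) b) a q - dirder p (dirder p (om ^~ b) c) a q.
  move=> Va Vb Vc.
  exact: (dirderB Vsub TV cov oD (holo_dirder Vsub TV cov oD (hom Vc) Vb)
    (holo_dirder Vsub TV cov oD (hom Vb) Vc) Va Dq).
have alg (a b a' b' a'' b'' : C) : a = a' -> b = a'' -> b' = b'' ->
    (a - b) - (a' - b') + (a'' - b'') = 0 by move=> -> -> ->; ring.
apply: etrans (congr2 (fun a b : C => a + b) (congr2 (fun a b : C => a - b)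
  (dE _ _ _ V1 V2 V3) (dE _ _ _ V2 V1 V3)) (dE _ _ _ V3 V1 V2)) _.
exact: (alg _ _ _ _ _ _ (dirder_comm Vsub TV cov oD (hom V3) V2 V1 Dq)
  (dirder_comm Vsub TV cov oD (hom V2) V3 V1 Dq) (dirder_comm Vsub TV cov oD (hom V1) V3 V2 Dq)).
Qed.

(** Closedness on [(v, 0)], [(0, e1)], [(0, e2)]: its two other terms differentiate components that
    vanish identically by [flat]. *)
Lemma curv_timeless q v e1 e2 : D q -> V v ->
  dirder p (fun q => curv q (0, e1) (0, e2)) (v, 0) q = 0.
Proof.
move=> Dq Vv.
have z w w' : V w.1 -> V w'.1 -> dirder p (fun q => curv q (v, 0) w) w' q = 0.
  move=> Vw Vw'; rewrite -(dirder_cst p 0 w' q).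
  have E1 q' : D q' -> 0 = curv q' (v, 0) w by move=> Dq'; rewrite flat.
  exact: (dirder_eq Vsub TV cov oD (holo_cst Vsub TV cov oD 0) E1 Vw' Dq).
have alg (a b c : C) : a - b + c = 0 -> b = 0 -> c = 0 -> a = 0.
  by move=> H b0 c0; rewrite b0 c0 subr0 addr0 in H.
exact: (alg _ _ _ (curv_closed (w1 := (v, 0)) (w2 := (0, e1)) (w3 := (0, e2)) Dq Vv V0 V0)
  (z (0, e2) (0, e1) V0 V0) (z (0, e1) (0, e2) V0 V0)).
Qed.

(** The value at an arbitrary point of the slice, with default 0 over an empty slice; by
    [vertical_formE] the choice of the point is immaterial. *)
Definition vertical_form (u e1 e2 : P) : C :=
  if pselect (exists x, D (x, u)) is left ex
  then curv (projT1 (cid ex), u) (0, e1) (0, e2) else 0.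

Lemma vertical_formE x u e1 e2 : D (x, u) ->
  vertical_form u e1 e2 = curv (x, u) (0, e1) (0, e2).
Proof.
move=> Dxu; rewrite /vertical_form; case: pselect => [ex|[]]; last by exists x.
apply: (slice_constant (F := fun q => curv q (0, e1) (0, e2))) => //.
- exact: holo_curv.
- by move=> q v Dq Vv; exact: curv_timeless.
- by case: (cid ex).
Qed.

Lemma vertical_form_descends e1 e2 :
  descends (fun q => curv q (0, e1) (0, e2)) (fun u => vertical_form u e1 e2).
Proof. by split; [exact: holo_curv | move=> x u; exact: vertical_formE]. Qed.

Theorem vertical_form_closed : closed_2form [set u | exists x, D (x, u)] vertical_form.
Proof.
split.
- move=> u e [x Dxu] a e1 e2; rewrite !(vertical_formE _ _ Dxu).
  have := curv_linear (w := (0, e)) (w1 := (0, e1)) (w2 := (0, e2)) a Dxu V0 V0 V0.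
  by rewrite /= scaler0 addr0.
- by move=> u e1 e2 [x Dxu]; rewrite !(vertical_formE _ _ Dxu) curv_antisym.
- by move=> e1 e2; exact: descends_holomorphic (vertical_form_descends e1 e2).
- move=> u e1 e2 e3 [x Dxu].
  have dE a b c : 'D_a ((fun u' => vertical_form u' b c) : P -> Cx R) u =
      dirder p (fun q => curv q (0, b) (0, c)) (0, a) (x, u).
    by have [_ ->] := descends_derive a (vertical_form_descends b c) Dxu.
  apply: etrans (congr2 (fun a b : C => a + b) (congr2 (fun a b : C => a - b)
    (dE e1 e2 e3) (dE e2 e1 e3)) (dE e3 e1 e2)) _.
  exact: (curv_closed (w1 := (0, e1)) (w2 := (0, e2)) (w3 := (0, e3)) Dxu V0 V0 V0).
Qed.

End Descent.

(** * Linearity of omega and conclusion *)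

Section OmegaLinear.
Variables (R : realType) (N n : nat) (r : option 'I_n -> nat).
Local Notation C := (Cx R).
Local Notation sing := (option 'I_n).
Local Notation times := (times R N r).
Local Notation V := (@trace_free R N n r).
Local Notation T := (@time_space R N n r).
Local Notation A := (series_ring C N).
Local Notation cst := (@series_const C N).
Hypothesis r0 : (0 < r None)%N.
Variables (X : topologicalType) (p : X -> times) (d : nat).
Local Notation par := 'rV[C]_d.
Variables (D : set (X * par)) (c G : X * par -> sing -> nat -> 'M[C]_N).
Hypotheses (cov : covering_map T p) (oD : open D).
Let Vsub := @trace_free_submodule R N n r.
Let TV := @time_space_open R N n r.
Hypothesis hG : forall nu k, holomorphic_on p V D (fun q => G q nu k).
Hypothesis hform : forall q, D q -> exists (W : set (X * par)) (th0 : par -> sing -> 'rV[C]_N),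
  [/\ open W, W q, W `<=` D & forall q', W q' ->
      formal_solution (p q'.1) (c q') (th0 q'.2) (G q')].

Lemma tau_linear k (th h x y z : A) (a b e : C) :
  tau k (th * (h * (cst a * x + y - cst (a * b + e) * z))) =
  a * tau k (th * (h * (x - cst b * z))) + tau k (th * (h * (y - cst e * z))).
Proof.
have cL (f g : A) : f * (cst a * g) = cst a * (f * g).
  by rewrite mulrA -series_const_comm -mulrA.
have -> : cst a * x + y - cst (a * b + e) * z = cst a * (x - cst b * z) + (y - cst e * z).
  apply/funext => j; rewrite !(series_addE, series_oppE, series_constM).
  by rewrite scalerBr scalerA scalerDl opprD addrACA.
by rewrite 2!mulrDr 2!cL tauD tau_const.
Qed.

Lemma omega_linear q w1 w2 a : D q -> V w1.1 -> V w2.1 ->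
  omega p c G q (a *: w1.1 + w2.1, a *: w1.2 + w2.2) = a * omega p c G q w1 + omega p c G q w2.
Proof.
move=> Dq V1 V2; pose w : times * par := (a *: w1.1 + w2.1, a *: w1.2 + w2.2).
have Vw : V w.1 by exact: Vsub.2.
rewrite (omega_formula r0 hG hform (w := w) Vw Dq) (omega_formula r0 hG hform V1 Dq).
rewrite (omega_formula r0 hG hform V2 Dq) mulr_sumr -big_split; apply: eq_bigr => nu _ /=.
have e1 : sdir p (sG G nu) w q = cst a * sdir p (sG G nu) w1 q + sdir p (sG G nu) w2 q.
  apply/funext => k; rewrite series_addE series_constM.
  exact: (mdir_linear Vsub TV cov oD a (holomorphic_on_mholo (hG nu k)) V1 V2 Dq).
have e2 : Defs.center w.1 nu = a * Defs.center w1.1 nu + Defs.center w2.1 nu.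
  by case: nu {e1} => [i|] /=; rewrite ?mxE ?mulr0 ?addr0.
by rewrite /form e1 e2; exact: tau_linear.
Qed.

End OmegaLinear.

Theorem theorem4p2 (R : realType) (N n m : nat) (r : option 'I_n -> nat)
    (hm : (m <= n)%N)
    (hr : forall i : 'I_n, (0 < r (Some i))%N = (i < m)%N)
    (hinf : (0 < r None)%N)
    (X : topologicalType) (p : X -> times R N r)
    (hp : universal_cover R (time_space (r := r)) p)
    (d : nat) (D : set (X * 'rV[Cx R]_d))
    (A G : X * 'rV[Cx R]_d -> option 'I_n -> nat -> 'M[Cx R]_N)
    (hA : isomonodromic_family p D A G) :
  exists Om : 'rV[Cx R]_d -> 'rV[Cx R]_d -> 'rV[Cx R]_d -> Cx R,
    closed_2form [set u | exists x, D (x, u)] Om /\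
    forall (q : X * 'rV[Cx R]_d) (w1 w2 : times R N r * 'rV[Cx R]_d),
      D q -> trace_free w1.1 -> trace_free w2.1 ->
      ext_d p (omega p A G) q w1 w2 = Om q.2 w1.2 w2.2.
Proof.
have [cov _] := hp; have [oD conn hc hG iso] := hA.
have Vsub := @trace_free_submodule R N n r; have TV := @time_space_open R N n r.
have hform q : D q -> exists (W : set (X * 'rV[Cx R]_d)) (th0 : 'rV[Cx R]_d -> _ -> 'rV[Cx R]_N),
    [/\ open W, W q, W `<=` D & forall q', W q' ->
        formal_solution (p q'.1) (A q') (th0 q'.2) (G q')].
  move=> /iso[W [oW Wq WD [mk [rho [mon [Phi [U [_ _ hmon _]]]]]]]].
  exists W, (fun u => md_exponent (mon u)); split => // q' Wq'.
  exact: hm_formal (hmon _ Wq').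
have hom w : trace_free w.1 -> holo p (@trace_free R N n r) D (fun q => omega p A G q w).
  by move=> Vw; exact: (holo_omega hinf cov oD hc hG hform Vw).
have omL q w1 w2 a : D q -> trace_free w1.1 -> trace_free w2.1 ->
    omega p A G q (a *: w1.1 + w2.1, a *: w1.2 + w2.2) = a * omega p A G q w1 + omega p A G q w2.
  by move=> Dq V1 V2; exact: (omega_linear hinf cov oD hG hform a Dq V1 V2).
have flat q v w : D q -> trace_free v -> trace_free w.1 -> ext_d p (omega p A G) q (v, 0) w = 0.
  (* Isomonodromy is a local condition, so the argument runs on the neighbourhood [W], to which the
     holomorphy of the coefficients and of [G] restricts; [ext_d] at [q] does not refer to the
     domain. *)
  move=> /iso[W [oW Wq WD isoW]] Vv Vw; apply: (isomonodromic_flat hinf cov oW) isoW Wq Vv Vw.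
    by move=> nu k /hc; exact: holomorphic_on_sub.
  by move=> nu k; exact: holomorphic_on_sub (hG nu k).
exists (vertical_form p D (omega p A G)); split.
  exact: (vertical_form_closed Vsub TV cov oD conn hom omL flat).
move=> [x u] w1 w2 Dq V1 V2.
rewrite (vertical_formE Vsub TV cov oD conn hom flat _ _ Dq).
exact: (curv_vertical Vsub TV cov oD hom omL flat Dq V1 V2).
Qed.
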